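(* Let $d=3$ (so $W$ is of type $A_2$, $\mathbb{C}[\mathcal{C}]=\mathbb{C}[A]$). The $\mathbb{C}[A]$-algebra $\mathbb{C}[\mathcal{Z}^{\mu_2}]$ admits the following presentation: generators $q,Q,\mathrm{eu}$ (the images of $q,Q,\mathbf{eu}\in Z$); relations $$q(\mathrm{eu}^2-9A^2-4qQ)=0,\qquad \mathrm{eu}(\mathrm{eu}^2-9A^2-4qQ)=0,\qquad Q(\mathrm{eu}^2-9A^2-4qQ)=0.$$ In particular, if $c\in\mathcal{C}$ and $a=c_s\ne0$, then the variety $\mathcal{Z}_c^{\mu_2}$ has two irreducible components: (1) a component of dimension $2$ defined by the equation $\mathrm{eu}^2-9a^2-4qQ=0$ (which contains the points $z_{\mathbf 1}$ and $z_\varepsilon$); (2) an isolated point, which is equal to $z_{\chi_1}$.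
   Context: Let $d=3$ and let $\zeta$ be a primitive $d$-th root of unity. $V=\mathbb{C}^2$ has canonical basis $(x,y)$, $V^*$ dual basis $(X,Y)$; $\mathbb{C}[V]=\mathbb{C}[X,Y]$, $\mathbb{C}[V^*]=\mathbb{C}[x,y]$. For $i\in\mathbb{Z}/d\mathbb{Z}$, $s_i=\begin{pmatrix}0&\zeta^i\\ \zeta^{-i}&0\end{pmatrix}$, $\alpha_i^\vee=\zeta^ix-y$, $\alpha_i=X-\zeta^iY$; $s=s_0$, $t=s_1$, $W=\langle s,t\rangle$, $\mathrm{Ref}(W)=\{s_i\}$. $\mathcal{C}$ is the space of functions $\mathrm{Ref}(W)\to\mathbb{C}$ constant on conjugacy classes, $C_i\in\mathcal{C}^*$ is evaluation at $s_i$, $A=C_0$ (all $C_i$ equal $A$ here). The irreducible characters of $W$ are the trivial one $\mathbf 1$, $\varepsilon=\det$, and $\chi_1$, the character of $W\subset\mathrm{GL}_2(\mathbb{C})$. $\mathbf{H}$ (generic rational Cherednik algebra at $t=0$) is the quotient of $\mathbb{C}[\mathcal{C}]\otimes(T(V\oplus V^* )\rtimes W)$ by $[u,u']=[U,U']=0$, $[u,U]=-2\sum_iC_i\frac{\langle u,\alpha_i\rangle\langle\alpha_i^\vee,U\rangle}{\langle\alpha_i^\vee,\alpha_i\rangle}s_i$ ($u,u'\in V$, $U,U'\in V^*$); $Z$ is its centre. For $c\in\mathcal{C}$, $\mathbf{H}_c=\mathbf{H}/(C_i-c_{s_i})_i\mathbf{H}$, with centre $Z_c=Z/(C_i-c_{s_i})_iZ$.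 $\mathcal{Z}$ and $\mathcal{Z}_c$ are the affine varieties with algebras of regular functions $Z$ and $Z_c$. Multiplication gives $\mathbb{C}[\mathcal{C}]\otimes\mathbb{C}[V]\otimes\mathbb{C}W\otimes\mathbb{C}[V^*]\cong\mathbf{H}$; $\mathrm{Trunc}$ takes the coefficient of $1\in W$ and restricts to a bijection $Z\cong\mathbb{C}[\mathcal{C}\times V\times V^*]^W$. $q=xy$, $Q=XY$ lie in $Z$ and $\mathbf{eu}=\mathrm{Trunc}^{-1}(xX+yY)$. $\xi\in\mathbb{C}^\times$ acts on $\mathbf{H}$ by $\xi^{-1}$ on $V$, $\xi$ on $V^*$, trivially on $W$ and $\mathcal{C}^*$; this induces actions on $\mathcal{Z}$ and $\mathcal{Z}_c$. $\mu_m$ is the group of $m$-th roots of unity, and fixed point varieties carry their reduced structure. For $\chi\in\mathrm{Irr}(W)$, $z_\chi\in\mathcal{Z}_c$ is the point corresponding to the character by which $Z_c$ acts on $\mathcal{L}_c(\chi)$, the unique simple quotient of the baby Verma module $\overline{\mathbf{H}}_c\otimes_{\overline{\mathbf H}_c^-}E_\chi$, where $\overline{\mathbf{H}}_c$ is the quotient of $\mathbf{H}_c$ by the ideal generated by the elements of $\mathbb{C}[V]^W$ and $\mathbb{C}[V^*]^W$ with zero constant term, $\overline{\mathbf H}_c^-$ is its subalgebra generated by $V$ and $W$, and $V$ acts by $0$ on the representation $E_\chi$ of character $\chi$. *)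

(* Defs.v *)
From HB Require Import structures.
From mathcomp Require Import all_boot all_order all_algebra.
From mathcomp Require Import boolp classical_sets reals.
From mathcomp Require Import -(notations) monalg.
From mathcomp Require Import complex mpoly.

Set Implicit Arguments.
Unset Strict Implicit.
Unset Printing Implicit Defensive.

Import GRing.Theory.
Local Open Scope classical_set_scope.
Local Open Scope ring_scope.

(* Quotient of a ring by the two-sided ideal generated by G. *)
Section QuotRing.
Variables (A : pzRingType) (G : set A).

Definition ideal2 : set A :=
  [set h | exists2 s : seq (A * A * A), (forall u, u \in s -> G u.1.2)
           & h = \sum_(u <- s) u.1.1 * u.1.2 * u.2].

Lemma ideal2_0 : ideal2 0.
Proof. by exists [::]; rewrite ?big_nil. Qed.

Lemma ideal2D x y : ideal2 x -> ideal2 y -> ideal2 (x + y).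
Proof.
move=> [s Gs ->] [t Gt ->]; exists (s ++ t); last by rewrite big_cat.
by move=> u; rewrite mem_cat => /orP[/Gs|/Gt].
Qed.

Lemma ideal2Ml a x : ideal2 x -> ideal2 (a * x).
Proof.
move=> [s Gs ->]; exists [seq (a * u.1.1, u.1.2, u.2) | u <- s].
  by move=> _ /mapP[u us ->]; exact: (Gs _ us).
by rewrite big_map mulr_sumr; apply: eq_bigr => u _; rewrite !mulrA.
Qed.

Lemma ideal2Mr a x : ideal2 x -> ideal2 (x * a).
Proof.
move=> [s Gs ->]; exists [seq (u.1.1, u.1.2, u.2 * a) | u <- s].
  by move=> _ /mapP[u us ->]; exact: (Gs _ us).
by rewrite big_map mulr_suml; apply: eq_bigr => u _; rewrite !mulrA.
Qed.

Lemma ideal2N x : ideal2 x -> ideal2 (- x).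
Proof. by rewrite -mulN1r; exact: ideal2Ml. Qed.

Lemma ideal2_gen x : G x -> ideal2 x.
Proof.
move=> Gx; exists [:: (1, x, 1)]; last by rewrite big_seq1 mul1r mulr1.
by move=> u; rewrite inE => /eqP ->.
Qed.

Definition ideal2_pred : {pred A} := fun h => `[< ideal2 h >].

Lemma ideal2_zmod_closed : zmod_closed ideal2_pred.
Proof.
split; first by apply/asboolP; exact: ideal2_0.
move=> x y /asboolP Ix /asboolP Iy; apply/asboolP.
by apply: ideal2D => //; exact: ideal2N.
Qed.

HB.instance Definition _ :=
  GRing.isZmodClosed.Build A ideal2_pred ideal2_zmod_closed.

Definition quotRing : Type := Quotient.quot ideal2_pred.

HB.instance Definition _ := GRing.Zmodule.on quotRing.

Definition quotR (x : A) : quotRing := \pi_(Quotient.quot ideal2_pred)%qT x.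

Lemma quotR_eq x y : quotR x = quotR y <-> ideal2 (x - y).
Proof.
split=> [/eqP|Ixy].
  by rewrite /quotR -Quotient.idealrBE => /asboolP.
by apply/eqP; rewrite /quotR -Quotient.idealrBE; apply/asboolP.
Qed.

Lemma quotR_repr (x : quotRing) : quotR (repr x) = x.
Proof. by rewrite /quotR reprK. Qed.

Lemma quotR_surj (x : quotRing) : exists y, x = quotR y.
Proof. by exists (repr x); rewrite quotR_repr. Qed.

Lemma quotR_zmod_morphism : zmod_morphism quotR.
Proof. by move=> x y; rewrite /quotR raddfB. Qed.

HB.instance Definition _ :=
  GRing.isZmodMorphism.Build A quotRing quotR quotR_zmod_morphism.

Definition quotR_one : quotRing := quotR 1.
Definition quotR_mul : quotRing -> quotRing -> quotRing :=
  locked (fun x y => quotR (repr x * repr y)).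

Lemma quotR_mulE x y : quotR_mul (quotR x) (quotR y) = quotR (x * y).
Proof.
rewrite /quotR_mul -lock; apply/quotR_eq; set x' := repr _; set y' := repr _.
have Ix : ideal2 (x' - x) by apply/quotR_eq; rewrite quotR_repr.
have Iy : ideal2 (y' - y) by apply/quotR_eq; rewrite quotR_repr.
have -> : x' * y' - x * y = (x' - x) * y' + x * (y' - y).
  by rewrite mulrBl mulrBr addrA subrK.
by apply: ideal2D; [exact: ideal2Mr|exact: ideal2Ml].
Qed.

Lemma quotR_mulA : associative quotR_mul.
Proof.
move=> x y z; rewrite -(quotR_repr x) -(quotR_repr y) -(quotR_repr z).
by rewrite !quotR_mulE mulrA.
Qed.
Lemma quotR_mul1 : left_id quotR_one quotR_mul.
Proof. by move=> x; rewrite -(quotR_repr x) quotR_mulE mul1r. Qed.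
Lemma quotR_mulr1 : right_id quotR_one quotR_mul.
Proof. by move=> x; rewrite -(quotR_repr x) quotR_mulE mulr1. Qed.
Lemma quotR_mulDl : left_distributive quotR_mul +%R.
Proof.
move=> x y z; rewrite -(quotR_repr x) -(quotR_repr y) -(quotR_repr z).
by rewrite -raddfD !quotR_mulE mulrDl raddfD.
Qed.
Lemma quotR_mulDr : right_distributive quotR_mul +%R.
Proof.
move=> x y z; rewrite -(quotR_repr x) -(quotR_repr y) -(quotR_repr z).
by rewrite -raddfD !quotR_mulE mulrDr raddfD.
Qed.

HB.instance Definition _ := GRing.Zmodule_isPzRing.Build quotRing
  quotR_mulA quotR_mul1 quotR_mulr1 quotR_mulDl quotR_mulDr.

Lemma quotR_monoid_morphism : monoid_morphism quotR.
Proof. by split=> // x y; rewrite -quotR_mulE. Qed.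

HB.instance Definition _ :=
  GRing.isMonoidMorphism.Build A quotRing quotR quotR_monoid_morphism.

Lemma quotR_eq0 x : quotR x = 0 <-> ideal2 x.
Proof. by rewrite -[0](rmorph0 quotR) quotR_eq subr0. Qed.

Section Lift.
Variables (B : pzRingType) (f : {rmorphism A -> B}).
Hypothesis fG : forall x, G x -> f x = 0.

Lemma ideal2_ker x : ideal2 x -> f x = 0.
Proof.
move=> [s Gs ->]; rewrite rmorph_sum big_seq big1 // => u us.
by rewrite !rmorphM /= (fG (Gs u us)) mulr0 mul0r.
Qed.

Definition quotR_lift (x : quotRing) : B := f (repr x).

Lemma quotR_liftE x : quotR_lift (quotR x) = f x.
Proof.
apply/eqP; rewrite -subr_eq0 -rmorphB; apply/eqP/ideal2_ker/quotR_eq.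
exact: quotR_repr.
Qed.

Lemma quotR_lift_zmod : zmod_morphism quotR_lift.
Proof.
move=> x y; rewrite -(quotR_repr x) -(quotR_repr y) -rmorphB !quotR_liftE.
by rewrite rmorphB.
Qed.

Lemma quotR_lift_monoid : monoid_morphism quotR_lift.
Proof.
split; first by rewrite -(rmorph1 quotR) quotR_liftE rmorph1.
move=> x y; rewrite -(quotR_repr x) -(quotR_repr y) -rmorphM !quotR_liftE.
by rewrite rmorphM.
Qed.

Definition quotR_liftM : {rmorphism quotRing -> B} :=
  HB.pack quotR_lift
    (GRing.isZmodMorphism.Build _ _ quotR_lift quotR_lift_zmod)
    (GRing.isMonoidMorphism.Build _ _ quotR_lift quotR_lift_monoid).

Lemma quotR_liftME x : quotR_liftM (quotR x) = f x.
Proof. exact: quotR_liftE. Qed.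

End Lift.
End QuotRing.

(* Quotient of a left module by the submodule generated by G. *)
Section QuotMod.
Variables (A : pzRingType) (M : lmodType A) (G : set M).

Definition submod : set M :=
  [set v | exists2 s : seq (A * M), (forall u, u \in s -> G u.2)
           & v = \sum_(u <- s) u.1 *: u.2].

Lemma submod_0 : submod 0.
Proof. by exists [::]; rewrite ?big_nil. Qed.

Lemma submodD x y : submod x -> submod y -> submod (x + y).
Proof.
move=> [s Gs ->] [t Gt ->]; exists (s ++ t); last by rewrite big_cat.
by move=> u; rewrite mem_cat => /orP[/Gs|/Gt].
Qed.

Lemma submodZ a x : submod x -> submod (a *: x).
Proof.
move=> [s Gs ->]; exists [seq (a * u.1, u.2) | u <- s].
  by move=> _ /mapP[u us ->]; exact: (Gs _ us).
by rewrite big_map scaler_sumr; apply: eq_bigr => u _; rewrite scalerA.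
Qed.

Definition submod_pred : {pred M} := fun h => `[< submod h >].

Lemma submod_zmod_closed : zmod_closed submod_pred.
Proof.
split; first by apply/asboolP; exact: submod_0.
move=> x y /asboolP Ix /asboolP Iy; apply/asboolP.
by apply: submodD => //; rewrite -scaleN1r; exact: submodZ.
Qed.

HB.instance Definition _ :=
  GRing.isZmodClosed.Build M submod_pred submod_zmod_closed.

Definition quotMod : Type := Quotient.quot submod_pred.

HB.instance Definition _ := GRing.Zmodule.on quotMod.

Definition quotM (x : M) : quotMod := \pi_(Quotient.quot submod_pred)%qT x.

Lemma quotM_eq x y : quotM x = quotM y <-> submod (x - y).
Proof.
split=> [/eqP|Ixy].
  by rewrite /quotM -Quotient.idealrBE => /asboolP.
by apply/eqP; rewrite /quotM -Quotient.idealrBE; apply/asboolP.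
Qed.

Lemma quotM_repr (x : quotMod) : quotM (repr x) = x.
Proof. by rewrite /quotM reprK. Qed.

Lemma quotM_zmod_morphism : zmod_morphism quotM.
Proof. by move=> x y; rewrite /quotM raddfB. Qed.

HB.instance Definition _ :=
  GRing.isZmodMorphism.Build M quotMod quotM quotM_zmod_morphism.

Definition quotM_scale : A -> quotMod -> quotMod :=
  locked (fun a x => quotM (a *: repr x)).

Lemma quotM_scaleE a x : quotM_scale a (quotM x) = quotM (a *: x).
Proof.
rewrite /quotM_scale -lock; apply/quotM_eq; rewrite -scalerBr; apply: submodZ.
by apply/quotM_eq; rewrite quotM_repr.
Qed.

Lemma quotM_scaleA a b v :
  quotM_scale a (quotM_scale b v) = quotM_scale (a * b) v.
Proof. by rewrite -(quotM_repr v) !quotM_scaleE scalerA. Qed.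
Lemma quotM_scale1 : left_id 1 quotM_scale.
Proof. by move=> v; rewrite -(quotM_repr v) quotM_scaleE scale1r. Qed.
Lemma quotM_scaleDr : right_distributive quotM_scale +%R.
Proof.
move=> a v w; rewrite -(quotM_repr v) -(quotM_repr w).
by rewrite -raddfD !quotM_scaleE scalerDr raddfD.
Qed.
Lemma quotM_scaleDl v : {morph quotM_scale^~ v : a b / a + b}.
Proof. by move=> a b; rewrite -(quotM_repr v) !quotM_scaleE scalerDl raddfD. Qed.

HB.instance Definition _ := GRing.Zmodule_isLmodule.Build A quotMod
  quotM_scaleA quotM_scale1 quotM_scaleDr quotM_scaleDl.

Lemma quotM_scalable : scalable quotM.
Proof. by move=> a x; rewrite -quotM_scaleE. Qed.

HB.instance Definition _ :=
  GRing.isScalable.Build A M quotMod *:%R quotM quotM_scalable.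

End QuotMod.

(* The affine variety with algebra of regular functions S, where j : C -> S is
   the structure map: its points are the C-algebra morphisms S -> C, with the
   Zariski topology.  The algebra of functions on a set F of points (with the
   reduced structure) is S modulo the functions vanishing on F. *)
Section Geometry.
Variables (C : fieldType) (S : pzRingType) (j : C -> S).

Definition points : set (S -> C) :=
  [set p | [/\ zmod_morphism p, monoid_morphism p & forall a, p (j a) = a]].

Definition zeros (E : set S) : set (S -> C) :=
  [set p | points p /\ forall f, E f -> p f = 0].

Definition vanishing (F : set (S -> C)) : set S :=
  [set f | forall p, F p -> p f = 0].

Definition functions_on (F : set (S -> C)) : Type := quotRing (vanishing F).

HB.instance Definition _ F := GRing.PzRing.on (functions_on F).

Definition zclosed (X : set (S -> C)) : Prop := exists E, X = zeros E.

Definition irreducible (X : set (S -> C)) : Prop :=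
  X !=set0 /\ forall Y1 Y2, zclosed Y1 -> zclosed Y2 ->
    X `<=` Y1 `|` Y2 -> X `<=` Y1 \/ X `<=` Y2.

Definition irreducible_component (F X : set (S -> C)) : Prop :=
  [/\ irreducible X, X `<=` F
    & forall Y, irreducible Y -> X `<=` Y -> Y `<=` F -> Y = X].

Definition closed_chain (X : set (S -> C)) (n : nat) : Prop :=
  exists Y : nat -> set (S -> C),
    (forall i, (i <= n)%N -> [/\ irreducible (Y i), zclosed (Y i) & Y i `<=` X])
    /\ (forall i, (i < n)%N -> Y i `<` Y i.+1).

(* Krull dimension of a closed subset X *)
Definition dimension (X : set (S -> C)) (n : nat) : Prop :=
  closed_chain X n /\ ~ closed_chain X n.+1.

Definition isolated (F : set (S -> C)) (p : S -> C) : Prop :=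
  F p /\ exists2 Y, zclosed Y & F `&` Y = F `\ p.

End Geometry.

Section Group.
Variables (C : numClosedFieldType) (zeta : C).

Definition refl (i : nat) : 'M[C]_2 :=
  \matrix_(k, l) (if (k == 0) && (l == 1) then zeta ^+ i
                  else if (k == 1) && (l == 0) then zeta ^- i else 0).

Definition alphav (i : nat) : 'cV[C]_2 :=
  \col_k (if k == 0 then zeta ^+ i else - 1).
Definition alpha (i : nat) : 'rV[C]_2 :=
  \row_k (if k == 0 then 1 else - zeta ^+ i).

Definition pairing (u : 'cV[C]_2) (U : 'rV[C]_2) : C := (U *m u) 0 0.

Inductive inW : 'M[C]_2 -> Prop :=
| inW_s : inW (refl 0)
| inW_t : inW (refl 1)
| inW_1 : inW 1%:M
| inW_M w w' : inW w -> inW w' -> inW (w *m w')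
| inW_V w : inW w -> inW (invmx w).

Definition W : Type := {w : 'M[C]_2 | `[< inW w >]}.
HB.instance Definition _ := Choice.on W.

Definition toW w (h : inW w) : W := exist _ w (introT (asboolP _) h).

Lemma inW_val (w : W) : inW (val w).
Proof. by case: w => w /= /asboolP. Qed.

Hypothesis zetaP : 3.-primitive_root zeta.

Lemma zeta_neq0 : zeta != 0.
Proof.
apply/eqP => z0; have := prim_expr_order zetaP.
by rewrite z0 expr0n /= => /eqP; rewrite eq_sym oner_eq0.
Qed.

Lemma ord2 (k : 'I_2) : (k = 0) \/ (k = 1).
Proof. by case: k => [[|[|]] //= h]; [left|right]; apply: val_inj. Qed.

Lemma refl_sq i : refl i *m refl i = 1%:M.
Proof.
apply/matrixP => k l; rewrite !mxE !big_ord_recl big_ord0 !mxE /=.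
have z : zeta ^+ i != 0 by rewrite expf_neq0 // zeta_neq0.
by case: (ord2 k) => ->; case: (ord2 l) => -> /=;
  rewrite ?(mul0r, mulr0, addr0, add0r) ?mulfV ?mulVf.
Qed.

Lemma refl_inv i : invmx (refl i) = refl i.
Proof.
have U : refl i \in unitmx by case: (mulmx1_unit (refl_sq i)).
by rewrite -[RHS]mul1mx -(mulVmx U) -mulmxA refl_sq mulmx1.
Qed.

Lemma refl2 : refl 2 = refl 1 *m refl 0 *m refl 1.
Proof.
apply/matrixP => k l; rewrite !mxE !big_ord_recl big_ord0 !mxE /=.
rewrite !big_ord_recl !big_ord0 !mxE /=.
by case: (ord2 k) => ->; case: (ord2 l) => -> /=;
  rewrite ?(mul0r, mulr0, addr0, add0r) ?expr0 ?invr1 ?mulr1 ?expr2 ?expr1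
    ?invfM.
Qed.

Lemma inW_refl (i : 'I_3) : inW (refl i).
Proof.
case: i => [[|[|[|]]] //= _]; [exact: inW_s|exact: inW_t|rewrite refl2].
by do !apply: inW_M; [exact: inW_t|exact: inW_s|exact: inW_t].
Qed.

Definition reflW (i : 'I_3) : W := toW (inW_refl i).

Lemma inW_unit w : inW w -> w \in unitmx.
Proof.
elim=> [||||v _]; last by rewrite unitmx_inv.
- by case: (mulmx1_unit (refl_sq 0)).
- by case: (mulmx1_unit (refl_sq 1)).
- exact: unitmx1.
- by move=> v v' _ uv _ uv'; rewrite unitmx_mul uv.
Qed.

End Group.

Section RelationImages.
Variables (A S : pzRingType) (F : {rmorphism A -> S}).

Lemma rmorph_eqB a b : F a = F b -> F (a - b) = 0.
Proof. by move=> E; rewrite rmorphB E subrr. Qed.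

Lemma rmorph_eq_mulB a b c d : F a * F b = F c * F d -> F (a * b - c * d) = 0.
Proof. by move=> E; rewrite rmorphB !rmorphM E subrr. Qed.

Lemma rmorph_eq_mul a b c : F a * F b = F c -> F (a * b - c) = 0.
Proof. by move=> E; rewrite rmorphB rmorphM E subrr. Qed.

Lemma rmorph_eq_comm a b (c d e : 'I_3 -> A) :
  F a * F b - F b * F a = - 2%:R * \sum_(i < 3) F (c i) * F (d i) * F (e i) <->
  F (a * b - b * a - (- 2%:R * \sum_(i < 3) c i * d i * e i)) = 0.
Proof.
have -> : F (a * b - b * a - (- 2%:R * \sum_(i < 3) c i * d i * e i)) =
  F a * F b - F b * F a - (- 2%:R * \sum_(i < 3) F (c i) * F (d i) * F (e i)).
  rewrite !(rmorphB, rmorphM, rmorphN, rmorph_nat) rmorph_sum.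
  by congr (_ - _ * _); apply: eq_bigr => i _; rewrite !rmorphM.
by split=> [->|/eqP]; rewrite ?subrr // subr_eq0 => /eqP.
Qed.

Lemma rmorph_lin a b c x : F (a * b + c) * x = F a * (F b * x) + F c * x.
Proof. by rewrite rmorphD rmorphM mulrDl mulrA. Qed.

Lemma mul0r3 (a b c : S) : a = 0 -> a * b * c = 0.
Proof. by move=> ->; rewrite !mul0r. Qed.

Lemma rmorph_comm a b : a * b = b * a -> F a * F b = F b * F a.
Proof. by move=> E; rewrite -!rmorphM E. Qed.

End RelationImages.

Lemma scale_mkmalgU (K : monomType) (R : nzRingType) (a b : R) (k : K) :
  a *: (mkmalgU k b : malg K R) = mkmalgU k (a * b).
Proof.
by apply/malgP => l; rewrite monalg.mcoeffZ !mcoeffU mulrnAr.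
Qed.

Section FreeAlg.
Variables (C : numClosedFieldType) (zeta : C).

(* Write Vd for the dual of V and Par for the space of parameters, so that
   C[Par] = C[A] = {poly C}.  The tensor product of C[Par] and the semidirect
   product of T(V + Vd) and W is the free C[A]-algebra on the basis of V, the
   dual basis and the elements of W, modulo the relations of the group W and
   w v w^-1 = w(v) for v in V or Vd.  Elements of V are column vectors, those of
   Vd row vectors, and w acts on Vd by U |-> U *m w^-1. *)
Definition gen : choiceType := ('I_2 + 'I_2 + W zeta)%type.

Definition freeAlg : Type := malg (fmonom gen) {poly C}.
HB.instance Definition _ := GRing.Lalgebra.on freeAlg.

End FreeAlg.

(* fgen, fconst, fV, fVd, Hconst and the products of quotients are locked to
   keep unification from unfolding the monoid algebra. *)
HB.lock Definition fgen (C : numClosedFieldType) (zeta : C) (g : gen zeta) :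
  freeAlg zeta := mkmalgU (fmu g) 1.

HB.lock Definition fconst (C : numClosedFieldType) (zeta : C) (a : {poly C}) :
  freeAlg zeta := a%:A.

Section FconstMorphism.
Variables (C : numClosedFieldType) (zeta : C).

Lemma fconst_zmod_morphism : zmod_morphism (fconst zeta).
Proof. by rewrite fconst.unlock => a b; rewrite scalerBl. Qed.

Lemma fconst_monoid_morphism : monoid_morphism (fconst zeta).
Proof.
rewrite fconst.unlock; split; first exact: scale1r.
by move=> a b; rewrite -scalerAl mul1r scalerA.
Qed.

HB.instance Definition _ := GRing.isZmodMorphism.Build _ _ (fconst zeta)
  fconst_zmod_morphism.
HB.instance Definition _ := GRing.isMonoidMorphism.Build _ _ (fconst zeta)
  fconst_monoid_morphism.

End FconstMorphism.

HB.lock Definition fV (C : numClosedFieldType) (zeta : C) (u : 'cV[C]_2) :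
  freeAlg zeta := \sum_k fconst zeta (u k 0)%:P * fgen (inl (inl k)).

HB.lock Definition fVd (C : numClosedFieldType) (zeta : C) (U : 'rV[C]_2) :
  freeAlg zeta := \sum_k fconst zeta (U 0 k)%:P * fgen (inl (inr k)).

Section Cherednik.
Variables (C : numClosedFieldType) (zeta : C).
Hypothesis zetaP : 3.-primitive_root zeta.

Local Notation W := (W zeta).
Local Notation gen := (gen zeta).
Local Notation freeAlg := (freeAlg zeta).
Local Notation fconst := (fconst zeta).
Local Notation fV := (fV zeta).
Local Notation fVd := (fVd zeta).

Definition fW (w : W) : freeAlg := fgen (inr w).

Inductive cherednik_rel : freeAlg -> Prop :=
| rel_W1 (w : W) : val w = 1%:M -> cherednik_rel (fW w - 1)
| rel_WM (w1 w2 w3 : W) : val w3 = val w1 *m val w2 ->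
    cherednik_rel (fW w1 * fW w2 - fW w3)
| rel_WV (w : W) u :
    cherednik_rel (fW w * fV u - fV (val w *m u) * fW w)
| rel_WVd (w : W) U :
    cherednik_rel (fW w * fVd U - fVd (U *m invmx (val w)) * fW w)
| rel_VV u u' : cherednik_rel (fV u * fV u' - fV u' * fV u)
| rel_VdVd U U' : cherednik_rel (fVd U * fVd U' - fVd U' * fVd U)
| rel_VVd u U :
    cherednik_rel (fV u * fVd U - fVd U * fV u
      - (- 2%:R * \sum_(i < 3)
          fconst 'X *
          fconst (pairing u (alpha zeta i) * pairing (alphav zeta i) U
                  / pairing (alphav zeta i) (alpha zeta i))%:P *
          fW (reflW zeta i))).

End Cherednik.

Definition H (C : numClosedFieldType) (zeta : C) : Type :=
  quotRing (@cherednik_rel C zeta).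
HB.instance Definition _ (C : numClosedFieldType) (zeta : C) :=
  GRing.PzRing.on (H zeta).

Definition Hpi (C : numClosedFieldType) (zeta : C) : freeAlg zeta -> H zeta :=
  @quotR _ (@cherednik_rel C zeta).
HB.instance Definition _ (C : numClosedFieldType) (zeta : C) :=
  GRing.RMorphism.on (@Hpi C zeta).

HB.lock Definition Hconst (C : numClosedFieldType) (zeta : C) (a : {poly C}) :
  H zeta := Hpi (fconst zeta a).

Section HconstMorphism.
Variables (C : numClosedFieldType) (zeta : C).

Lemma Hconst_zmod_morphism : zmod_morphism (Hconst zeta).
Proof.
by rewrite Hconst.unlock => a b; rewrite (rmorphB (fconst zeta)) rmorphB.
Qed.

Lemma Hconst_monoid_morphism : monoid_morphism (Hconst zeta).
Proof.
rewrite Hconst.unlock; split; first by rewrite (rmorph1 (fconst zeta)) rmorph1.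
by move=> a b; rewrite (rmorphM (fconst zeta)) rmorphM.
Qed.

HB.instance Definition _ := GRing.isZmodMorphism.Build _ _ (Hconst zeta)
  Hconst_zmod_morphism.
HB.instance Definition _ := GRing.isMonoidMorphism.Build _ _ (Hconst zeta)
  Hconst_monoid_morphism.

End HconstMorphism.

Section CherednikTheory.
Variables (C : numClosedFieldType) (zeta : C).
Hypothesis zetaP : 3.-primitive_root zeta.

Local Notation W := (W zeta).
Local Notation gen := (gen zeta).
Local Notation freeAlg := (freeAlg zeta).
Local Notation fconst := (fconst zeta).
Local Notation fV := (fV zeta).
Local Notation fVd := (fVd zeta).
Local Notation cherednik_rel := (@cherednik_rel C zeta).
Local Notation H := (H zeta).
Local Notation Hpi := (@Hpi C zeta).
Local Notation Hconst := (Hconst zeta).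

Definition HV u : H := Hpi (fV u).
Definition HVd U : H := Hpi (fVd U).
Definition HW w : H := Hpi (fW w).

Section Word.
Variables (S : nzRingType) (phi : gen -> S).
Definition wordmap (m : fmonom gen) : S := \prod_(g <- m : seq gen) phi g.
Lemma wordmap_mmorphism : mmorphism wordmap.
Proof.
split; last by rewrite /wordmap fm1 big_nil.
by move=> m1 m2; rewrite /wordmap fmM big_cat.
Qed.
HB.instance Definition _ :=
  monalg.isMultiplicative.Build (fmonom gen) S wordmap wordmap_mmorphism.
End Word.

Lemma fconst_lin a b c x :
  fconst (a * b + c)%:P * x
  = fconst a%:P * (fconst b%:P * x) + fconst c%:P * x.
Proof.
rewrite polyCD polyCM; exact: rmorph_lin.
Qed.

Lemma fV_linear a u v : fV (a *: u + v) = fconst a%:P * fV u + fV v.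
Proof.
rewrite !fV.unlock [X in _ = X + _](@mulr_sumr freeAlg) -big_split; apply: eq_bigr => k _.
by rewrite mxE mxE; exact: fconst_lin.
Qed.

Lemma fVd_linear a u v : fVd (a *: u + v) = fconst a%:P * fVd u + fVd v.
Proof.
rewrite !fVd.unlock [X in _ = X + _](@mulr_sumr freeAlg) -big_split; apply: eq_bigr => k _.
by rewrite mxE mxE; exact: fconst_lin.
Qed.

Lemma mkmalgUM (m1 m2 : fmonom gen) (c1 c2 : {poly C}) :
  (mkmalgU m1 c1 : freeAlg) * mkmalgU m2 c2 = mkmalgU (monalg.mul m1 m2) (c1 * c2).
Proof. by rewrite malgM_def fgmulUU. Qed.

Lemma fconstE a : fconst a = mkmalgU monalg.one a.
Proof. by rewrite fconst.unlock; rewrite -[in RHS](mulr1 a); exact: scale_mkmalgU. Qed.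

Lemma fconst_fgen_comm a g : fconst a * fgen g = fgen g * fconst a.
Proof. by rewrite fgen.unlock fconstE !mkmalgUM mulr1 mul1r mul1m mulm1. Qed.

Lemma freeAlg_ind (P : freeAlg -> Prop) :
  (forall a, P (fconst a)) -> (forall g, P (fgen g)) ->
  (forall u v, P u -> P v -> P (u + v)) ->
  (forall u v, P u -> P v -> P (u * v)) -> forall u, P u.
Proof.
move=> Pc Pg PD PM u; rewrite (monalgE u).
have P0 : P 0 by rewrite -(rmorph0 fconst); exact: Pc.
elim/big_ind: _ => // k _.
suff Pk c : P (mkmalgU k c) by exact: Pk.
have -> : mkmalgU k c = fconst c * mkmalgU k 1.
  by rewrite fconstE mkmalgUM mul1m mulr1.
apply: (PM) => //; case: k => s; elim: s => [|g s IH].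
  have -> : mkmalgU (FMonom [::]) 1 = 1 :> freeAlg.
    by rewrite -fmoneE; reflexivity.
  by rewrite -(rmorph1 fconst); exact: Pc.
have Eg : FMonom (g :: s) = monalg.mul (fmu g) (FMonom s).
  by apply/eqP; rewrite fmP fmM fmU.
rewrite Eg -[1]mulr1 -mkmalgUM; apply: PM => //.
by have := Pg g; rewrite fgen.unlock.
Qed.

Section RelKill.
Variables (S : pzRingType) (F : {rmorphism freeAlg -> S}).

Hypothesis FW1 : forall w : W, val w = 1%:M -> F (fW w) = 1.
Hypothesis FWM : forall w1 w2 w3 : W, val w3 = val w1 *m val w2 ->
  F (fW w1) * F (fW w2) = F (fW w3).
Hypothesis FWV : forall (w : W) u,
  F (fW w) * F (fV u) = F (fV (val w *m u)) * F (fW w).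
Hypothesis FWVd : forall (w : W) U,
  F (fW w) * F (fVd U) = F (fVd (U *m invmx (val w))) * F (fW w).
Hypothesis FVV : forall u u', F (fV u) * F (fV u') = F (fV u') * F (fV u).
Hypothesis FVdVd :
  forall U U', F (fVd U) * F (fVd U') = F (fVd U') * F (fVd U).
Hypothesis FVVd : forall u U,
  F (fV u) * F (fVd U) - F (fVd U) * F (fV u) =
  - 2%:R * \sum_(i < 3) F (fconst 'X) *
     F (fconst (pairing u (alpha zeta i) * pairing (alphav zeta i) U
                  / pairing (alphav zeta i) (alpha zeta i))%:P) *
     F (fW (reflW zeta i)).

Lemma rel_kill h : cherednik_rel h -> F h = 0.
Proof.
case=> [w w1|w1 w2 w3 w123|w u|w U|u u'|U U'|u U].
- by apply: rmorph_eqB; rewrite FW1 // rmorph1.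
- exact: rmorph_eq_mul (FWM w123).
- exact: rmorph_eq_mulB (FWV w u).
- exact: rmorph_eq_mulB (FWVd w U).
- exact: rmorph_eq_mulB (FVV u u').
- exact: rmorph_eq_mulB (FVdVd U U').
- by apply: (proj1 (rmorph_eq_comm F _ _ _ _ _)); exact: FVVd u U.
Qed.

End RelKill.

Section FreeLift.
Variables (S : nzRingType) (f : {rmorphism {poly C} -> S}) (phi : gen -> S).
Hypothesis fphi : forall a g, GRing.comm (f a) (phi g).

Definition freeLift : freeAlg -> S := monalg.mmap f (wordmap phi).

HB.instance Definition _ := GRing.Additive.on freeLift.

Lemma freeLift_monoid : monoid_morphism freeLift.
Proof.
suff h u m m' : GRing.comm (f (monalg.mcoeff m (u : freeAlg))) (wordmap phi m').
  have [fM f1] := monalg.commr_mmap_is_multiplicative h.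
  by split; [exact: f1 | exact: fM].
rewrite /= /wordmap; elim: (m' : seq gen) => [|g s IH].
  by rewrite big_nil; exact: commr1.
by rewrite big_cons; apply: commrM.
Qed.

Definition freeLiftM : {rmorphism freeAlg -> S} :=
  HB.pack freeLift (GRing.isMonoidMorphism.Build _ _ freeLift freeLift_monoid).

Lemma freeLift_gen g : freeLiftM (fgen g) = phi g.
Proof.
have -> : freeLiftM (fgen g) = f 1 * wordmap phi (fmu g).
  by rewrite fgen.unlock; exact: monalg.mmapU.
by rewrite rmorph1 mul1r /wordmap fmU big_seq1.
Qed.

Lemma freeLift_const a : freeLiftM (fconst a) = f a.
Proof.
have -> : freeLiftM (fconst a) = f a * freeLiftM 1 by rewrite fconst.unlock; exact: monalg.mmapZ.
by rewrite rmorph1 mulr1.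
Qed.

Lemma freeLift_fV u :
  freeLiftM (fV u) = \sum_k f (u k 0)%:P * phi (inl (inl k)).
Proof.
rewrite fV.unlock rmorph_sum; apply: eq_bigr => k _.
by rewrite (rmorphM freeLiftM); congr (_ * _); [exact: freeLift_const|exact: freeLift_gen].
Qed.

Lemma freeLift_fVd U :
  freeLiftM (fVd U) = \sum_k f (U 0 k)%:P * phi (inl (inr k)).
Proof.
rewrite fVd.unlock rmorph_sum; apply: eq_bigr => k _.
by rewrite (rmorphM freeLiftM); congr (_ * _); [exact: freeLift_const|exact: freeLift_gen].
Qed.

End FreeLift.

Section TrivialCharacter.

Definition triv_gen (g : gen) : C := if g is inr _ then 1 else 0.

Let triv_comm (a : {poly C}) g :
  GRing.comm (horner_eval 0 a) (triv_gen g).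
Proof. exact: mulrC. Qed.

Definition triv_char : {rmorphism freeAlg -> C} := freeLiftM triv_comm.

Lemma triv_char_rel u : cherednik_rel u -> triv_char u = 0.
Proof.
have tW w : triv_char (fW w) = 1 by exact: freeLift_gen.
have tV v : triv_char (fV v) = 0.
  by rewrite freeLift_fV big1 // => k _; rewrite /= mulr0.
have tVd v : triv_char (fVd v) = 0.
  by rewrite freeLift_fVd big1 // => k _; rewrite /= mulr0.
have tX : triv_char (fconst 'X) = 0.
  by rewrite freeLift_const /= /horner_eval hornerX.
apply: (@rel_kill _ triv_char).
- by move=> w _; rewrite tW.
- by move=> w1 w2 w3 _; rewrite (tW w1) (tW w2) (tW w3) mulr1.
- by move=> w v; rewrite (tV v) (tV (val w *m v)) mulr0 mul0r.
- by move=> w v; rewrite (tVd v) (tVd (v *m invmx (val w))) mulr0 mul0r.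
- by move=> v v'; rewrite (tV v) (tV v').
- by move=> v v'; rewrite (tVd v) (tVd v').
move=> v v'; rewrite (tV v) (tVd v') big1 ?mulr0 ?subrr // => i _.
exact: mul0r3 tX.
Qed.

Lemma H_nonzero : 1 != 0 :> H.
Proof.
apply/eqP => h10; have /quotR_eq0 : Hpi 1 = 0 by rewrite rmorph1.
move=> /(ideal2_ker triv_char_rel) /eqP.
by rewrite rmorph1 oner_eq0.
Qed.

HB.instance Definition _ := GRing.PzSemiRing_isNonZero.Build H H_nonzero.

End TrivialCharacter.

Lemma H_ind (P : H -> Prop) :
  (forall a, P (Hconst a)) -> (forall g, P (Hpi (fgen g))) ->
  (forall u v, P u -> P v -> P (u + v)) ->
  (forall u v, P u -> P v -> P (u * v)) -> forall h, P h.
Proof.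
rewrite Hconst.unlock => Pc Pg PD PM h; have [u ->] := quotR_surj h; rewrite -/(Hpi u).
elim/freeAlg_ind: u => [a|g|u v|u v]; [exact: Pc|exact: Pg| |].
- by rewrite rmorphD; exact: PD.
- by rewrite rmorphM; exact: PM.
Qed.

Lemma Hconst_comm a h : Hconst a * h = h * Hconst a.
Proof.
elim/H_ind: h => [b|g|u v IHu IHv|u v IHu IHv].
- by rewrite -(rmorphM Hconst) -(rmorphM Hconst) (mulrC a).
- by rewrite Hconst.unlock; apply: (rmorph_comm Hpi); exact: fconst_fgen_comm.
- by rewrite mulrDr mulrDl IHu IHv.
- by rewrite mulrA IHu -mulrA IHv mulrA.
Qed.

Lemma Hpi_fconst a : Hpi (fconst a) = Hconst a.
Proof. by rewrite Hconst.unlock. Qed.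

Section HRelations.

Lemma Hpi_eq a b : cherednik_rel (a - b) -> Hpi a = Hpi b.
Proof. by move=> r; apply/quotR_eq/ideal2_gen. Qed.

Lemma HW1 (w : W) : val w = 1%:M -> HW w = 1.
Proof. by move=> w1; rewrite -(rmorph1 Hpi); apply: Hpi_eq; exact: rel_W1. Qed.

Lemma HWM (w1 w2 w3 : W) : val w3 = val w1 *m val w2 -> HW w1 * HW w2 = HW w3.
Proof.
by move=> w123; rewrite -(rmorphM Hpi); apply: Hpi_eq; exact: rel_WM.
Qed.

Lemma HWV (w : W) u : HW w * HV u = HV (val w *m u) * HW w.
Proof. by rewrite -!(rmorphM Hpi); apply: Hpi_eq; exact: rel_WV. Qed.

Lemma HWVd (w : W) U : HW w * HVd U = HVd (U *m invmx (val w)) * HW w.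
Proof. by rewrite -!(rmorphM Hpi); apply: Hpi_eq; exact: rel_WVd. Qed.

Lemma HVC u u' : HV u * HV u' = HV u' * HV u.
Proof. by rewrite -!(rmorphM Hpi); apply: Hpi_eq; exact: rel_VV. Qed.

Lemma HVdC U U' : HVd U * HVd U' = HVd U' * HVd U.
Proof. by rewrite -!(rmorphM Hpi); apply: Hpi_eq; exact: rel_VdVd. Qed.

Lemma HVVd u U :
  HV u * HVd U - HVd U * HV u = - 2%:R * \sum_(i < 3) Hconst 'X *
     Hconst (pairing u (alpha zeta i) * pairing (alphav zeta i) U
                  / pairing (alphav zeta i) (alpha zeta i))%:P *
     HW (reflW zeta i).
Proof.
rewrite Hconst.unlock; apply: (proj2 (rmorph_eq_comm Hpi _ _ _ _ _)).
by apply/quotR_eq0/ideal2_gen; exact: rel_VVd.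
Qed.

Lemma HV_linear a u v : HV (a *: u + v) = Hconst a%:P * HV u + HV v.
Proof. by rewrite /HV fV_linear (rmorphD Hpi) (rmorphM Hpi) -Hpi_fconst. Qed.

Lemma HVd_linear a u v : HVd (a *: u + v) = Hconst a%:P * HVd u + HVd v.
Proof. by rewrite /HVd fVd_linear (rmorphD Hpi) (rmorphM Hpi) -Hpi_fconst. Qed.

End HRelations.

Section Action.
Variables (xi : C) (xi0 : xi != 0).

Definition act_gen (g : gen) : H :=
  match g with
  | inl (inl _) => Hconst xi^-1%:P * Hpi (fgen g)
  | inl (inr _) => Hconst xi%:P * Hpi (fgen g)
  | inr _ => Hpi (fgen g)
  end.

Let act_comm a g : GRing.comm (Hconst a) (act_gen g).
Proof. exact: Hconst_comm. Qed.

Let F : {rmorphism freeAlg -> H} := freeLiftM act_comm.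

Let mulcA a b h : Hconst a * (Hconst b * h) = Hconst b * (Hconst a * h).
Proof. by rewrite mulrA Hconst_comm -mulrA. Qed.

Let FV u : F (fV u) = Hconst xi^-1%:P * HV u.
Proof.
rewrite /HV [in RHS]fV.unlock (rmorph_sum Hpi) mulr_sumr /F freeLift_fV.
apply: eq_bigr => k _.
rewrite (rmorphM Hpi) -[X in _ = _ * (X * _)]/(Hpi (fconst _)) Hpi_fconst.
exact: mulcA.
Qed.

Let FVd U : F (fVd U) = Hconst xi%:P * HVd U.
Proof.
rewrite /HVd [in RHS]fVd.unlock (rmorph_sum Hpi) mulr_sumr /F freeLift_fVd.
apply: eq_bigr => k _.
rewrite (rmorphM Hpi) -[X in _ = _ * (X * _)]/(Hpi (fconst _)) Hpi_fconst.
exact: mulcA.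
Qed.

Let FW w : F (fW w) = HW w.
Proof. exact: freeLift_gen. Qed.

Let Fc a : F (fconst a) = Hconst a.
Proof. exact: freeLift_const. Qed.

Let mulcc a b (h k : H) :
  Hconst a * h * (Hconst b * k) = Hconst a * Hconst b * (h * k).
Proof. by rewrite -!mulrA; congr (_ * _); rewrite mulrA -Hconst_comm -mulrA. Qed.

Lemma act_kill h : cherednik_rel h -> F h = 0.
Proof.
apply: (@rel_kill _ F).
- by move=> w w1; rewrite FW HW1.
- by move=> w1 w2 w3 w123; rewrite (FW w1) (FW w2) (FW w3) (HWM w123).
- move=> w u; rewrite (FW w) (FV u) (FV (val w *m u)).
  by rewrite mulrA -Hconst_comm -!mulrA HWV.
- move=> w U; rewrite (FW w) (FVd U) (FVd (U *m invmx (val w))).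
  by rewrite mulrA -Hconst_comm -!mulrA HWVd.
- by move=> u u'; rewrite (FV u) (FV u') !mulcc HVC.
- by move=> u u'; rewrite (FVd u) (FVd u') !mulcc HVdC.
move=> u U; rewrite (FV u) (FVd U) !mulcc -!(rmorphM Hconst) -!polyCM.
rewrite mulfV // mulVf // rmorph1 !mul1r HVVd.
congr (_ * _); apply: eq_bigr => i _.
by rewrite (Fc 'X) (FW (reflW zeta i)); congr (_ * _ * _); rewrite Fc.
Qed.

Definition act : {rmorphism H -> H} := quotR_liftM act_kill.

Let act_Hpi u : act (Hpi u) = F u.
Proof. exact: quotR_liftME. Qed.

Lemma act_const a : act (Hconst a) = Hconst a.
Proof. by rewrite -[X in act X]Hpi_fconst act_Hpi Fc. Qed.
Lemma act_V u : act (HV u) = Hconst xi^-1%:P * HV u.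
Proof. by rewrite act_Hpi FV. Qed.
Lemma act_Vd U : act (HVd U) = Hconst xi%:P * HVd U.
Proof. by rewrite act_Hpi FVd. Qed.
Lemma act_W w : act (HW w) = HW w.
Proof. by rewrite act_Hpi FW. Qed.
Lemma act_genE g : act (Hpi (fgen g)) = act_gen g.
Proof. by rewrite act_Hpi; exact: freeLift_gen. Qed.

End Action.

Lemma actK xi (xi0 : xi != 0) (xi0' : xi^-1 != 0) h :
  act xi0 (act xi0' h) = h.
Proof.
elim/H_ind: h => [a|g|u v IHu IHv|u v IHu IHv].
- by rewrite !act_const.
- case: g => [[k|k]|w]; rewrite (act_genE xi0' _) {1}/act_gen.
  + rewrite (rmorphM (act xi0)) act_const act_genE {1}/act_gen mulrA.
    by rewrite -(rmorphM Hconst) -polyCM invrK mulfV // rmorph1 mul1r.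
  + rewrite (rmorphM (act xi0)) act_const act_genE {1}/act_gen mulrA.
    by rewrite -(rmorphM Hconst) -polyCM mulVf // rmorph1 mul1r.
  + by rewrite act_genE.
- by rewrite !rmorphD IHu IHv.
- by rewrite !rmorphM IHu IHv.
Qed.

(* Z(H) *)
Definition center_pred : {pred H} := fun z => `[< forall h : H, z * h = h * z >].

Lemma center_predP z : reflect (forall h : H, z * h = h * z) (z \in center_pred).
Proof. exact: asboolP. Qed.

Lemma center_subring_closed : subring_closed center_pred.
Proof.
split.
- by apply/center_predP => h; rewrite mul1r mulr1.
- move=> x y /center_predP cx /center_predP cy; apply/center_predP => h.
  by rewrite mulrBl mulrBr cx cy.
- move=> x y /center_predP cx /center_predP cy; apply/center_predP => h.
  by rewrite -mulrA cy mulrA cx mulrA.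
Qed.

HB.instance Definition _ :=
  GRing.isSubringClosed.Build H center_pred center_subring_closed.

Definition Z : Type := {z : H | z \in center_pred}.
HB.instance Definition _ := SubType.on Z.
HB.instance Definition _ := [Choice of Z by <:].
HB.instance Definition _ := [SubChoice_isSubNzRing of Z by <:].

Lemma Z_mulC : commutative (@GRing.mul Z).
Proof.
move=> z z'; apply: val_inj; rewrite !rmorphM /=.
by have /center_predP := valP z.
Qed.

HB.instance Definition _ := GRing.PzRing_hasCommutativeMul.Build Z Z_mulC.

Lemma Hconst_center a : Hconst a \in center_pred.
Proof. by apply/center_predP; exact: Hconst_comm. Qed.

Definition Zconst a : Z := exist _ (Hconst a) (Hconst_center a).

Lemma Zconst_zmod_morphism : zmod_morphism Zconst.
Proof. by move=> a b; apply: val_inj; rewrite /= (rmorphB Hconst). Qed.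

Lemma Zconst_monoid_morphism : monoid_morphism Zconst.
Proof.
split; first by apply: val_inj; rewrite /= (rmorph1 Hconst).
by move=> a b; apply: val_inj; rewrite /= (rmorphM Hconst).
Qed.

HB.instance Definition _ := GRing.isZmodMorphism.Build _ _ Zconst
  Zconst_zmod_morphism.
HB.instance Definition _ := GRing.isMonoidMorphism.Build _ _ Zconst
  Zconst_monoid_morphism.

Lemma act_center xi (xi0 : xi != 0) z :
  z \in center_pred -> act xi0 z \in center_pred.
Proof.
move=> /center_predP cz; apply/center_predP => h.
have xi0' : xi^-1 != 0 by rewrite invr_eq0.
by rewrite -(actK xi0 xi0' h) -!(rmorphM (act xi0)) cz.
Qed.

Definition actZ xi (xi0 : xi != 0) (z : Z) : Z :=
  exist _ (act xi0 (val z)) (act_center xi0 (valP z)).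

Definition ex : 'cV[C]_2 := delta_mx 0 0.
Definition ey : 'cV[C]_2 := delta_mx 1 0.
Definition eX : 'rV[C]_2 := delta_mx 0 0.
Definition eY : 'rV[C]_2 := delta_mx 0 1.

Definition Hx : H := HV ex.
Definition Hy : H := HV ey.
Definition HX : H := HVd eX.
Definition HY : H := HVd eY.

Lemma HV_gen k : Hpi (fgen (inl (inl k))) = HV (delta_mx k 0).
Proof.
rewrite /HV fV.unlock; congr (Hpi _); rewrite (bigD1 k) // big1 => [|l lk].
  rewrite mxE !eqxx (rmorph1 fconst) mul1r; exact/esym/addr0.
by rewrite mxE (negPf lk) (rmorph0 fconst) mul0r.
Qed.

Lemma HVd_gen k : Hpi (fgen (inl (inr k))) = HVd (delta_mx 0 k).
Proof.
rewrite /HVd fVd.unlock; congr (Hpi _); rewrite (bigD1 k) // big1 => [|l lk].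
  rewrite mxE !eqxx (rmorph1 fconst) mul1r; exact/esym/addr0.
by rewrite mxE (negPf lk) (rmorph0 fconst) mul0r.
Qed.

Lemma HV0 : HV 0 = 0.
Proof.
have := HV_linear (-1) 0 0; rewrite scaler0 addr0.
by rewrite polyCN (rmorphN Hconst) (rmorph1 Hconst) mulN1r addNr.
Qed.

Lemma HVd0 : HVd 0 = 0.
Proof.
have := HVd_linear (-1) 0 0; rewrite scaler0 addr0.
by rewrite polyCN (rmorphN Hconst) (rmorph1 Hconst) mulN1r addNr.
Qed.

Lemma HVZ a u : HV (a *: u) = Hconst a%:P * HV u.
Proof. by rewrite -[a *: u]addr0 HV_linear HV0 addr0. Qed.

Lemma HVdZ a u : HVd (a *: u) = Hconst a%:P * HVd u.
Proof. by rewrite -[a *: u]addr0 HVd_linear HVd0 addr0. Qed.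

Lemma center_crit z : (forall u, z * HV u = HV u * z) ->
  (forall U, z * HVd U = HVd U * z) -> (forall w, z * HW w = HW w * z) ->
  z \in center_pred.
Proof.
move=> zV zVd zW; apply/center_predP; elim/H_ind => [a|g|u v IHu IHv|u v IHu IHv].
- by rewrite Hconst_comm.
- by case: g => [[k|k]|w]; rewrite ?HV_gen ?HVd_gen; [exact: zV|exact: zVd|exact: zW].
- by rewrite mulrDl mulrDr IHu IHv.
- by rewrite mulrA IHu -mulrA IHv mulrA.
Qed.

Lemma comm_W z : (forall (w : W) i, val w = refl zeta i -> z * HW w = HW w * z) ->
  forall w, z * HW w = HW w * z.
Proof.
move=> zs; suff h m : inW zeta m -> forall w, val w = m -> z * HW w = HW w * z.
  by move=> w; exact: (h _ (inW_val w) w).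
elim => [||||] => [w E|w E|w E|m1 m2 h1 IH1 h2 IH2 w E|m1 h1 IH w E].
- exact: zs E.
- exact: zs E.
- by rewrite (HW1 E) mul1r mulr1.
- rewrite -(@HWM (toW h1) (toW h2) w E) mulrA (IH1 (toW h1)) //.
  by rewrite -mulrA (IH2 (toW h2)) // mulrA.
have u1 : m1 \in unitmx := inW_unit zetaP h1.
have h12 : HW w * HW (toW h1) = 1.
  rewrite (@HWM w (toW h1) (toW (inW_1 zeta))) ?HW1 //= [val w](E) mulVmx //.
have h21 : HW (toW h1) * HW w = 1.
  rewrite (@HWM (toW h1) w (toW (inW_1 zeta))) ?HW1 //= [val w](E) mulmxV //.
rewrite -[LHS]mul1r -h12 -!mulrA; congr (_ * _).
by rewrite mulrA -(IH (toW h1)) // -mulrA h21 mulr1.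
Qed.

Section CenterElements.

Let refl_x i : refl zeta i *m ex = zeta ^- i *: ey.
Proof.
apply/matrixP => k l; rewrite !mxE !big_ord_recl big_ord0 !mxE /=.
rewrite (ord1 l).
by case: (ord2 k) => -> /=; rewrite ?(mul0r, mulr0, addr0, add0r, mulr1).
Qed.

Let refl_y i : refl zeta i *m ey = zeta ^+ i *: ex.
Proof.
apply/matrixP => k l; rewrite !mxE !big_ord_recl big_ord0 !mxE /=.
rewrite (ord1 l).
by case: (ord2 k) => -> /=; rewrite ?(mul0r, mulr0, addr0, add0r, mulr1).
Qed.

Let refl_X i : eX *m refl zeta i = zeta ^+ i *: eY.
Proof.
apply/matrixP => k l; rewrite !mxE !big_ord_recl big_ord0 !mxE /=.
rewrite (ord1 k).
by case: (ord2 l) => -> /=; rewrite ?(mul0r, mulr0, addr0, add0r, mulr1, mul1r).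
Qed.

Let refl_Y i : eY *m refl zeta i = zeta ^- i *: eX.
Proof.
apply/matrixP => k l; rewrite !mxE !big_ord_recl big_ord0 !mxE /=.
rewrite (ord1 k).
by case: (ord2 l) => -> /=; rewrite ?(mul0r, mulr0, addr0, add0r, mulr1, mul1r).
Qed.

Lemma Hrefl_x (w : W) i : val w = refl zeta i ->
  HW w * Hx = Hconst (zeta ^- i)%:P * Hy * HW w.
Proof. by move=> E; rewrite HWV E refl_x HVZ. Qed.

Lemma Hrefl_y (w : W) i : val w = refl zeta i ->
  HW w * Hy = Hconst (zeta ^+ i)%:P * Hx * HW w.
Proof. by move=> E; rewrite HWV E refl_y HVZ. Qed.

Lemma Hrefl_X (w : W) i : val w = refl zeta i ->
  HW w * HX = Hconst (zeta ^+ i)%:P * HY * HW w.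
Proof. by move=> E; rewrite HWVd E (refl_inv zetaP) refl_X HVdZ. Qed.

Lemma Hrefl_Y (w : W) i : val w = refl zeta i ->
  HW w * HY = Hconst (zeta ^- i)%:P * HX * HW w.
Proof. by move=> E; rewrite HWVd E (refl_inv zetaP) refl_Y HVdZ. Qed.

Let zV i : (zeta ^+ i)%:P * (zeta ^- i)%:P = 1 :> {poly C}.
Proof. by rewrite -polyCM mulfV // expf_neq0 // (zeta_neq0 zetaP). Qed.

Let bracket_kill (c1 c2 z : {poly C}) (h k s : H) :
  s * k = Hconst z * h * s -> c1 + c2 * z = 0 ->
  h * (Hconst 'X * Hconst c1 * s) + Hconst 'X * Hconst c2 * s * k = 0.
Proof.
move=> E c0; rewrite -!(rmorphM Hconst) -mulrA E.
rewrite [h * _]mulrA -Hconst_comm -!mulrA [X in _ + X]mulrA.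
rewrite -(rmorphM Hconst) -mulrDl -(rmorphD Hconst) -mulrA -mulrDr c0.
by rewrite mulr0 (rmorph0 Hconst) mul0r.
Qed.

Let refl_comm (c1 c2 : {poly C}) (h k s : H) :
  s * h = Hconst c1 * k * s -> s * k = Hconst c2 * h * s ->
  c1 * c2 = 1 -> k * h = h * k -> h * k * s = s * (h * k).
Proof.
move=> Eh Ek c12 hk; rewrite mulrA Eh -[RHS]mulrA Ek.
have -> : Hconst c1 * k * (Hconst c2 * h * s) = Hconst c1 * Hconst c2 * (k * h * s).
  by rewrite -!mulrA; congr (_ * _); rewrite mulrA -Hconst_comm -!mulrA.
by rewrite -(rmorphM Hconst) c12 (rmorph1 Hconst) mul1r hk.
Qed.

Let pairing_x i : pairing ex (alpha zeta i) = 1.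
Proof. by rewrite /pairing !mxE !big_ord_recl big_ord0 !mxE /= mulr1 mulr0 !addr0. Qed.
Let pairing_y i : pairing ey (alpha zeta i) = - zeta ^+ i.
Proof. by rewrite /pairing !mxE !big_ord_recl big_ord0 !mxE /= mulr1 mulr0 addr0 add0r. Qed.
Let pairing_X i : pairing (alphav zeta i) eX = zeta ^+ i.
Proof. by rewrite /pairing !mxE !big_ord_recl big_ord0 !mxE /= mul1r mul0r !addr0. Qed.
Let pairing_Y i : pairing (alphav zeta i) eY = -1.
Proof. by rewrite /pairing !mxE !big_ord_recl big_ord0 !mxE /= mul1r mul0r addr0 add0r. Qed.

Let mulm2 (h S : H) : h * (- 2%:R * S) = - 2%:R * (h * S).
Proof. by rewrite !mulNr mulrN !mulr_natl mulrnAr. Qed.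

Lemma q_center : Hx * Hy \in center_pred.
Proof.
apply: center_crit.
- by move=> u; rewrite -mulrA (HVC _ u) mulrA (HVC _ u) -mulrA.
- move=> U; apply/eqP; rewrite -subr_eq0; apply/eqP.
  have -> : Hx * Hy * HVd U - HVd U * (Hx * Hy)
      = Hx * (Hy * HVd U - HVd U * Hy) + (Hx * HVd U - HVd U * Hx) * Hy.
    by rewrite mulrBr mulrBl !mulrA addrA subrK.
  rewrite [Hy * _ - _]HVVd [Hx * _ - _]HVVd mulm2 -[X in _ + X]mulrA -mulrDr.
  rewrite mulr_sumr mulr_suml -big_split big1 ?mulr0 // => i _ /=.
  apply: bracket_kill (Hrefl_y _) _ => //.
  rewrite -polyCM -polyCD pairing_x pairing_y mul1r !mulNr.
  by rewrite -[zeta ^+ i * _ / _]mulrA [zeta ^+ i * _]mulrC addNr.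
- apply: comm_W => w i E.
  apply: refl_comm (Hrefl_x E) (Hrefl_y E) _ (HVC _ _).
  by rewrite mulrC.
Qed.

Lemma Q_center : HX * HY \in center_pred.
Proof.
apply: center_crit.
- move=> u; apply/esym/eqP; rewrite -subr_eq0; apply/eqP.
  have -> : HV u * (HX * HY) - HX * HY * HV u
      = HX * (HV u * HY - HY * HV u) + (HV u * HX - HX * HV u) * HY.
    by rewrite mulrBr mulrBl !mulrA [RHS]addrC addrA subrK.
  rewrite [HV u * HY - _]HVVd [HV u * HX - _]HVVd mulm2 -[X in _ + X]mulrA -mulrDr.
  rewrite mulr_sumr mulr_suml -big_split big1 ?mulr0 // => i _ /=.
  apply: bracket_kill (Hrefl_Y _) _ => //.
  rewrite -polyCM -polyCD pairing_X pairing_Y; set d := _^-1.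
  have zi : zeta ^+ i != 0 by rewrite expf_neq0 // (zeta_neq0 zetaP).
  by rewrite mulrN1 mulNr [X in _ + X]mulrAC mulfK // addNr.
- by move=> u; rewrite -mulrA (HVdC _ u) mulrA (HVdC _ u) -mulrA.
- apply: comm_W => w i E.
  exact: refl_comm (Hrefl_X E) (Hrefl_Y E) (zV i) (HVdC _ _).
Qed.

End CenterElements.

End CherednikTheory.

Section Elements.
Variables (C : numClosedFieldType) (zeta : C).
Hypothesis zetaP : 3.-primitive_root zeta.

Local Notation Z := (Z zeta).
Local Notation H := (H zeta).
Local Notation W := (W zeta).

Definition q : Z := exist _ (Hx zeta * Hy zeta) (q_center zetaP).
Definition Q : Z := exist _ (HX zeta * HY zeta) (Q_center zetaP).

(* coordinates of C[Par x V x Vd] = C[A][X, Y, x, y] *)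
Definition iX : 'I_4 := @Ordinal 4 0 isT.
Definition iY : 'I_4 := @Ordinal 4 1 isT.
Definition ix : 'I_4 := @Ordinal 4 2 isT.
Definition iy : 'I_4 := @Ordinal 4 3 isT.

(* the image of (A^k X^a Y^b) (x) w (x) (x^c y^d) under multiplication
   C[Par] (x) C[V] (x) CW (x) C[Vd] -> H, extended linearly *)
Definition mult_map (P : {mpoly {poly C}[4]}) (w : W) : H :=
  \sum_(m <- msupp P)
    Hconst zeta P@_m * HX zeta ^+ m iX * HY zeta ^+ m iY * HW w *
    Hx zeta ^+ m ix * Hy zeta ^+ m iy.

(* An element of the tensor product is presented as a finite sum of P (x) w;
   Trunc keeps the terms with w = 1.  That this is a function of h is the PBW
   theorem. *)
Definition is_Trunc (h : H) (P : {mpoly {poly C}[4]}) : Prop :=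
  exists s : seq ({mpoly {poly C}[4]} * W),
    h = \sum_(u <- s) mult_map u.1 u.2
    /\ P = \sum_(u <- s | val u.2 == 1%:M) u.1.

Definition eu : Z :=
  xget 0 [set z : Z | is_Trunc (val z) ('X_ix * 'X_iX + 'X_iy * 'X_iY)].

(* points of the variety with algebra of functions Z fixed by mu_m *)
Definition fixedZ (m : nat) : set (Z -> C) :=
  [set p | points (fun a => Zconst zeta a%:P) p
    /\ forall (xi : C) (xi0 : xi != 0), xi ^+ m = 1 ->
         forall z, p (actZ xi0 z) = p z].

Definition restrictZ (F : set (Z -> C)) : Z -> functions_on F :=
  @quotR _ (vanishing F).

Definition presentation (B : pzRingType) (j : {poly C} -> B) (n : nat)
    (g : 'I_n -> B) (rels : set {mpoly {poly C}[n]}) : Prop :=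
  exists phi : {rmorphism {mpoly {poly C}[n]} -> B},
    [/\ forall a, phi a%:MP = j a, forall i, phi 'X_i = g i,
        forall b, exists P, phi P = b
      & forall P, phi P = 0 <-> ideal2 rels P].

End Elements.

Section Specialization.
Variables (C : numClosedFieldType) (zeta : C).

Local Notation Z := (Z zeta).
Local Notation H := (H zeta).
Local Notation W := (W zeta).

(* c i is the value at s_i of a function on Ref(W) *)
Definition class_function (c : 'I_3 -> C) : Prop :=
  forall (w : W) (i j : 'I_3), val w *m refl zeta i = refl zeta j *m val w -> c i = c j.

Variable c : 'I_3 -> C.

Definition Hc : Type :=
  quotRing [set h : H | exists i, h = Hconst zeta ('X - (c i)%:P)].
HB.instance Definition _ := GRing.PzRing.on Hc.
Definition Hc_pi : H -> Hc := @quotR _ _.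
HB.instance Definition _ := GRing.RMorphism.on Hc_pi.

Definition Zc : Type :=
  quotRing [set z : Z | exists i, z = Zconst zeta ('X - (c i)%:P)].
HB.instance Definition _ := GRing.PzRing.on Zc.
Definition Zc_pi : Z -> Zc := @quotR _ _.
HB.instance Definition _ := GRing.RMorphism.on Zc_pi.
Definition Zc_const (a : C) : Zc := Zc_pi (Zconst zeta a%:P).

Definition fixedZc (m : nat) : set (Zc -> C) :=
  [set p | points Zc_const p
    /\ forall (xi : C) (xi0 : xi != 0), xi ^+ m = 1 ->
         forall z, p (Zc_pi (actZ xi0 z)) = p (Zc_pi z)].

Definition linear_subst (M : 'M[C]_2) (p : {mpoly C[2]}) : {mpoly C[2]} :=
  comp_mpoly [tuple \sum_l M k l *: 'X_l | k < 2] p.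

(* w sends the k-th coordinate function to row k of w^-1, and the k-th basis
   vector to column k of w *)
Definition invariant_CV (p : {mpoly C[2]}) : Prop :=
  forall w : W, linear_subst (invmx (val w)) p = p.
Definition invariant_CVd (p : {mpoly C[2]}) : Prop :=
  forall w : W, linear_subst (val w)^T p = p.

Definition eval_CV (p : {mpoly C[2]}) : H :=
  mpoly.mmap (fun a => Hconst zeta a%:P) (fun k => HVd zeta (delta_mx 0 k)) p.
Definition eval_CVd (p : {mpoly C[2]}) : H :=
  mpoly.mmap (fun a => Hconst zeta a%:P) (fun k => HV zeta (delta_mx k 0)) p.

Definition coinvariant_rel : set Hc :=
  [set h | (exists p, [/\ invariant_CV p, p@_0%MM = 0 & h = Hc_pi (eval_CV p)])
        \/ (exists p, [/\ invariant_CVd p, p@_0%MM = 0 & h = Hc_pi (eval_CVd p)])].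

Definition Hbar : Type := quotRing coinvariant_rel.
HB.instance Definition _ := GRing.PzRing.on Hbar.
Definition Hbar_pi (h : H) : Hbar := @quotR _ coinvariant_rel (Hc_pi h).

(* Hbar (x)_{Hbar^-} E for E = C^n with W acting through rho and V by 0:
   Hbar (x)_C C^n = Hbar^n modulo b (x) e_j - 1 (x) b e_j, where it suffices to
   let b run over the generators W and V of Hbar^- *)
Section BabyVerma.
Variables (n : nat) (rho : W -> 'M[C]_n).

Inductive baby_verma_rel : 'rV[Hbar]_n -> Prop :=
| baby_verma_W w j : baby_verma_rel
    (Hbar_pi (HW w) *: delta_mx 0 j
     - \sum_k Hbar_pi (Hconst zeta (rho w k j)%:P) *: delta_mx 0 k)
| baby_verma_V u j : baby_verma_rel (Hbar_pi (HV zeta u) *: delta_mx 0 j).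

Definition baby_verma : Type := quotMod baby_verma_rel.
HB.instance Definition _ := GRing.Lmodule.on baby_verma.

End BabyVerma.

Definition simple_module (A : pzRingType) (L : lmodType A) : Prop :=
  (exists v : L, v != 0) /\
  forall P : {pred L}, GRing.submod_closed P ->
    (forall v, v \in P -> v = 0) \/ (forall v, v \in P).

Definition simple_quotient (A : pzRingType) (M L : lmodType A)
    (f : {linear M -> L}) : Prop :=
  simple_module L /\ forall v, exists u, f u = v.

(* p is the point z_chi, for the representation rho of character chi *)
Definition is_zpoint n (rho : W -> 'M[C]_n) (p : Zc -> C) : Prop :=
  [/\ points Zc_const p,
      exists (L : lmodType Hbar) (f : {linear baby_verma rho -> L}),
        simple_quotient f
    & forall (L : lmodType Hbar) (f : {linear baby_verma rho -> L}),
        simple_quotient f -> forall (z : Z) (v : L),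
          Hbar_pi (val z) *: v = Hbar_pi (Hconst zeta (p (Zc_pi z))%:P) *: v].

End Specialization.

Arguments fixedZ {C} zeta m.
Arguments restrictZ {C zeta} F.
Arguments eu {C} zeta.
Arguments q {C zeta} zetaP.
Arguments Q {C zeta} zetaP.
Arguments class_function {C} zeta c.
Arguments fixedZc {C} zeta c m.
Arguments Zc_const {C} zeta c a.
Arguments Zc_pi {C zeta} c z.

Section Irreps.
Variables (C : numClosedFieldType) (zeta : C).
Definition rho_triv (w : W zeta) : 'M[C]_1 := 1%:M.
Definition rho_det (w : W zeta) : 'M[C]_1 := (\det (val w))%:M.
Definition rho_nat (w : W zeta) : 'M[C]_2 := val w.
End Irreps.

Arguments rho_triv {C} zeta w.
Arguments rho_det {C} zeta w.
Arguments rho_nat {C} zeta w.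

(* Main.v *)
(* The algebra H acts on C[X, Y] / (XY - Q, X^3 + Y^3 - 2 rho), a space of
   dimension 6, with x and y acting by Dunkl-type operators that depend on two
   further parameters a, b.  These representations separate the elements of H and
   the centre acts on them by scalars; hence identities between central elements
   reduce to identities between polynomials in A, Q, rho, a, b.

   The centre is generated by A, q, Q, eu and four elements r, R, u, U of odd
   degree, and with G = eu^2 - 9 A^2 - 4 q Q one has
     q G = r U - u^2,  Q G = R u - U^2,  eu G = r R - u U.
   As mu_2 changes the signs of r, R, u, U, the fixed points are those where the
   latter vanish, and there q G = Q G = eu G = 0.  Conversely, the representations
   with rho = b = 0 cover the part Q <> 0 of the surface G = 0, and the point
   z_(chi_1) has q = Q = eu = 0; so a polynomial vanishing on the fixed locus is
   G times a polynomial without constant term.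

   The points z_chi are the central characters of simple quotients of baby Verma
   modules: q, Q, r, R act by 0 and the relations make u and U nilpotent.

   Finally, a chain of four irreducible closed subsets of the surface would give
   three algebraically independent functions on it, which is impossible because
   its functions embed into polynomials in two variables. *)

Require Import Defs.
From HB Require Import structures.
From mathcomp Require Import all_boot all_order all_algebra.
From mathcomp Require Import boolp classical_sets reals.
From mathcomp Require Import complex mpoly.
From mathcomp Require Import ring zify.
From mathcomp.multinomials Require Import ssrcomplements.
Set Implicit Arguments.
Unset Strict Implicit.
Unset Printing Implicit Defensive.
Import GRing.Theory Num.Theory.
Local Open Scope classical_set_scope.
Local Open Scope ring_scope.

(** * Representations of the Cherednik algebra *)

(** Only the defining relations of [H] are given, so the independence of ordered monomials and the
    generators of the centre must both be read off the charts. Their form comes from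
    [W]-equivariance. The pair [(a Y + b X^2, a X + b Y^2)] is the gradient of the invariant
    [a X Y + b (X^3 + Y^3) / 3], and where [X^3 != Y^3] it takes every value as [a], [b] vary. The
    divided differences are linear over invariants, so they survive in the quotient by [XY - Q] and
    [X^3 + Y^3 - 2 rho]. When [a], [b] are scaled by a formal variable, the leading coefficients of
    [X], [Y], [x], [y] are diagonalised by evaluation at the six points of a generic orbit, which
    [W] permutes; this recovers the symbol of an element. For a central element the symbol sits in
    the component of the identity and is constant along orbits, as a chart depends only on [Q] and
    [rho]. Averaging over the orbit expresses it through the generators, and induction on the degree
    in [x], [y] concludes. The charts with [rho = b = 0] have [eu = - 3 A] when [Q = 0]; the line
    [Q = 0], [eu = 3 A] is reached by twisting with det. *)

Lemma mul2E (R : pzSemiRingType) (v w : 'M[R]_2) i j :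
  (v *m w) i j = v i 0 * w 0 j + v i 1 * w 1 j.
Proof.
rewrite !mxE !big_ord_recl big_ord0 addr0.
by congr (v _ _ * w _ _ + v _ _ * w _ _); apply: val_inj.
Qed.

Section ReflectionGroup.
Context {C : numClosedFieldType} {zeta : C}.
Hypothesis zetaP : 3.-primitive_root zeta.

Local Notation W := (W zeta).

Lemma zeta3 : zeta ^+ 3 = 1.
Proof. exact: prim_expr_order zetaP. Qed.

Lemma zeta_sum : zeta ^+ 2 = - zeta - 1.
Proof.
have z1 : zeta - 1 != 0.
  apply/eqP => /eqP; rewrite subr_eq0 => /eqP z1.
  by have := eq_prim_root_expr zetaP 1 0; rewrite z1 !expr1n eqxx.
apply: (mulfI z1); apply/eqP; rewrite -subr_eq0; apply/eqP.
transitivity (zeta ^+ 3 - 1); first by ring.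
by rewrite zeta3 subrr.
Qed.

Lemma zetaV : zeta^-1 = zeta ^+ 2.
Proof.
apply: (mulfI (zeta_neq0 zetaP)); rewrite mulfV ?(zeta_neq0 zetaP) //.
by rewrite -exprS zeta3.
Qed.

Lemma zetaV2 : (zeta ^+ 2)^-1 = zeta.
Proof. by rewrite -zetaV invrK. Qed.

Lemma refl_mulE i (u : 'cV[C]_2) :
  ((refl zeta i *m u) 0 0 = zeta ^+ i * u 1 0) *
  ((refl zeta i *m u) 1 0 = zeta ^- i * u 0 0).
Proof.
by split; rewrite !mxE !big_ord_recl big_ord0 !mxE /= !mul0r ?add0r ?addr0;
  congr (_ * u _ _); apply: val_inj.
Qed.

Lemma mul_reflE i (U : 'rV[C]_2) :
  ((U *m refl zeta i) 0 0 = zeta ^- i * U 0 1) *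
  ((U *m refl zeta i) 0 1 = zeta ^+ i * U 0 0).
Proof.
by split; rewrite !mxE !big_ord_recl big_ord0 !mxE /= !mulr0 ?add0r ?addr0 mulrC;
  congr (_ * U _ _); apply: val_inj.
Qed.

Lemma det_refl i : \det (refl zeta i) = -1.
Proof.
rewrite (expand_det_row _ 0) !big_ord_recl big_ord0 /cofactor !det_mx11 !mxE /=.
rewrite mul0r add0r addr0 /bump /= expr1 mulN1r mulrN mulfV //.
by rewrite expf_neq0 ?(zeta_neq0 zetaP).
Qed.

End ReflectionGroup.

(** * Morphisms out of [H] *)

Section HMorphism.
Context {C : numClosedFieldType} {zeta : C}.
Hypothesis zetaP : 3.-primitive_root zeta.

Local Notation W := (W zeta).
Local Notation gen := (gen zeta).

Variables (S : nzRingType) (f : {rmorphism {poly C} -> S}) (rho : W -> S).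
Variables x y X Y : S.

Hypothesis fC : forall a s, f a * s = s * f a.
Hypothesis rho1 : forall w : W, val w = 1%:M -> rho w = 1.
Hypothesis rhoM : forall w1 w2 w3 : W, val w3 = val w1 *m val w2 ->
  rho w1 * rho w2 = rho w3.
Hypothesis rho_x : forall (w : W) i, val w = refl zeta i ->
  rho w * x = f (zeta ^- i)%:P * y * rho w.
Hypothesis rho_y : forall (w : W) i, val w = refl zeta i ->
  rho w * y = f (zeta ^+ i)%:P * x * rho w.
Hypothesis rho_X : forall (w : W) i, val w = refl zeta i ->
  rho w * X = f (zeta ^+ i)%:P * Y * rho w.
Hypothesis rho_Y : forall (w : W) i, val w = refl zeta i ->
  rho w * Y = f (zeta ^- i)%:P * X * rho w.
Hypotheses (xyC : x * y = y * x) (XYC : X * Y = Y * X).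
Let s_ i := rho (reflW zeta i).
Hypothesis xX : x * X - X * x = - f 'X * \sum_(i < 3) s_ i.
Hypothesis xY : x * Y - Y * x = f 'X * \sum_(i < 3) f (zeta ^- i)%:P * s_ i.
Hypothesis yX : y * X - X * y = f 'X * \sum_(i < 3) f (zeta ^+ i)%:P * s_ i.
Hypothesis yY : y * Y - Y * y = - f 'X * \sum_(i < 3) s_ i.

Let phi (g : gen) : S :=
  match g with
  | inl (inl k) => if k == 0 then x else y
  | inl (inr k) => if k == 0 then X else Y
  | inr w => rho w
  end.

Let fphi a g : GRing.comm (f a) (phi g).
Proof. exact: fC. Qed.

Let F := freeLiftM fphi.

Let mV (u : 'cV[C]_2) := f (u 0 0)%:P * x + f (u 1 0)%:P * y.
Let mVd (U : 'rV[C]_2) := f (U 0 0)%:P * X + f (U 0 1)%:P * Y.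

Let FV u : F (fV zeta u) = mV u.
Proof.
rewrite /F freeLift_fV !big_ord_recl big_ord0 addr0 /mV.
by congr (_ + f (u _ _)%:P * _); apply: val_inj.
Qed.

Let FVd u : F (fVd zeta u) = mVd u.
Proof.
rewrite /F freeLift_fVd !big_ord_recl big_ord0 addr0 /mVd.
by congr (_ + f (u _ _)%:P * _); apply: val_inj.
Qed.

Let FW w : F (fW w) = rho w.
Proof. exact: freeLift_gen. Qed.

Let Fc a : F (fconst zeta a) = f a.
Proof. exact: freeLift_const. Qed.

Let fM a b : f (a * b)%:P = f a%:P * f b%:P.
Proof. by rewrite polyCM rmorphM. Qed.

Let mulff a b s t : f a * s * (f b * t) = f a * f b * (s * t).
Proof. by rewrite -!mulrA; congr (_ * _); rewrite mulrA -fC -!mulrA. Qed.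

Let mulfV a b s t : f a%:P * s * (f b%:P * t) = f (a * b)%:P * (s * t).
Proof. by rewrite mulff fM. Qed.

Let fA a s t : s * (f a * t) = f a * (s * t).
Proof. by rewrite mulrA -fC mulrA. Qed.

(** The group is generated by [refl 0] and [refl 1], for which the relation is given on coordinates;
    it passes to products and inverses along [inW]. *)
Let rho_M (w : W) : (forall u, rho w * mV u = mV (val w *m u) * rho w) /\
  (forall U, rho w * mVd U = mVd (U *m invmx (val w)) * rho w).
Proof.
suff h m : inW zeta m -> forall w, val w = m ->
    (forall u, rho w * mV u = mV (m *m u) * rho w) /\
    (forall U, rho w * mVd U = mVd (U *m invmx m) * rho w).
  exact: (h _ (inW_val w) w).
have hs i w' : val w' = refl zeta i ->
    (forall u, rho w' * mV u = mV (refl zeta i *m u) * rho w') /\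
    (forall U, rho w' * mVd U = mVd (U *m invmx (refl zeta i)) * rho w').
  move=> E; split=> u.
    rewrite /mV !refl_mulE mulrDr !fA (rho_x E) (rho_y E) addrC mulrDl.
    by rewrite (mulrC (zeta ^+ i)) (mulrC (zeta ^- i)) !fM !mulrA.
  rewrite (refl_inv zetaP) /mVd !mul_reflE mulrDr !fA (rho_X E) (rho_Y E).
  by rewrite addrC mulrDl (mulrC (zeta ^+ i)) (mulrC (zeta ^- i)) !fM !mulrA.
elim=> {w m} [w E|w E|w E|m1 m2 h1 IH1 h2 IH2 w E|m h IH w E].
- exact: hs.
- exact: hs.
- by rewrite (rho1 E); split=> u; rewrite mul1r mulr1 ?invmx1 ?mul1mx ?mulmx1.
- have E' : rho (toW h1) * rho (toW h2) = rho w by apply: rhoM.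
  have u1 : m1 \in unitmx := inW_unit zetaP h1.
  have u2 : m2 \in unitmx := inW_unit zetaP h2.
  have [I1 I1'] := IH1 (toW h1) erefl; have [I2 I2'] := IH2 (toW h2) erefl.
  split=> u; rewrite -E' -mulrA.
    by rewrite I2 mulrA I1 -!mulrA mulmxA.
  have iM : invmx (m1 *m m2) = invmx m2 *m invmx m1 := invrM u1 u2.
  by rewrite I2' mulrA I1' -!mulrA iM mulmxA.
have u1 : m \in unitmx := inW_unit zetaP h.
have [I I'] := IH (toW h) erefl.
have h12 : rho w * rho (toW h) = 1.
  by rewrite (@rhoM w (toW h) (toW (inW_1 zeta))) ?rho1 //= [val w](E) mulVmx.
have h21 : rho (toW h) * rho w = 1.
  by rewrite (@rhoM (toW h) w (toW (inW_1 zeta))) ?rho1 //= [val w](E) mulmxV.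
split=> u.
  rewrite -[mV (_ *m u)]mul1r -h12 -!mulrA; congr (_ * _).
  by rewrite mulrA I mulmxA mulmxV // mul1mx -mulrA h21 mulr1.
rewrite -[mVd (u *m _)]mul1r -h12 -!mulrA; congr (_ * _).
by rewrite mulrA I' invmxK mulmxK // -mulrA h21 mulr1.
Qed.

Let mV_C u u' : mV u * mV u' = mV u' * mV u.
Proof.
rewrite /mV !mulrDl !mulrDr !mulfV xyC.
rewrite (mulrC (u' 0 0) (u 0 0)) (mulrC (u' 0 0) (u 1 0)).
rewrite (mulrC (u' 1 0) (u 0 0)) (mulrC (u' 1 0) (u 1 0)).
by rewrite !addrA; congr (_ + _); rewrite -!addrA; congr (_ + _); rewrite addrC.
Qed.

Let mVd_C U U' : mVd U * mVd U' = mVd U' * mVd U.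
Proof.
rewrite /mVd !mulrDl !mulrDr !mulfV XYC.
rewrite (mulrC (U' 0 0) (U 0 0)) (mulrC (U' 0 0) (U 0 1)).
rewrite (mulrC (U' 0 1) (U 0 0)) (mulrC (U' 0 1) (U 0 1)).
by rewrite !addrA; congr (_ + _); rewrite -!addrA; congr (_ + _); rewrite addrC.
Qed.

(** The denominator [pairing (alphav i) (alpha i)] is [2 zeta ^+ i]; its 2 cancels the factor -2 of
    the defining commutator. *)
Let coef (u : 'cV[C]_2) (U : 'rV[C]_2) i :
  pairing u (alpha zeta i) * pairing (alphav zeta i) U
    / pairing (alphav zeta i) (alpha zeta i) * 2 =
  u 0 0 * U 0 0 + u 1 0 * U 0 1
  - (u 0 0 * U 0 1 * zeta ^- i + u 1 0 * U 0 0 * zeta ^+ i).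
Proof.
rewrite /pairing !mxE !big_ord_recl !big_ord0 !mxE /= !addr0.
have -> : lift ord0 ord0 = 1 :> 'I_2 by apply: val_inj.
have -> : ord0 = 0 :> 'I_2 by apply: val_inj.
have z0 : zeta ^+ i != 0 by rewrite expf_neq0 // (zeta_neq0 zetaP).
have z2 : zeta ^+ i + - zeta ^+ i * -1 = 2 * zeta ^+ i by ring.
by field; rewrite z0 z2 mulf_neq0 // pnatr_eq0.
Qed.

Let mVVd u U : mV u * mVd U - mVd U * mV u = - 2%:R * \sum_(i < 3) f 'X *
     f (pairing u (alpha zeta i) * pairing (alphav zeta i) U
                  / pairing (alphav zeta i) (alpha zeta i))%:P * s_ i.
Proof.
have -> : mV u * mVd U - mVd U * mV u =
    f (u 0 0 * U 0 0)%:P * (x * X - X * x) + f (u 1 0 * U 0 1)%:P * (y * Y - Y * y)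
  + (f (u 0 0 * U 0 1)%:P * (x * Y - Y * x) + f (u 1 0 * U 0 0)%:P * (y * X - X * y)).
  rewrite /mV /mVd !mulrDl !mulrDr !mulfV !mulrN.
  rewrite (mulrC (U 0 0) (u 0 0)) (mulrC (U 0 0) (u 1 0)).
  rewrite (mulrC (U 0 1) (u 0 0)) (mulrC (U 0 1) (u 1 0)).
  move: (_ * (x * X)) (_ * (x * Y)) (_ * (y * X)) (_ * (y * Y)).
  move: (_ * (X * x)) (_ * (Y * x)) (_ * (X * y)) (_ * (Y * y)).
  move=> a1 a2 a3 a4 b1 b2 b3 b4; rewrite !opprD !addrA.
  by rewrite (ACl (1*5*4*8*2*7*3*6)) /=.
have S0 c : f c%:P * (- f 'X * \sum_(i < 3) s_ i) =
    \sum_(i < 3) f 'X * f (- c)%:P * s_ i.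
  rewrite mulrA mulrN -mulNr -rmorphN -polyCN fC mulr_sumr.
  by apply: eq_bigr => i _.
have S1 c d : f c%:P * (f 'X * \sum_(i < 3) f (d i)%:P * s_ i) =
    \sum_(i < 3) f 'X * f (c * d i)%:P * s_ i.
  rewrite mulrA fC mulr_sumr; apply: eq_bigr => i _.
  by rewrite fM !mulrA.
rewrite xX yY xY yX !S0 !S1 -!big_split mulr_sumr; apply: eq_bigr => i _ /=.
have -> : - 2%:R = f (- 2)%:P by rewrite polyCN rmorphN polyC_natr rmorph_nat.
have fX b c t : f b%:P * (f 'X * f c%:P * t) = f 'X * f (b * c)%:P * t.
  by rewrite mulrA -!rmorphM polyCM; congr (f _ * _); ring.
rewrite fX.
rewrite -!mulrDl -!mulrDr -!(rmorphD f) -!polyCD; congr (_ * f _%:P * _).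
by rewrite mulNr [in RHS]mulrC coef; ring.
Qed.
Let kill h : cherednik_rel h -> F h = 0.
Proof.
apply: (@rel_kill _ _ _ F).
- by move=> w w1; rewrite FW rho1.
- by move=> w1 w2 w3 E; rewrite !FW (rhoM E).
- by move=> w u; rewrite FW !FV (rho_M w).1.
- by move=> w u; rewrite FW !FVd (rho_M w).2.
- by move=> u u'; rewrite !FV mV_C.
- by move=> u u'; rewrite !FVd mVd_C.
move=> u U; rewrite FV FVd mVVd; congr (_ * _); apply: eq_bigr => i _.
by rewrite !Fc FW.
Qed.

(** The universal property of [H] in coordinates: equivariance is asked only of reflections, and the
    commutator only for the four pairs of basis vectors. *)
Definition H_rep : {rmorphism H zeta -> S} := quotR_liftM kill.

Let H_rep_Hpi u : H_rep (Hpi u) = F u.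
Proof. exact: quotR_liftME. Qed.

Lemma H_rep_const a : H_rep (Hconst zeta a) = f a.
Proof. by rewrite -Hpi_fconst H_rep_Hpi Fc. Qed.
Lemma H_rep_W w : H_rep (HW w) = rho w.
Proof. by rewrite /HW H_rep_Hpi FW. Qed.
Lemma H_rep_x : H_rep (Hx zeta) = x.
Proof.
rewrite /Hx /HV H_rep_Hpi FV /mV !mxE !eqxx polyC0 polyC1 rmorph0 rmorph1.
by rewrite mul1r mul0r addr0.
Qed.
Lemma H_rep_y : H_rep (Hy zeta) = y.
Proof.
rewrite /Hy /HV H_rep_Hpi FV /mV !mxE !eqxx polyC0 polyC1 rmorph0 rmorph1.
by rewrite mul1r mul0r add0r.
Qed.
Lemma H_rep_X : H_rep (HX zeta) = X.
Proof.
rewrite /HX /HVd H_rep_Hpi FVd /mVd !mxE !eqxx polyC0 polyC1 rmorph0 rmorph1.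
by rewrite mul1r mul0r addr0.
Qed.
Lemma H_rep_Y : H_rep (HY zeta) = Y.
Proof.
rewrite /HY /HVd H_rep_Hpi FVd /mVd !mxE !eqxx polyC0 polyC1 rmorph0 rmorph1.
by rewrite mul1r mul0r add0r.
Qed.

End HMorphism.

Section Columns.
Variable R : comNzRingType.

Definition col6 (c0 c1 c2 c3 c4 c5 : R) : 'cV[R]_6 :=
  \col_i [:: c0; c1; c2; c3; c4; c5]`_i.

Definition mx6 (L : seq (seq R)) : 'M[R]_6 := \matrix_(i, j) (nth [::] L i)`_j.

Definition dot6 (l : seq R) (c0 c1 c2 c3 c4 c5 : R) : R :=
  l`_0 * c0 + l`_1 * c1 + l`_2 * c2 + l`_3 * c3 + l`_4 * c4 + l`_5 * c5.

Lemma mx6_col l0 l1 l2 l3 l4 l5 c0 c1 c2 c3 c4 c5 :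
  mx6 [:: l0; l1; l2; l3; l4; l5] *m col6 c0 c1 c2 c3 c4 c5 =
  col6 (dot6 l0 c0 c1 c2 c3 c4 c5) (dot6 l1 c0 c1 c2 c3 c4 c5)
       (dot6 l2 c0 c1 c2 c3 c4 c5) (dot6 l3 c0 c1 c2 c3 c4 c5)
       (dot6 l4 c0 c1 c2 c3 c4 c5) (dot6 l5 c0 c1 c2 c3 c4 c5).
Proof.
apply/matrixP => i j; rewrite !mxE !big_ord_recl big_ord0 !mxE /= addr0 !addrA.
by case: i => -[|[|[|[|[|[|]]]]]].
Qed.

Lemma col6D a0 a1 a2 a3 a4 a5 b0 b1 b2 b3 b4 b5 :
  col6 a0 a1 a2 a3 a4 a5 + col6 b0 b1 b2 b3 b4 b5 =
  col6 (a0 + b0) (a1 + b1) (a2 + b2) (a3 + b3) (a4 + b4) (a5 + b5).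
Proof.
by apply/matrixP => -[[|[|[|[|[|[|]]]]]] i] j //; rewrite !mxE.
Qed.

Lemma col6Z k a0 a1 a2 a3 a4 a5 : k *: col6 a0 a1 a2 a3 a4 a5 =
  col6 (k * a0) (k * a1) (k * a2) (k * a3) (k * a4) (k * a5).
Proof.
by apply/matrixP => -[[|[|[|[|[|[|]]]]]] i] j //; rewrite !mxE.
Qed.

Lemma col6N a0 a1 a2 a3 a4 a5 : - col6 a0 a1 a2 a3 a4 a5 =
  col6 (- a0) (- a1) (- a2) (- a3) (- a4) (- a5).
Proof.
by apply/matrixP => -[[|[|[|[|[|[|]]]]]] i] j //; rewrite !mxE.
Qed.

Lemma col6_surj (v : 'cV[R]_6) : exists c0 c1 c2 c3 c4 c5,
  v = col6 c0 c1 c2 c3 c4 c5.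
Proof.
exists (v (@Ordinal 6 0 isT) 0), (v (@Ordinal 6 1 isT) 0),
  (v (@Ordinal 6 2 isT) 0), (v (@Ordinal 6 3 isT) 0),
  (v (@Ordinal 6 4 isT) 0), (v (@Ordinal 6 5 isT) 0).
apply/matrixP => -[[|[|[|[|[|[|]]]]]] i] j //; rewrite !mxE ord1 /=;
  by congr (v _ _); apply: val_inj.
Qed.

Lemma mx6P (M N : 'M[R]_6) : (forall c0 c1 c2 c3 c4 c5,
  M *m col6 c0 c1 c2 c3 c4 c5 = N *m col6 c0 c1 c2 c3 c4 c5) -> M = N.
Proof.
move=> MN; apply/matrixP => i j.
have [c0 [c1 [c2 [c3 [c4 [c5 E]]]]]] := col6_surj (delta_mx j 0).
have := MN c0 c1 c2 c3 c4 c5; rewrite -E => /colP/(_ i).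
by rewrite -!colE !mxE.
Qed.

End Columns.

(** * The six-dimensional charts *)

Section Chart.
Context {C : numClosedFieldType} {zeta : C}.
Hypothesis zetaP : 3.-primitive_root zeta.
Variables (R : comNzRingType) (kappa : {rmorphism C -> R}).
Variables (tw : bool) (A Q rho a b : R).

Local Notation W := (W zeta).

Let At : R := if tw then - A else A.

(* [R[X, Y] / (XY - Q, X^3 + Y^3 - 2 rho)] in the basis 1, X, Y, X^2, Y^2,
   (X^3 - Y^3) / 2.  Here X and Y act by multiplication, and x, y by
   [a Y + b X^2 + A D_x] and [a X + b Y^2 + A D_y], where [D_x], [D_y] are the
   divided-difference parts of the Dunkl operators.  The flag [tw] tensors with
   det, which changes the sign of [A]. *)
Definition chart_X : 'M[R]_6 := mx6
  [:: [:: 0; 0; Q; rho; 0; 0]; [:: 1; 0; 0; 0; 0; rho]; [:: 0; 0; 0; 0; Q; 0];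
      [:: 0; 1; 0; 0; 0; 0]; [:: 0; 0; 0; 0; 0; - Q]; [:: 0; 0; 0; 1; 0; 0]].

Definition chart_Y : 'M[R]_6 := mx6
  [:: [:: 0; Q; 0; 0; rho; 0]; [:: 0; 0; 0; Q; 0; 0]; [:: 1; 0; 0; 0; 0; - rho];
      [:: 0; 0; 0; 0; 0; Q]; [:: 0; 0; 1; 0; 0; 0]; [:: 0; 0; 0; 0; - 1; 0]].

(** The operator [f |-> - \sum_i (f - s_i f) / (X - zeta ^+ i Y)]. In [chart_dy] the [i]-th term
    carries the extra factor [- zeta ^+ i], the pairing of [y] with [alpha_i]. *)
Definition chart_dx : 'M[R]_6 := mx6
  [:: [:: 0; - 3; 0; 0; 0; 0]; [:: 0; 0; 0; - 3; 0; 0]; [:: 0; 0; 0; 0; 0; 0];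
      [:: 0; 0; 0; 0; 0; - 3]; [:: 0; 0; 0; 0; 0; 0]; [:: 0; 0; 0; 0; 0; 0]].

Definition chart_dy : 'M[R]_6 := mx6
  [:: [:: 0; 0; - 3; 0; 0; 0]; [:: 0; 0; 0; 0; 0; 0]; [:: 0; 0; 0; 0; - 3; 0];
      [:: 0; 0; 0; 0; 0; 0]; [:: 0; 0; 0; 0; 0; 3]; [:: 0; 0; 0; 0; 0; 0]].

Definition chart_x : 'M[R]_6 :=
  a *: chart_Y + b *: (chart_X *m chart_X) + At *: chart_dx.
Definition chart_y : 'M[R]_6 :=
  a *: chart_X + b *: (chart_Y *m chart_Y) + At *: chart_dy.

Let e (w : 'M[C]_2) i j := kappa (w i j).
Let d (w : 'M[C]_2) := kappa (\det w).

(** The entries of the elements of [W] are zero or cube roots of unity, so [X^2], [Y^2] transform by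
    [w] itself and [X], [Y] by [w] with both indices exchanged. In this form the formula is
    multiplicative on all matrices. *)
Definition chart_W (w : 'M[C]_2) : 'M[R]_6 := (if tw then d w else 1) *: mx6
  [:: [:: 1; 0; 0; 0; 0; 0];
      [:: 0; e w 1 1; e w 1 0; 0; 0; 0]; [:: 0; e w 0 1; e w 0 0; 0; 0; 0];
      [:: 0; 0; 0; e w 0 0; e w 0 1; 0]; [:: 0; 0; 0; e w 1 0; e w 1 1; 0];
      [:: 0; 0; 0; 0; 0; d w]].

Lemma chart_X_col c0 c1 c2 c3 c4 c5 : chart_X *m col6 c0 c1 c2 c3 c4 c5 =
  col6 (Q * c2 + rho * c3) (c0 + rho * c5) (Q * c4) c1 (- Q * c5) c3.
Proof. by rewrite mx6_col /dot6 /=; congr col6; ring. Qed.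

Lemma chart_Y_col c0 c1 c2 c3 c4 c5 : chart_Y *m col6 c0 c1 c2 c3 c4 c5 =
  col6 (Q * c1 + rho * c4) (Q * c3) (c0 - rho * c5) (Q * c5) c2 (- c4).
Proof. by rewrite mx6_col /dot6 /=; congr col6; ring. Qed.

Lemma chart_dx_col c0 c1 c2 c3 c4 c5 : chart_dx *m col6 c0 c1 c2 c3 c4 c5 =
  col6 (- 3 * c1) (- 3 * c3) 0 (- 3 * c5) 0 0.
Proof. by rewrite mx6_col /dot6 /=; congr col6; ring. Qed.

Lemma chart_dy_col c0 c1 c2 c3 c4 c5 : chart_dy *m col6 c0 c1 c2 c3 c4 c5 =
  col6 (- 3 * c2) 0 (- 3 * c4) 0 (3 * c5) 0.
Proof. by rewrite mx6_col /dot6 /=; congr col6; ring. Qed.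

Lemma chart_x_col c0 c1 c2 c3 c4 c5 : chart_x *m col6 c0 c1 c2 c3 c4 c5 =
  col6 (a * (Q * c1 + rho * c4) + b * (Q * (Q * c4) + rho * c1) - 3 * At * c1)
       (a * (Q * c3) + b * (Q * c2 + rho * c3 + rho * c3) - 3 * At * c3)
       (a * (c0 - rho * c5) - b * (Q * Q * c5))
       (a * (Q * c5) + b * (c0 + rho * c5) - 3 * At * c5)
       (a * c2 - b * (Q * c3)) (- a * c4 + b * c1).
Proof.
rewrite !mulmxDl -!scalemxAl -mulmxA !(chart_X_col, chart_Y_col, chart_dx_col).
by rewrite !(col6Z, col6D); congr col6; ring.
Qed.

Lemma chart_y_col c0 c1 c2 c3 c4 c5 : chart_y *m col6 c0 c1 c2 c3 c4 c5 =
  col6 (a * (Q * c2 + rho * c3) + b * (Q * (Q * c3) + rho * c2) - 3 * At * c2)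
       (a * (c0 + rho * c5) + b * (Q * Q * c5))
       (a * (Q * c4) + b * (Q * c1 + rho * c4 + rho * c4) - 3 * At * c4)
       (a * c1 - b * (Q * c4))
       (- a * (Q * c5) + b * (c0 - rho * c5) + 3 * At * c5)
       (a * c3 - b * c2).
Proof.
rewrite !mulmxDl -!scalemxAl -mulmxA !(chart_X_col, chart_Y_col, chart_dy_col).
by rewrite !(col6Z, col6D); congr col6; ring.
Qed.

Lemma chart_W_col w c0 c1 c2 c3 c4 c5 : chart_W w *m col6 c0 c1 c2 c3 c4 c5 =
  (if tw then d w else 1) *:
  col6 c0 (e w 1 1 * c1 + e w 1 0 * c2) (e w 0 1 * c1 + e w 0 0 * c2)
       (e w 0 0 * c3 + e w 0 1 * c4) (e w 1 0 * c3 + e w 1 1 * c4) (d w * c5).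
Proof.
by rewrite -scalemxAl mx6_col /dot6 /=; congr (_ *: col6 _ _ _ _ _ _); ring.
Qed.

Lemma chart_WM v w : chart_W (v *m w) = chart_W v * chart_W w.
Proof.
apply: mx6P => c0 c1 c2 c3 c4 c5.
rewrite -mulmxA !chart_W_col -scalemxAr chart_W_col scalerA /d det_mulmx.
rewrite /e !mul2E !(rmorphD, rmorphM).
congr (_ *: col6 _ _ _ _ _ _); try ring.
by case: (tw); rewrite ?mulr1 1?mulrC.
Qed.

Lemma chart_W1 : chart_W 1%:M = 1.
Proof.
apply: mx6P => c0 c1 c2 c3 c4 c5; rewrite chart_W_col mul1mx /d det1 /e !mxE /=.
rewrite !(rmorph1, rmorph0).
rewrite (_ : (if tw then 1 else 1) = 1) ?scale1r; last by case: (tw).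
by congr col6; ring.
Qed.

Lemma chart_refl_col i c0 c1 c2 c3 c4 c5 :
  chart_W (refl zeta i) *m col6 c0 c1 c2 c3 c4 c5 =
  (if tw then - 1 else 1) *:
  col6 c0 (kappa (zeta ^- i) * c2) (kappa (zeta ^+ i) * c1)
    (kappa (zeta ^+ i) * c4) (kappa (zeta ^- i) * c3) (- c5).
Proof.
have dE : d (refl zeta i) = -1.
  by rewrite /d (det_refl zetaP) rmorphN rmorph1.
rewrite chart_W_col dE /e !mxE /= !rmorph0.
by congr (_ *: col6 _ _ _ _ _ _); ring.
Qed.

Let hA : {rmorphism {poly C} -> R} :=
  horner_morph (fun x => mulrC A (kappa x) : GRing.comm A (kappa x)).

Let f : {rmorphism {poly C} -> 'M[R]_6} := @scalar_mx R 6 \o hA.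

Let hAC c : hA c%:P = kappa c.
Proof. by rewrite /hA /= horner_morphC. Qed.

Let hAX : hA 'X = A.
Proof. by rewrite /hA /= horner_morphX. Qed.

Let fC c (s : 'M[R]_6) : f c * s = s * f c.
Proof. by rewrite /f /=; exact/esym/scalar_mxC. Qed.

Let fcol c (v : 'cV[R]_6) : f c *m v = hA c *: v.
Proof. by rewrite /f /= mul_scalar_mx. Qed.

Let fcolM c (M : 'M[R]_6) (v : 'cV[R]_6) : (f c * M) *m v = hA c *: (M *m v).
Proof. by rewrite -mulmxA fcol. Qed.

Let zz i : kappa (zeta ^+ i) * kappa (zeta ^- i) = 1.
Proof. by rewrite -rmorphM mulfV ?rmorph1 ?expf_neq0 ?(zeta_neq0 zetaP). Qed.

Let zz2 i : kappa (zeta ^+ i) ^+ 2 = kappa (zeta ^- i).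
Proof.
rewrite -rmorphXn -exprM mulnC exprM; congr (kappa _).
by rewrite -exprVn (zetaV zetaP) -exprM.
Qed.

Let zV2 i : kappa (zeta ^- i) ^+ 2 = kappa (zeta ^+ i).
Proof.
by rewrite -zz2 -exprM -rmorphXn -exprM mulnC (exprM _ 4) exprS (zeta3 zetaP) mulr1.
Qed.

Let sg : R := if tw then - 1 else 1.

Let AtE : At = sg * A.
Proof. by rewrite /At /sg; case: (tw); ring. Qed.

Local Ltac refl_action E1 E2 :=
  move=> ->; apply: mx6P => c0 c1 c2 c3 c4 c5;
  rewrite -mulrA fcolM -!mulmxA hAC E1 !chart_refl_col -scalemxAr E2 !scalerA;
  rewrite [in RHS]mulrC -scalerA; congr (_ *: _); rewrite col6Z;
  match goal with i : nat |- _ => move: (zz i) (zz2 i) (zV2 i) end;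
  move: (kappa _) (kappa _).

Let rho_x (w : W) i : val w = refl zeta i ->
  chart_W (val w) * chart_x = f (zeta ^- i)%:P * chart_y * chart_W (val w).
Proof. by refl_action chart_x_col chart_y_col; move=> u v E1 E2 E3; congr col6; ring: E1 E2 E3. Qed.

Let rho_y (w : W) i : val w = refl zeta i ->
  chart_W (val w) * chart_y = f (zeta ^+ i)%:P * chart_x * chart_W (val w).
Proof. by refl_action chart_y_col chart_x_col; move=> u v E1 E2 E3; congr col6; ring: E1 E2 E3. Qed.

Let rho_X (w : W) i : val w = refl zeta i ->
  chart_W (val w) * chart_X = f (zeta ^+ i)%:P * chart_Y * chart_W (val w).
Proof. by refl_action chart_X_col chart_Y_col; move=> u v E1 E2 E3; congr col6; ring: E1 E2 E3. Qed.

Let rho_Y (w : W) i : val w = refl zeta i ->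
  chart_W (val w) * chart_Y = f (zeta ^- i)%:P * chart_X * chart_W (val w).
Proof. by refl_action chart_Y_col chart_X_col; move=> u v E1 E2 E3; congr col6; ring: E1 E2 E3. Qed.

Let xyC : chart_x * chart_y = chart_y * chart_x.
Proof.
apply: mx6P => c0 c1 c2 c3 c4 c5; rewrite -!mulmxA.
by rewrite !(chart_x_col, chart_y_col); congr col6; ring.
Qed.

Let XYC : chart_X * chart_Y = chart_Y * chart_X.
Proof.
apply: mx6P => c0 c1 c2 c3 c4 c5; rewrite -!mulmxA.
by rewrite !(chart_X_col, chart_Y_col); congr col6; ring.
Qed.

Let k := kappa zeta.
Let k2 : k ^+ 2 = - k - 1.
Proof. by rewrite -rmorphXn (zeta_sum zetaP) rmorphB rmorphN rmorph1. Qed.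

Let kE : (kappa (zeta ^+ 0) = 1) * (kappa (zeta ^- 0) = 1) * (kappa (zeta ^+ 1) = k)
  * (kappa (zeta ^- 1) = k ^+ 2) * (kappa (zeta ^+ 2) = k ^+ 2)
  * (kappa (zeta ^- 2) = k).
Proof.
do !split; rewrite ?expr0 ?invr1 ?rmorph1 ?expr1 ?(zetaV zetaP) ?(zetaV2 zetaP) //;
  exact: rmorphXn.
Qed.

Lemma chart_sum_refl c0 c1 c2 c3 c4 c5 :
  (\sum_(i < 3) chart_W (val (reflW zeta i))) *m col6 c0 c1 c2 c3 c4 c5 =
  (if tw then - 1 else 1) *: col6 (3 * c0) 0 0 0 0 (- 3 * c5).
Proof.
rewrite !big_ord_recl big_ord0 addr0 !mulmxDl /= !chart_refl_col -!scalerDr.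
rewrite !col6D !kE; congr (_ *: _).
by congr col6; ring: k2.
Qed.

Lemma chart_sum_zrefl c0 c1 c2 c3 c4 c5 :
  (\sum_(i < 3) f (zeta ^+ i)%:P * chart_W (val (reflW zeta i)))
    *m col6 c0 c1 c2 c3 c4 c5 =
  (if tw then - 1 else 1) *: col6 0 (3 * c2) 0 0 (3 * c3) 0.
Proof.
rewrite !big_ord_recl big_ord0 addr0 !mulmxDl !fcolM !hAC /= !chart_refl_col.
rewrite -/sg !(col6Z, col6D) !kE.
by congr col6; ring: k2.
Qed.

Lemma chart_sum_zVrefl c0 c1 c2 c3 c4 c5 :
  (\sum_(i < 3) f (zeta ^- i)%:P * chart_W (val (reflW zeta i)))
    *m col6 c0 c1 c2 c3 c4 c5 =
  (if tw then - 1 else 1) *: col6 0 0 (3 * c1) (3 * c4) 0 0.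
Proof.
rewrite !big_ord_recl big_ord0 addr0 !mulmxDl !fcolM !hAC /= !chart_refl_col.
rewrite -/sg !(col6Z, col6D) !kE.
by congr col6; ring: k2.
Qed.

Let xX : chart_x * chart_X - chart_X * chart_x =
  - f 'X * \sum_(i < 3) chart_W (val (reflW zeta i)).
Proof.
apply: mx6P => c0 c1 c2 c3 c4 c5.
rewrite mulNr mulNmx fcolM hAX chart_sum_refl mulmxBl -!mulmxA -/sg.
rewrite !(chart_x_col, chart_X_col) !(col6Z, col6N, col6D) AtE.
by congr col6; ring.
Qed.

Let yY : chart_y * chart_Y - chart_Y * chart_y =
  - f 'X * \sum_(i < 3) chart_W (val (reflW zeta i)).
Proof.
apply: mx6P => c0 c1 c2 c3 c4 c5.
rewrite mulNr mulNmx fcolM hAX chart_sum_refl mulmxBl -!mulmxA -/sg.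
rewrite !(chart_y_col, chart_Y_col) !(col6Z, col6N, col6D) AtE.
by congr col6; ring.
Qed.

Let xY : chart_x * chart_Y - chart_Y * chart_x =
  f 'X * \sum_(i < 3) f (zeta ^- i)%:P * chart_W (val (reflW zeta i)).
Proof.
apply: mx6P => c0 c1 c2 c3 c4 c5.
rewrite fcolM hAX chart_sum_zVrefl mulmxBl -!mulmxA -/sg.
rewrite !(chart_x_col, chart_Y_col) !(col6Z, col6N, col6D) AtE.
by congr col6; ring.
Qed.

Let yX : chart_y * chart_X - chart_X * chart_y =
  f 'X * \sum_(i < 3) f (zeta ^+ i)%:P * chart_W (val (reflW zeta i)).
Proof.
apply: mx6P => c0 c1 c2 c3 c4 c5.
rewrite fcolM hAX chart_sum_zrefl mulmxBl -!mulmxA -/sg.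
rewrite !(chart_y_col, chart_X_col) !(col6Z, col6N, col6D) AtE.
by congr col6; ring.
Qed.

Definition chart : {rmorphism H zeta -> 'M[R]_6} :=
  @H_rep C zeta zetaP 'M[R]_6 f (fun w => chart_W (val w))
    chart_x chart_y chart_X chart_Y fC
    (fun w E => etrans (congr1 chart_W E) chart_W1)
    (fun w1 w2 w3 E => esym (etrans (congr1 chart_W E) (chart_WM _ _)))
    rho_x rho_y rho_X rho_Y xyC XYC xX xY yX yY.

Lemma chart_const p : chart (Hconst zeta p) = (map_poly kappa p).[A]%:M.
Proof. exact: H_rep_const. Qed.
Lemma chart_HW w : chart (HW w) = chart_W (val w).
Proof. exact: H_rep_W. Qed.
Lemma chart_Hx : chart (Hx zeta) = chart_x.
Proof. exact: H_rep_x. Qed.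
Lemma chart_Hy : chart (Hy zeta) = chart_y.
Proof. exact: H_rep_y. Qed.
Lemma chart_HX : chart (HX zeta) = chart_X.
Proof. exact: H_rep_X. Qed.
Lemma chart_HY : chart (HY zeta) = chart_Y.
Proof. exact: H_rep_Y. Qed.

Lemma chart_S c0 c1 c2 c3 c4 c5 :
  chart (\sum_(i < 3) HW (reflW zeta i)) *m col6 c0 c1 c2 c3 c4 c5 =
  (if tw then - 1 else 1) *: col6 (3 * c0) 0 0 0 0 (- 3 * c5).
Proof.
rewrite -(chart_sum_refl c0 c1 c2 c3 c4 c5) rmorph_sum; congr (_ *m _).
by apply: eq_bigr => i _; exact: chart_HW.
Qed.

Lemma chart_Sz c0 c1 c2 c3 c4 c5 :
  chart (\sum_(i < 3) Hconst zeta (zeta ^+ i)%:P * HW (reflW zeta i))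
    *m col6 c0 c1 c2 c3 c4 c5 =
  (if tw then - 1 else 1) *: col6 0 (3 * c2) 0 0 (3 * c3) 0.
Proof.
rewrite -(chart_sum_zrefl c0 c1 c2 c3 c4 c5) rmorph_sum; congr (_ *m _); apply: eq_bigr => i _.
by rewrite rmorphM; congr (_ * _); [exact: H_rep_const|exact: chart_HW].
Qed.

Lemma chart_SzV c0 c1 c2 c3 c4 c5 :
  chart (\sum_(i < 3) Hconst zeta (zeta ^- i)%:P * HW (reflW zeta i))
    *m col6 c0 c1 c2 c3 c4 c5 =
  (if tw then - 1 else 1) *: col6 0 0 (3 * c1) (3 * c4) 0 0.
Proof.
rewrite -(chart_sum_zVrefl c0 c1 c2 c3 c4 c5) rmorph_sum; congr (_ *m _); apply: eq_bigr => i _.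
by rewrite rmorphM; congr (_ * _); [exact: H_rep_const|exact: chart_HW].
Qed.

Lemma chart_constX : chart (Hconst zeta 'X) = A%:M.
Proof. by rewrite chart_const map_polyX hornerX. Qed.

(** The sum of the reflections has eigenvalues 3 on [1], -3 on the last basis vector and 0 on the
    others (opposite signs when twisted). A commuting operator therefore maps [1] to a multiple of
    itself, and [1] generates the module under [X] and [Y]. *)
Lemma chart_scalar (z : H zeta) : (forall h, z * h = h * z) ->
  exists t, chart z = t%:M.
Proof.
move=> zC; have [c0 [c1 [c2 [c3 [c4 [c5 E]]]]]] := col6_surj (chart z *m col6 1 0 0 0 0 0).
have comm h v : chart z *m (chart h *m v) = chart h *m (chart z *m v).
  by rewrite !mulmxA -[_ *m chart h]rmorphM zC rmorphM.
(* Positive integers are invertible in [R], being images of units of [C] under [kappa]. *)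
have cancel n (c : R) : n.+1%:R * c = 0 -> c = 0.
  move=> nc; rewrite -[c]mul1r -(rmorph1 kappa) -(@mulVf _ n.+1%:R) ?pnatr_eq0 //.
  by rewrite rmorphM rmorph_nat -mulrA nc mulr0.
have ztw (u v : 'cV[R]_6) : (if tw then -1 else 1 : R) *: u = (if tw then -1 else 1) *: v -> u = v.
  by case: (tw); rewrite ?scale1r // !scaleN1r => /oppr_inj.
have : chart z *m (chart (\sum_(i < 3) HW (reflW zeta i)) *m col6 1 0 0 0 0 0) =
    (if tw then -1 else 1) *: (3 *: col6 c0 c1 c2 c3 c4 c5).
  rewrite chart_S -E -!scalemxAr; congr (_ *: _).
  by rewrite scalemxAr col6Z; congr (_ *m col6 _ _ _ _ _ _); ring.
rewrite comm E chart_S col6Z => /ztw /colP Ec.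
have z1 : c1 = 0 by have := Ec (@Ordinal 6 1 isT); rewrite !mxE /= => /esym/(@cancel 2).
have z2 : c2 = 0 by have := Ec (@Ordinal 6 2 isT); rewrite !mxE /= => /esym/(@cancel 2).
have z3 : c3 = 0 by have := Ec (@Ordinal 6 3 isT); rewrite !mxE /= => /esym/(@cancel 2).
have z4 : c4 = 0 by have := Ec (@Ordinal 6 4 isT); rewrite !mxE /= => /esym/(@cancel 2).
have z5 : c5 = 0.
  have := Ec (@Ordinal 6 5 isT); rewrite !mxE /= => Ec5; apply: (@cancel 5).
  by rewrite -[RHS](subrr (3 * c5)) -{2}Ec5; ring.
have {z1 z2 z3 z4 z5}E : chart z *m col6 1 0 0 0 0 0 = c0 *: col6 1 0 0 0 0 0.
  by rewrite E z1 z2 z3 z4 z5 col6Z !mulr0 mulr1.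
exists c0; apply: mx6P => a0 a1 a2 a3 a4 a5; rewrite mul_scalar_mx.
pose e0 := col6 (1 : R) 0 0 0 0 0.
have sX (v : 'cV[R]_6) : chart z *m v = c0 *: v -> chart z *m (chart_X *m v) = c0 *: (chart_X *m v).
  by move=> Ev; rewrite -chart_HX comm Ev scalemxAr.
have sY (v : 'cV[R]_6) : chart z *m v = c0 *: v -> chart z *m (chart_Y *m v) = c0 *: (chart_Y *m v).
  by move=> Ev; rewrite -chart_HY comm Ev scalemxAr.
(* [X^3] maps [1] to [rho] plus the last basis vector, hence the correction [a0 - a5 * rho]. *)
have -> : col6 a0 a1 a2 a3 a4 a5 = (a0 - a5 * rho) *: e0 + a1 *: (chart_X *m e0)
    + a2 *: (chart_Y *m e0) + a3 *: (chart_X *m (chart_X *m e0))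
    + a4 *: (chart_Y *m (chart_Y *m e0))
    + a5 *: (chart_X *m (chart_X *m (chart_X *m e0))).
  by rewrite /e0 !(chart_X_col, chart_Y_col, col6Z, col6D); congr col6; ring.
rewrite !mulmxDr -!scalemxAr (sX _ (sX _ (sX _ E))) (sX _ (sX _ E)) (sX _ E).
rewrite (sY _ (sY _ E)) (sY _ E) E -/e0 !scalerDr !scalerA.
by rewrite !(mulrC c0).
Qed.

End Chart.

(** * Normal forms *)

Section Enumeration.
Context {C : numClosedFieldType} {zeta : C}.
Hypothesis zetaP : 3.-primitive_root zeta.

Local Notation W := (W zeta).

Definition rot (i : nat) : 'M[C]_2 :=
  \matrix_(k, l) (if k == l then if k == 0 then zeta ^+ i else zeta ^- i else 0).

Lemma zetaVX i : zeta ^- i = zeta ^+ (2 * i).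
Proof. by rewrite -exprVn (zetaV zetaP) exprM. Qed.

Lemma zeta3X i : zeta ^+ (3 * i) = 1.
Proof. by rewrite exprM (zeta3 zetaP) expr1n. Qed.

Lemma zetaX3 i : (zeta ^+ i) ^+ 3 = 1.
Proof. by rewrite -exprM mulnC zeta3X. Qed.

Lemma zetaXX i : zeta ^+ (2 * (2 * i)) = zeta ^+ i.
Proof.
have -> : (2 * (2 * i) = 3 * i + i)%N by lia.
by rewrite exprD zeta3X mul1r.
Qed.

Let mx2P (v w : 'M[C]_2) : v 0 0 = w 0 0 -> v 0 1 = w 0 1 -> v 1 0 = w 1 0 ->
  v 1 1 = w 1 1 -> v = w.
Proof.
by move=> h1 h2 h3 h4; apply/matrixP => i j;
  case: (ord2 i) => ->; case: (ord2 j) => ->.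
Qed.

Let simp := (mul0r, mulr0, addr0, add0r).

Lemma rot_rot i k : rot i *m rot k = rot (i + k).
Proof.
by apply: mx2P; rewrite mul2E !mxE /= !simp // ?zetaVX -?exprD ?mulnDr.
Qed.

Lemma rot_refl i k : rot i *m refl zeta k = refl zeta (i + k).
Proof.
by apply: mx2P; rewrite mul2E !mxE /= !simp // ?zetaVX -?exprD ?mulnDr.
Qed.

Lemma refl_rot i k : refl zeta i *m rot k = refl zeta (i + 2 * k).
Proof.
apply: mx2P; rewrite mul2E !mxE /= !simp // ?zetaVX -?exprD ?mulnDr //.
by rewrite exprD -[in LHS](zetaXX k) -exprD.
Qed.

Lemma refl_refl i k : refl zeta i *m refl zeta k = rot (i + 2 * k).
Proof.
apply: mx2P; rewrite mul2E !mxE /= !simp // ?zetaVX -?exprD ?mulnDr //.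
by rewrite exprD -[in LHS](zetaXX k) -exprD.
Qed.

Lemma rot0 : rot 0 = 1%:M.
Proof. by apply: mx2P; rewrite !mxE //= expr0 ?invr1. Qed.

Lemma rot_inv i : invmx (rot i) = rot (2 * i).
Proof.
have E : rot i *m rot (2 * i) = 1%:M.
  have -> : (rot i *m rot (2 * i) = rot (3 * i))%N by rewrite rot_rot -mulSn.
  by rewrite -rot0; apply: mx2P; rewrite !mxE //= zeta3X.
have U : rot i \in unitmx by case: (mulmx1_unit E).
by rewrite -[RHS]mul1mx -(mulVmx U) -mulmxA E mulmx1.
Qed.

Lemma inW_shape w : inW zeta w ->
  (exists i, w = rot i) \/ (exists i, w = refl zeta i).
Proof.
elim=> [|||v v' _ IH _ IH'|v _ IH].
- by right; exists 0.
- by right; exists 1.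
- by left; exists 0; rewrite rot0.
- case: IH => -[i ->]; case: IH' => -[k ->].
  + by left; exists (i + k)%N; rewrite rot_rot.
  + by right; exists (i + k)%N; rewrite rot_refl.
  + by right; exists (i + 2 * k)%N; rewrite refl_rot.
  + by left; exists (i + 2 * k)%N; rewrite refl_refl.
case: IH => -[i ->]; first by left; exists (2 * i)%N; rewrite rot_inv.
by right; exists i; rewrite (refl_inv zetaP).
Qed.

Lemma rot_mod i : rot (i %% 3) = rot i.
Proof. by apply: mx2P; rewrite !mxE //= (prim_expr_mod zetaP). Qed.

Lemma refl_mod i : refl zeta (i %% 3) = refl zeta i.
Proof. by apply: mx2P; rewrite !mxE //= (prim_expr_mod zetaP). Qed.

Lemma inW_reflN i : inW zeta (refl zeta i).
Proof. by rewrite -refl_mod; exact: (inW_refl zeta (Ordinal (ltn_pmod i _))). Qed.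

Lemma inW_rot i : inW zeta (rot i).
Proof.
have -> : rot i = refl zeta i *m refl zeta 0 by rewrite refl_refl addn0.
by apply: inW_M; exact: inW_reflN.
Qed.

(** Index 0 is the identity; the indices 3, 4, 5 serve directly as exponents of the reflections,
    since these matter only modulo 3. *)
Definition wmat (j : 'I_6) : 'M[C]_2 := if (j < 3)%N then rot j else refl zeta j.

Lemma inW_wmat j : inW zeta (wmat j).
Proof. by rewrite /wmat; case: ifP => _; [exact: inW_rot|exact: inW_reflN]. Qed.

Definition wel j : W := toW (inW_wmat j).

Lemma wel_inj : injective wel.
Proof.
move=> i j /(congr1 val) /= E.
have z0 k : zeta ^+ k != 0 by rewrite expf_neq0 // (zeta_neq0 zetaP).
have e3 (k l : nat) : zeta ^+ k = zeta ^+ l -> k = l %[mod 3].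
  by move=> /eqP; rewrite (eq_prim_root_expr zetaP) => /eqP.
move: E; rewrite /wmat; case: (ltnP i 3) => i3; case: (ltnP j 3) => j3.
- move=> /matrixP/(_ 0 0); rewrite !mxE /= => /e3; rewrite !modn_small //.
  exact: val_inj.
- move=> /matrixP/(_ 0 0); rewrite !mxE /= => /eqP; rewrite (negPf (z0 _)) //.
- move=> /matrixP/(_ 0 0); rewrite !mxE /= => /eqP; rewrite eq_sym (negPf (z0 _)) //.
- move=> /matrixP/(_ 0 1); rewrite !mxE /= => /e3 E; apply: val_inj => /=.
  by case: i i3 E => [[|[|[|[|[|[|]]]]]] //= ?]; case: j j3 => [[|[|[|[|[|[|]]]]]] //= ?].
Qed.

Lemma wel_surj (w : W) : exists j, w = wel j.
Proof.
have [[i E]|[i E]] := inW_shape (inW_val w).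
  have i6 : (i %% 3 < 6)%N by apply: leq_trans (ltn_pmod i _) _.
  exists (Ordinal i6); apply: val_inj; rewrite [LHS]E /= /wmat /=.
  by rewrite ltn_pmod // rot_mod.
have i6 : (i %% 3 + 3 < 6)%N by rewrite -[6%N]/(3 + 3)%N ltn_add2r ltn_pmod.
exists (Ordinal i6); apply: val_inj; rewrite [LHS]E /= /wmat /=.
by rewrite ltnNge leq_addl /= -[in RHS]refl_mod modnDr modn_mod refl_mod.
Qed.

End Enumeration.

(** * Spanning by ordered monomials *)

Section NormalForm.
Context {C : numClosedFieldType} {zeta : C}.
Hypothesis zetaP : 3.-primitive_root zeta.

Local Notation W := (W zeta).
Local Notation H := (H zeta).
Local Notation Hconst := (Hconst zeta).
Local Notation Hx := (Hx zeta).
Local Notation Hy := (Hy zeta).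
Local Notation HX := (HX zeta).
Local Notation HY := (HY zeta).

(** Summing over all exponents of bounded degree removes the dependence of the index set on [P],
    which additivity requires. *)
Lemma mult_mapE (P : {mpoly {poly C}[4]}) (w : W) k : (msize P <= k)%N ->
  mult_map P w = \sum_(m : 'X_{1..4 < k})
    Hconst P@_m * HX ^+ m iX * HY ^+ m iY * HW w * Hx ^+ m ix * Hy ^+ m iy.
Proof.
move=> le_k; set I : subFinType _ := 'X_{1..4 < k}.
rewrite /mult_map (big_mksub I) ?msupp_uniq //=; first last.
  by move=> x /msize_mdeg_lt /leq_trans; apply.
rewrite big_rmcond //= => j /memN_msupp_eq0 ->.
by rewrite (rmorph0 Hconst) !mul0r.
Qed.

Definition mult_mapw (w : W) P := mult_map P w.

Lemma mult_map_zmod (w : W) : zmod_morphism (mult_mapw w).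
Proof.
move=> P P'; pose k := maxn (msize (P - P')) (maxn (msize P) (msize P')).
rewrite /mult_mapw !(@mult_mapE _ w k) ?leq_max ?leqnn ?orbT // -sumrB.
by apply: eq_bigr => m _; rewrite mcoeffB (rmorphB Hconst) !mulrBl.
Qed.

HB.instance Definition _ (w : W) :=
  GRing.isZmodMorphism.Build _ _ (mult_mapw w) (mult_map_zmod w).

Lemma mult_mapD (w : W) P P' : mult_map (P + P') w = mult_map P w + mult_map P' w.
Proof. exact: (raddfD (mult_mapw w)). Qed.

Lemma mult_mapN (w : W) P : mult_map (- P) w = - mult_map P w.
Proof. exact: (raddfN (mult_mapw w)). Qed.

Lemma mult_map0 (w : W) : mult_map 0 w = 0.
Proof. exact: (raddf0 (mult_mapw w)). Qed.

Lemma mult_map_sum (w : W) I (r : seq I) (Pr : pred I) F :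
  mult_map (\sum_(i <- r | Pr i) F i) w = \sum_(i <- r | Pr i) mult_map (F i) w.
Proof. exact: (raddf_sum (mult_mapw w)). Qed.

Lemma mult_mapZX (w : W) p m : mult_map (p *: 'X_[m]) w =
  Hconst p * HX ^+ m iX * HY ^+ m iY * HW w * Hx ^+ m ix * Hy ^+ m iy.
Proof.
have [->|p0] := eqVneq p 0.
  by rewrite scale0r mult_map0 (rmorph0 Hconst) !mul0r.
by rewrite /mult_map msuppMCX // big_seq1 mcoeffZ mcoeffX eqxx mulr1.
Qed.

Definition nf (P : 'I_6 -> {mpoly {poly C}[4]}) : H :=
  \sum_j mult_map (P j) (wel zetaP j).

Lemma nf_zmod P P' : nf (fun j => P j - P' j) = nf P - nf P'.
Proof.
by rewrite /nf -sumrB; apply: eq_bigr => j _; rewrite mult_mapD mult_mapN.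
Qed.

Lemma nfD P P' : nf (fun j => P j + P' j) = nf P + nf P'.
Proof. by rewrite /nf -big_split; apply: eq_bigr => j _; rewrite mult_mapD. Qed.

Lemma nf_list (s : seq ({mpoly {poly C}[4]} * W)) :
  \sum_(u <- s) mult_map u.1 u.2 =
  nf (fun j => \sum_(u <- s | u.2 == wel zetaP j) u.1).
Proof.
rewrite /nf (eq_bigr _ (fun j _ => mult_map_sum _ _ _ _)) (exchange_big_dep xpredT) //=.
apply: eq_bigr => u _; have [j E] := wel_surj zetaP u.2.
rewrite (bigD1 j) /= ?E // big1 ?addr0 // => i /andP[/eqP/(@wel_inj _ _ zetaP) -> ].
by rewrite eqxx.
Qed.

Definition Hmono p a b (w : W) c d : H :=
  Hconst p * HX ^+ a * HY ^+ b * HW w * Hx ^+ c * Hy ^+ d.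

Definition spanned (h : H) := exists P, h = nf P.

Lemma spanned0 : spanned 0.
Proof.
by exists (fun=> 0); rewrite /nf big1 // => j _; rewrite mult_map0.
Qed.

Lemma spannedD h h' : spanned h -> spanned h' -> spanned (h + h').
Proof. by move=> [P ->] [P' ->]; exists (fun j => P j + P' j); rewrite nfD. Qed.

Lemma spanned_mono p a b w c d : spanned (Hmono p a b w c d).
Proof.
pose m := [multinom nth 0%N [:: a; b; c; d] i | i < 4].
have [j Ej] := wel_surj zetaP w.
exists (fun i => if i == j then p *: 'X_[m] else 0).
rewrite /nf (bigD1 j) //= eqxx big1 => [|i /negPf ->]; last by rewrite mult_map0.
by rewrite addr0 mult_mapZX -Ej !mnmE.
Qed.

Lemma spanned_ind (P : H -> Prop) : P 0 ->
  (forall h h', P h -> P h' -> P (h + h')) ->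
  (forall p a b w c d, P (Hmono p a b w c d)) -> forall h, spanned h -> P h.
Proof.
move=> P0 PD Pm _ [F ->]; rewrite /nf; elim/big_ind: _ => // j _.
rewrite /mult_map; elim/big_ind: _ => // m _; exact: Pm.
Qed.

Let closedL g := forall h, spanned h -> spanned (g * h).

Let closedL_mono g : (forall p a b w c d, spanned (g * Hmono p a b w c d)) ->
  closedL g.
Proof.
move=> gm h; elim/spanned_ind => [|h1 h2|]; last exact: gm.
  by rewrite mulr0; exact: spanned0.
by rewrite mulrDr; exact: spannedD.
Qed.

Let closedLD g g' : closedL g -> closedL g' -> closedL (g + g').
Proof. by move=> Lg Lg' h hs; rewrite mulrDl; apply: spannedD; auto. Qed.

Let closedLM g g' : closedL g -> closedL g' -> closedL (g * g').
Proof. by move=> Lg Lg' h hs; rewrite -mulrA; auto. Qed.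

Let closedLc p : closedL (Hconst p).
Proof.
apply: closedL_mono => p' a b w c d.
rewrite (_ : _ * _ = Hmono (p * p') a b w c d); first exact: spanned_mono.
by rewrite /Hmono (rmorphM Hconst) !mulrA.
Qed.

Lemma HVE u : HV zeta u = Hconst (u 0 0)%:P * Hx + Hconst (u 1 0)%:P * Hy.
Proof.
rewrite -[in LHS](_ : u 0 0 *: ex C + u 1 0 *: ey C = u).
  by rewrite HV_linear HVZ.
apply/matrixP => i j; rewrite !mxE (ord1 j); case: (ord2 i) => -> /=;
  by rewrite ?mulr1 ?mulr0 ?addr0 ?add0r.
Qed.

Lemma HVdE U : HVd zeta U = Hconst (U 0 0)%:P * HX + Hconst (U 0 1)%:P * HY.
Proof.
rewrite -[in LHS](_ : U 0 0 *: eX C + U 0 1 *: eY C = U).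
  by rewrite HVd_linear HVdZ.
apply/matrixP => i j; rewrite !mxE (ord1 i); case: (ord2 j) => -> /=;
  by rewrite ?mulr1 ?mulr0 ?addr0 ?add0r.
Qed.

Let constX p (h : H) n : h * (Hconst p * n) = Hconst p * (h * n).
Proof. by rewrite mulrA -Hconst_comm mulrA. Qed.

Let closedLX : closedL HX.
Proof.
apply: closedL_mono => p a b w c d.
rewrite (_ : _ * _ = Hmono p a.+1 b w c d); first exact: spanned_mono.
by rewrite /Hmono -!mulrA constX exprS !mulrA.
Qed.

Let XYX a : HY * HX ^+ a = HX ^+ a * HY.
Proof. by elim: a => [|a IH]; rewrite ?mulr1 ?mul1r // exprS mulrA HVdC -mulrA IH mulrA. Qed.

Let closedLY : closedL HY.
Proof.
apply: closedL_mono => p a b w c d.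
rewrite (_ : _ * _ = Hmono p a b.+1 w c d); first exact: spanned_mono.
by rewrite /Hmono -!mulrA constX [HY * (_ * _)]mulrA XYX exprS !mulrA.
Qed.

Let closedLVd U : closedL (HVd zeta U).
Proof. by rewrite HVdE; apply: closedLD; apply: closedLM. Qed.

Let W_mul (w w' : W) : exists w'' : W, HW w * HW w' = HW w''.
Proof. by exists (toW (inW_M (inW_val w) (inW_val w'))); apply: HWM. Qed.

Let HmonoE p a b w c d :
  Hmono p a b w c d = Hconst p * (HX ^+ a * (HY ^+ b * Hmono 1 0 0 w c d)).
Proof. by rewrite /Hmono (rmorph1 Hconst) !mul1r !mulrA. Qed.

Let powL g h n : (forall h', spanned (g * h') -> spanned (g * (h * h'))) ->
  forall h', spanned (g * h') -> spanned (g * (h ^+ n * h')).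
Proof.
by move=> gh h' gh'; elim: n => [|n IH]; rewrite ?mul1r // exprS -mulrA; exact: gh.
Qed.

Let closedLW (w : W) : closedL (HW w).
Proof.
apply: closedL_mono => p a b w' c d; rewrite HmonoE constX; apply: closedLc.
have hU U h' : spanned (HW w * h') -> spanned (HW w * (HVd zeta U * h')).
  by move=> wh; rewrite mulrA HWVd -mulrA; exact: closedLVd.
apply: powL => [h'|]; first exact: hU.
apply: powL => [h'|]; first exact: hU.
have [w'' E] := W_mul w w'.
rewrite /Hmono (rmorph1 Hconst) !expr0 !mul1r !mulrA E.
rewrite (_ : _ * _ = Hmono 1 0 0 w'' c d); first exact: spanned_mono.
by rewrite /Hmono (rmorph1 Hconst) !mul1r.
Qed.

Let closedLs g I (r : seq I) F : (forall i, closedL (F i)) ->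
  closedL g -> closedL (g * \sum_(i <- r) F i).
Proof.
move=> LF Lg; apply: closedLM => //.
elim/big_ind: _ => [h hs|g1 g2|i _]; [|exact: closedLD|exact: LF].
by rewrite mul0r; exact: spanned0.
Qed.

Let xyX a : Hy * Hx ^+ a = Hx ^+ a * Hy.
Proof. by elim: a => [|a IH]; rewrite ?mulr1 ?mul1r // exprS mulrA HVC -mulrA IH mulrA. Qed.

(** Moving [v] past [X] or [Y] leaves a commutator in [C[A] W], which acts on the remaining factor.
    The induction therefore carries along that this factor is itself in the span. *)
Let closedLV u : closedL (HV zeta u).
Proof.
apply: closedL_mono => p a b w c d; rewrite HmonoE constX; apply: closedLc.
have hU U h' : spanned h' /\ spanned (HV zeta u * h') ->
    spanned (HVd zeta U * h') /\ spanned (HV zeta u * (HVd zeta U * h')).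
  move=> [sh suh]; split; first exact: closedLVd.
  have E : HV zeta u * HVd zeta U = HVd zeta U * HV zeta u +
      (HV zeta u * HVd zeta U - HVd zeta U * HV zeta u) by rewrite addrC subrK.
  rewrite mulrA E mulrDl -mulrA; apply: spannedD; first exact: closedLVd.
  rewrite HVVd; apply: closedLs => // [i|].
    by apply: closedLM => //; exact: closedLM.
  have -> : - 2%:R = Hconst (- 2%:R) by rewrite (rmorphN Hconst) (rmorph_nat Hconst).
  exact: closedLc.
suff: spanned (HX ^+ a * (HY ^+ b * Hmono 1 0 0 w c d)) /\
  spanned (HV zeta u * (HX ^+ a * (HY ^+ b * Hmono 1 0 0 w c d))) by case.
elim: a => [|a IH]; last by rewrite exprS -mulrA; exact: hU.
rewrite !mul1r; elim: b => [|b IH]; last by rewrite exprS -mulrA; exact: hU.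
rewrite !mul1r; split; first exact: spanned_mono.
have [w' w'E] : exists w' : W, val w' = invmx (val w).
  by exists (toW (inW_V (inW_val w))).
have E : HV zeta u * HW w = HW w * HV zeta (val w' *m u).
  by rewrite HWV w'E mulmxA mulmxV ?mul1mx // (inW_unit zetaP (inW_val w)).
rewrite /Hmono (rmorph1 Hconst) !expr0 !mul1r !mulrA E -!mulrA.
apply: closedLW; rewrite HVE mulrDl -!mulrA; apply: spannedD; apply: closedLc.
  rewrite (_ : _ * _ = Hmono 1 0 0 (toW (inW_1 zeta)) c.+1 d);
    first exact: spanned_mono.
  by rewrite /Hmono (rmorph1 Hconst) (@HW1 _ _ (toW _)) // !mul1r exprS !mulrA.
rewrite (_ : _ * _ = Hmono 1 0 0 (toW (inW_1 zeta)) c d.+1);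
  first exact: spanned_mono.
rewrite /Hmono (rmorph1 Hconst) (@HW1 _ _ (toW _)) // !mul1r mulrA xyX exprS.
by rewrite !mulrA.
Qed.

(** The spanning half of the PBW theorem: the span of the ordered monomials contains 1 and is stable
    under left multiplication by the generators. *)
Lemma H_spanned h : spanned h.
Proof.
suff : closedL h.
  move=> /(_ (Hmono 1 0 0 (toW (inW_1 zeta)) 0 0) (spanned_mono _ _ _ _ _ _)).
  by rewrite /Hmono (rmorph1 Hconst) (@HW1 _ _ (toW _)) // !mulr1.
elim/H_ind: h => [a|g|u v|u v]; [exact: closedLc| |exact: closedLD|exact: closedLM].
case: g => [[k|k]|w]; rewrite ?HV_gen ?HVd_gen;
  [exact: closedLV|exact: closedLVd|exact: closedLW].
Qed.

End NormalForm.

(** * Leading coefficients and faithfulness *)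

Section ZeroTest.

(** In characteristic zero the naturals below [size p] are already too many roots. *)
Lemma poly_eq0_horner (F : numDomainType) (p : {poly F}) :
  (forall x, p.[x] = 0) -> p = 0.
Proof.
move=> p0; apply/eqP/contraT => pN0.
have := @max_poly_roots F p [seq i%:R | i <- iota 0 (size p)] pN0.
rewrite size_map size_iota ltnn; apply; first by apply/allP => x _; apply/eqP.
by rewrite map_inj_uniq ?iota_uniq // => i j /eqP; rewrite eqr_nat => /eqP.
Qed.

Lemma meval_muni (F : comNzRingType) n (P : {mpoly F[n.+1]}) (v : 'I_n.+1 -> F) :
  P.@[v] = (map_poly (meval (fun i => v (widen_ord (leqnSn n) i))) (muni P)).[v ord_max].
Proof.
rewrite muniE rmorph_sum horner_sum mevalE; apply: eq_bigr => m _.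
rewrite /= map_polyZ map_polyXn hornerZ hornerXn /= mevalZ mevalX -mulrA big_ord_recr /=.
by congr (_ * (_ * _)); apply: eq_bigr => i _; rewrite mnmE.
Qed.

Lemma sum_msupp_delta (R : nzRingType) n (P : {mpoly R[n]}) (F : 'X_{1..n} -> R) m :
  (P@_m = 0 -> F m = 0) -> \sum_(k <- msupp P) F k * (k == m)%:R = F m.
Proof.
move=> F0; have [mP|/memN_msupp_eq0/F0 Fm0] := boolP (m \in msupp P).
  rewrite (bigD1_seq m) ?msupp_uniq //= eqxx mulr1 big1 ?addr0 // => k /negPf ->.
  by rewrite mulr0.
by rewrite big1 // => k _; case: eqP => [->|]; rewrite ?Fm0 ?mul0r ?mulr0.
Qed.

Lemma muni_eq0 (F : nzRingType) n (P : {mpoly F[n.+1]}) : muni P = 0 -> P = 0.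
Proof.
move=> P0; apply/mpolyP => m; rewrite mcoeff0.
have := congr1 (fun p : {poly {mpoly F[n]}} => p`_(m ord_max)
  @_[multinom (m (widen_ord (leqnSn n) i)) | i < n]) P0.
rewrite muniE coef0 mcoeff0 coef_sum raddf_sum /=.
have E m' : ((P@_m' *: 'X_[[multinom m' (widen_ord (leqnSn n) i) | i < n]]
      *: 'X^(m' ord_max) : {poly {mpoly F[n]}})`_(m ord_max))
    @_[multinom (m (widen_ord (leqnSn n) i)) | i < n] = P@_m' * (m' == m)%:R.
  rewrite coefZ coefXn; have [Em|/eqP Nm] := eqVneq m' m.
    by rewrite Em eqxx mulr1 mcoeffZ mcoeffX eqxx.
  have [Em|/negPf Nm'] := eqVneq (m ord_max) (m' ord_max); last by rewrite mulr0 mcoeff0 mulr0.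
  rewrite mulr1 mcoeffZ mcoeffX; case: eqP => // /mnmP Eh; case: Nm.
  apply/mnmP => i; have [j ->|->] := unliftP ord_max i; last by [].
  by have := Eh j; rewrite !mnmE; congr (m' _ = m _); apply: val_inj; rewrite /= /bump leqNgt ltn_ord.
under eq_bigr do rewrite E.
by rewrite (sum_msupp_delta (F := fun k => P@_k)).
Qed.

Lemma meval_eq0 (F : numDomainType) n (P : {mpoly F[n]}) :
  (forall v, P.@[v] = 0) -> P = 0.
Proof.
elim: n P => [|n IH] P P0.
  have mE (m m' : 'X_{1..0}) : m = m' by apply/mnmP => -[].
  apply/mpolyP => m; rewrite mcoeff0 -(P0 (fun=> 0)).
  have {2}-> : P = (P@_m)%:MP.
    by apply/mpolyP => m'; rewrite mcoeffC (mE 0%MM m') eqxx mulr1 (mE m' m).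
  by rewrite mevalC.
apply: muni_eq0; apply/polyP => k; rewrite coef0; apply: IH => v.
have : map_poly (meval v) (muni P) = 0.
  apply: poly_eq0_horner => x.
  pose v' (i : 'I_n.+1) := if unlift ord_max i is Some j then v j else x.
  have := P0 v'; rewrite meval_muni {2}/v' unlift_none => <-.
  congr (_.[x]); apply: eq_map_poly => Q; apply: meval_eq => i.
  rewrite /v' (_ : widen_ord _ _ = lift ord_max i) ?liftK //.
  by apply: val_inj; rewrite /= /bump leqNgt ltn_ord.
by move=> /polyP/(_ k); rewrite coef_map coef0.
Qed.

Variable F : numFieldType.

Definition pev n (A : F) (v : 'I_n -> F) : {rmorphism {mpoly {poly F}[n]} -> F} :=
  mmap (horner_eval A) v.

Lemma pevE n A v (P : {mpoly {poly F}[n]}) :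
  pev A v P = \sum_(m <- msupp P) (P@_m).[A] * \prod_i v i ^+ m i.
Proof. by []. Qed.

Lemma pevC n A v p : @pev n A v p%:MP = p.[A].
Proof. exact: mmapC. Qed.

Lemma pevX n A v i : @pev n A v 'X_i = v i.
Proof. by rewrite /pev /= mmapX mmap1U. Qed.

Lemma pev_eq0 n (P : {mpoly {poly F}[n]}) :
  (forall A v, pev A v P = 0) -> P = 0.
Proof.
move=> P0; apply/mpolyP => m; rewrite mcoeff0; apply: poly_eq0_horner => A.
have : map_mpoly (horner_eval A) P = 0.
  apply: meval_eq0 => v; rewrite -(P0 A v).
  pose k := maxn (msize P) (msize (map_mpoly (horner_eval A) P)).
  rewrite /pev /meval (@mmapE _ _ _ _ _ _ k) ?leq_max ?leqnn ?orbT //.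
  rewrite [RHS](@mmapE _ _ _ _ _ _ k) ?leq_max ?leqnn ?orbT //.
  by apply: eq_bigr => i _; rewrite mcoeff_map_mpoly.
by move=> /mpolyP/(_ m); rewrite mcoeff_map_mpoly mcoeff0.
Qed.

End ZeroTest.

Section TopCoefficient.
Variable F : idomainType.

(** [T] is allowed to vanish: the relation records the coefficient of degree [n] of a matrix of
    degree at most [n], so it is stable under sums and products without tracking exact degrees. *)
Definition topm n r s (M : 'M[{poly F}]_(r, s)) (T : 'M[F]_(r, s)) : Prop :=
  forall i j, (size (M i j) <= n.+1)%N /\ (M i j)`_n = T i j.

Lemma topm_const r s (T : 'M[F]_(r, s)) : topm 0 (map_mx polyC T) T.
Proof. by move=> i j; rewrite mxE size_polyC coefC eqxx; case: (_ != 0). Qed.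

Lemma topmD n r s (M N : 'M[{poly F}]_(r, s)) T U :
  topm n M T -> topm n N U -> topm n (M + N) (T + U).
Proof.
move=> MT NU i j; have [s1 c1] := MT i j; have [s2 c2] := NU i j.
by rewrite !mxE coefD c1 c2 (leq_trans (size_polyD _ _)) // geq_max s1.
Qed.

Lemma topm0 n r s : topm n (0 : 'M[{poly F}]_(r, s)) 0.
Proof. by move=> i j; rewrite !mxE size_poly0 coef0. Qed.

Lemma topm_sum n r s I (l : seq I) (Pr : pred I) (M : I -> 'M[{poly F}]_(r, s)) T :
  (forall i, Pr i -> topm n (M i) (T i)) ->
  topm n (\sum_(i <- l | Pr i) M i) (\sum_(i <- l | Pr i) T i).
Proof.
move=> MT; apply: (big_rec2 (fun x y => topm n x y)) => [|i x y Pi]; first exact: topm0.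
by apply: topmD; exact: MT.
Qed.

Lemma topm_lower n m r s (M : 'M[{poly F}]_(r, s)) T : (n < m)%N ->
  topm n M T -> topm m M 0.
Proof.
move=> nm MT i j; have [s1 _] := MT i j; rewrite mxE.
by split; [exact: leq_trans s1 (leqW nm)|rewrite nth_default // (leq_trans s1)].
Qed.

Let top_mul n m (p p' : {poly F}) : (size p <= n.+1)%N -> (size p' <= m.+1)%N ->
  ((size (p * p')%R) <= (n + m).+1)%N /\ (p * p')`_(n + m)%N = p`_n * p'`_m.
Proof.
move=> sp sp'; split.
  apply: leq_trans (size_polyMleq _ _) _.
  by move: sp sp'; lia.
have nl : (n < (n + m).+1)%N by rewrite ltnS leq_addr.
rewrite coefM (bigD1 (Ordinal nl)) //= addKn big1 ?addr0 // => i iN.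
case: (ltnP n i) => [ni|]; first by rewrite (nth_default _ (leq_trans sp ni)) mul0r.
rewrite leq_eqVlt => /predU1P[E|ni]; first by rewrite -val_eqE /= E eqxx in iN.
by rewrite [p'`__]nth_default ?mulr0 // (leq_trans sp') // ltn_subRL ltn_add2r.
Qed.

Lemma topmM n m r s t (M : 'M[{poly F}]_(r, s)) (N : 'M[{poly F}]_(s, t)) T U :
  topm n M T -> topm m N U -> topm (n + m) (M *m N) (T *m U).
Proof.
move=> MT NU i j; rewrite !mxE coef_sum; split.
  apply: leq_trans (size_sum _ _ _) _; apply/bigmax_leqP => k _.
  exact: (top_mul (MT i k).1 (NU k j).1).1.
apply: eq_bigr => k _; rewrite (top_mul (MT i k).1 (NU k j).1).2.
by rewrite (MT i k).2 (NU k j).2.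
Qed.

Lemma topmX n r (M : 'M[{poly F}]_r.+1) T k : topm n M T ->
  topm (n * k) (M ^+ k) (T ^+ k).
Proof.
move=> MT; elim: k => [|k IH].
  rewrite muln0 !expr0; have := topm_const (1 : 'M[F]_r.+1).
  by rewrite -[1]/(1%:M) map_scalar_mx.
by rewrite mulnS !exprS; exact: topmM.
Qed.

Lemma topmZX n r s (c : F) (M : 'M[{poly F}]_(r, s)) T : topm n M T ->
  topm n.+1 ((c *: 'X) *: M) (c *: T).
Proof.
move=> MT i j; have [s1 c1] := MT i j.
rewrite !mxE -scalerAl coefZ coefXM /= c1; split=> //.
apply: leq_trans (size_scale_leq _ _) _; apply: leq_trans (size_polyMleq _ _) _.
by rewrite size_polyX.
Qed.

Lemma topmZ n r s c (M : 'M[{poly F}]_(r, s)) T : topm n M T ->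
  topm n (c%:P *: M) (c *: T).
Proof.
move=> MT i j; have [s1 c1] := MT i j.
rewrite !mxE coefCM c1; split=> //; rewrite mul_polyC.
exact: leq_trans (size_scale_leq _ _) _.
Qed.

End TopCoefficient.

(** * Symbols at the points of an orbit *)

Section Symbol.
Context {C : numClosedFieldType} {zeta : C}.
Hypothesis zetaP : 3.-primitive_root zeta.

Local Notation W := (W zeta).
Local Notation H := (H zeta).
Local Notation wel := (wel zetaP).
Local Notation nf := (nf zetaP).

Section Point.
Variables (A X Y a b : C).

Let Q := X * Y.
Let rho := (X ^+ 3 + Y ^+ 3) / 2.

(** The polynomial variable scales [a] and [b], so that [x] and [y] have degree 1 while [X], [Y] and
    [W] have degree 0; the divided differences drop out of the leading coefficients. *)
Definition chart_at : {rmorphism H -> 'M[{poly C}]_6} :=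
  chart zetaP (@polyC C) false A%:P Q%:P rho%:P (a *: 'X) (b *: 'X).

Let mX := chart_X Q rho.
Let mY := chart_Y Q rho.
Let mx : 'M[C]_6 := a *: mY + b *: (mX *m mX).
Let my : 'M[C]_6 := a *: mX + b *: (mY *m mY).

Let mXE : chart_X Q%:P rho%:P = map_mx polyC mX.
Proof.
apply/matrixP => -[[|[|[|[|[|[|]]]]]] i] // [[|[|[|[|[|[|]]]]]] j] //;
  by rewrite !mxE /= ?polyC0 ?polyC1 ?polyCN.
Qed.

Let mYE : chart_Y Q%:P rho%:P = map_mx polyC mY.
Proof.
apply/matrixP => -[[|[|[|[|[|[|]]]]]] i] // [[|[|[|[|[|[|]]]]]] j] //;
  by rewrite !mxE /= ?polyC0 ?polyC1 ?polyCN ?polyC1.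
Qed.

Let mWE w : chart_W (@polyC C) false w = map_mx polyC (chart_W (@idfun C) false w).
Proof.
rewrite /chart_W !scale1r.
apply/matrixP => -[[|[|[|[|[|[|]]]]]] i] // [[|[|[|[|[|[|]]]]]] j] //;
  by rewrite !mxE /= ?polyC0 ?polyC1.
Qed.

Let dxE : chart_dx {poly C} = map_mx polyC (chart_dx C).
Proof.
apply/matrixP => -[[|[|[|[|[|[|]]]]]] i] // [[|[|[|[|[|[|]]]]]] j] //;
  by rewrite !mxE /= ?polyC0 // polyCN polyC_natr.
Qed.

Let dyE : chart_dy {poly C} = map_mx polyC (chart_dy C).
Proof.
apply/matrixP => -[[|[|[|[|[|[|]]]]]] i] // [[|[|[|[|[|[|]]]]]] j] //;
  by rewrite !mxE /= ?polyC0 // ?polyCN polyC_natr.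
Qed.

Lemma topm_x : topm 1 (chart_at (Hx zeta)) mx.
Proof.
rewrite [chart_at _]chart_Hx /chart_x mXE mYE dxE /mx -[X in topm _ _ X]addr0.
apply: topmD; last by apply: topm_lower (topmZ _ (topm_const _)).
apply: topmD; apply: topmZX; first exact: topm_const.
exact: (topmM (topm_const _) (topm_const _)).
Qed.

Lemma topm_y : topm 1 (chart_at (Hy zeta)) my.
Proof.
rewrite [chart_at _]chart_Hy /chart_y mXE mYE dyE /my -[X in topm _ _ X]addr0.
apply: topmD; last by apply: topm_lower (topmZ _ (topm_const _)).
apply: topmD; apply: topmZX; first exact: topm_const.
exact: (topmM (topm_const _) (topm_const _)).
Qed.

Lemma topm_X : topm 0 (chart_at (HX zeta)) mX.
Proof. by rewrite [chart_at _]chart_HX mXE; exact: topm_const. Qed.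

Lemma topm_Y : topm 0 (chart_at (HY zeta)) mY.
Proof. by rewrite [chart_at _]chart_HY mYE; exact: topm_const. Qed.

Lemma topm_W (w : W) : topm 0 (chart_at (HW w)) (chart_W (@idfun C) false (val w)).
Proof. by rewrite [chart_at _]chart_HW mWE; exact: topm_const. Qed.

Lemma chart_at_const p : chart_at (Hconst zeta p) = p.[A]%:P%:M.
Proof. by rewrite [LHS]chart_const horner_map. Qed.

Definition mono_top (w : W) (m : 'X_{1..4}) : 'M[C]_6 :=
  mX ^+ m iX * mY ^+ m iY * chart_W (@idfun C) false (val w) * mx ^+ m ix * my ^+ m iy.

Lemma topm_mono p (w : W) (m : 'X_{1..4}) :
  topm (m ix + m iy) (chart_at (Hconst zeta p * HX zeta ^+ m iX * HY zeta ^+ m iY *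
    HW w * Hx zeta ^+ m ix * Hy zeta ^+ m iy)) (p.[A] *: mono_top w m).
Proof.
rewrite /mono_top -!mulrA !rmorphM !rmorphXn chart_at_const /=.
rewrite -[_%:M * _]/(_ *m _) mul_scalar_mx; apply: topmZ.
have tx := topmX (m ix) topm_x; have ty := topmX (m iy) topm_y.
have tX := topmX (m iX) topm_X; have tY := topmX (m iY) topm_Y.
rewrite -[(m ix + m iy)%N]add0n -[X in topm (X + _) _ _](mul0n (m iX)).
apply: topmM tX _; rewrite -[(m ix + m iy)%N]add0n -[X in topm (X + _) _ _](mul0n (m iY)).
apply: topmM tY _; rewrite -[(m ix + m iy)%N]add0n; apply: topmM (topm_W w) _.
by have := topmM tx ty; rewrite !mul1n.
Qed.

Definition degxy (m : 'X_{1..4}) := (m ix + m iy)%N.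
Definition degxy_le n (P : {mpoly {poly C}[4]}) :=
  all (fun m => (degxy m <= n)%N) (msupp P).

Lemma topm_mult_map n P (w : W) : degxy_le n P ->
  topm n (chart_at (mult_map P w))
    (\sum_(m <- msupp P | degxy m == n) (P@_m).[A] *: mono_top w m).
Proof.
move=> /allP Pn; rewrite /mult_map rmorph_sum [X in topm _ _ X]big_mkcond.
rewrite !big_seq; apply: topm_sum => m mP; case: eqP => [<-|mn].
  exact: topm_mono.
apply: topm_lower (topm_mono _ _ _); rewrite ltn_neqAle Pn // andbT.
exact/eqP.
Qed.

(** [(orbX j, orbY j)] is the image of [(X, Y)] under the inverse of [wmat j], because a group
    element acts on functions through its inverse. *)
Definition orbX (j : 'I_6) : C := if (j < 3)%N then zeta ^- j * X else zeta ^+ j * Y.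
Definition orbY (j : 'I_6) : C := if (j < 3)%N then zeta ^+ j * Y else zeta ^- j * X.
Definition orbx (j : 'I_6) : C := a * orbY j + b * orbX j ^+ 2.
Definition orby (j : 'I_6) : C := a * orbX j + b * orbY j ^+ 2.

(* Evaluation at a point of the orbit of (X, Y) of a function written in the
   basis 1, X, Y, X^2, Y^2, (X^3 - Y^3) / 2 of the coinvariant algebra. *)
Definition ev_row (j : 'I_6) : 'rV[C]_6 :=
  \row_i [:: 1; orbX j; orbY j; orbX j ^+ 2; orbY j ^+ 2;
             (orbX j ^+ 3 - orbY j ^+ 3) / 2]`_i.

Lemma orbQ j : orbX j * orbY j = Q.
Proof.
have z0 : zeta ^+ j != 0 by rewrite expf_neq0 // (zeta_neq0 zetaP).
by rewrite /orbX /orbY /Q; case: ifP => _; field.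
Qed.

Lemma orbrho j : orbX j ^+ 3 + orbY j ^+ 3 = 2 * rho.
Proof.
rewrite /rho mulrCA mulfV ?pnatr_eq0 // mulr1 /orbX /orbY; case: ifP => _.
  by rewrite !exprMn !exprVn !(zetaX3 zetaP) invr1 !mul1r.
by rewrite !exprMn !exprVn !(zetaX3 zetaP) invr1 !mul1r addrC.
Qed.

Let ev_row_mul j (M : 'M[C]_6) c :
  (forall k : 'I_6, \sum_i ev_row j 0 i * M i k = c * ev_row j 0 k) ->
  ev_row j *m M = c *: ev_row j.
Proof. by move=> E; apply/rowP => k; rewrite mxE [RHS]mxE E. Qed.

Let ev_X j : ev_row j *m mX = orbX j *: ev_row j.
Proof.
have hQ := orbQ j; have hr := orbrho j.
have {}hr : rho = (orbX j ^+ 3 + orbY j ^+ 3) / 2.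
  by rewrite hr mulrAC mulfV ?mul1r ?pnatr_eq0.
apply: ev_row_mul => -[[|[|[|[|[|[|]]]]]] k] //;
  rewrite !big_ord_recl big_ord0 !mxE /= -?hQ ?hr; by field; rewrite ?pnatr_eq0.
Qed.

Let ev_Y j : ev_row j *m mY = orbY j *: ev_row j.
Proof.
have hQ := orbQ j; have hr := orbrho j.
have {}hr : rho = (orbX j ^+ 3 + orbY j ^+ 3) / 2.
  by rewrite hr mulrAC mulfV ?mul1r ?pnatr_eq0.
apply: ev_row_mul => -[[|[|[|[|[|[|]]]]]] k] //;
  rewrite !big_ord_recl big_ord0 !mxE /= -?hQ ?hr; by field; rewrite ?pnatr_eq0.
Qed.

Let ev_x j : ev_row j *m mx = orbx j *: ev_row j.
Proof.
rewrite mulmxDr -!scalemxAr mulmxA !ev_X -scalemxAl ev_X ev_Y !scalerA -scalerDl.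
by rewrite /orbx expr2 mulrA.
Qed.

Let ev_y j : ev_row j *m my = orby j *: ev_row j.
Proof.
rewrite mulmxDr -!scalemxAr mulmxA !ev_Y -scalemxAl ev_Y ev_X !scalerA -scalerDl.
by rewrite /orby expr2 mulrA.
Qed.

Let ev_pow j M c n : ev_row j *m M = c *: ev_row j ->
  ev_row j *m (M ^+ n) = c ^+ n *: ev_row j.
Proof.
move=> E; elim: n => [|n IH]; first by rewrite !expr0 mulmx1 scale1r.
by rewrite !exprS mulmxA E -scalemxAl IH scalerA.
Qed.

Let ev_W j : ev_row 0 *m chart_W (@idfun C) false (@wmat C zeta j) = ev_row j.
Proof.
have zj : zeta ^- j = (zeta ^+ j) ^+ 2 by rewrite (zetaVX zetaP) mulnC exprM.
have z3 : (zeta ^+ j) ^+ 3 = 1 := zetaX3 zetaP _.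
have d1 : \det (@rot C zeta j) = 1.
  have := det_refl zetaP j; rewrite -[in X in X -> _](addn0 j).
  rewrite -(rot_refl zetaP) det_mulmx (det_refl zetaP) mulrN1.
  exact: oppr_inj.
apply/rowP; rewrite /wmat /ev_row /orbX /orbY; case: ifP => _;
  rewrite /chart_W scale1r ?d1 ?(det_refl zetaP) !expr0 !invr1 !mul1r /=;
  move=> -[[|[|[|[|[|[|]]]]]] k] //;
  rewrite !mxE !big_ord_recl big_ord0 !mxE /= ?zj;
  move: (zeta ^+ j) z3 => z z3; ring: z3.
Qed.

(** In an ordered monomial [X], [Y] stand to the left of [w] and are evaluated at the base point;
    [x], [y] stand to its right and are evaluated at the point to which [w] moves it. *)
Definition pt (j : 'I_6) (i : 'I_4) : C := [:: X; Y; orbx j; orby j]`_i.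

Let ev_mono j m : ev_row 0 *m mono_top (wel j) m =
  (\prod_i pt j i ^+ m i) *: ev_row j.
Proof.
have X0 : orbX 0 = X by rewrite /orbX /= expr0 invr1 mul1r.
have Y0 : orbY 0 = Y by rewrite /orbY /= expr0 mul1r.
rewrite /mono_top !mulmxA (ev_pow _ (ev_X 0)) -!scalemxAl (ev_pow _ (ev_Y 0)).
rewrite -!scalemxAl ev_W (ev_pow _ (ev_x j)) -!scalemxAl (ev_pow _ (ev_y j)).
rewrite !scalerA !big_ord_recl big_ord0 mulr1 X0 Y0 /pt /= !mulrA.
by congr (_ ^+ m _ * _ ^+ m _ * _ ^+ m _ * _ ^+ m _ *: _); apply: val_inj.
Qed.

Definition top n (P : {mpoly {poly C}[4]}) : {mpoly {poly C}[4]} :=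
  \sum_(m <- msupp P | degxy m == n) P@_m *: 'X_[m].

(** A Lagrange interpolation vector: the function [\prod_(i != j) (X - orbX i)], which vanishes at
    all points of the orbit except the [j]-th. *)
Let separator j : 'cV[C]_6 := (\prod_(i | i != j) (mX - (orbX i)%:M)) *m delta_mx 0 0.

Let ev_separator k j :
  (ev_row k *m separator j) 0 0 = \prod_(i | i != j) (orbX k - orbX i).
Proof.
have -> : ev_row k *m separator j =
    (\prod_(i | i != j) (orbX k - orbX i)) *: (ev_row k *m delta_mx 0 0).
  rewrite /separator mulmxA scalemxAl; congr (_ *m _).
  apply: (big_rec2 (fun x y => ev_row k *m x = y *: ev_row k)) => [|i x y _ IH].
    by rewrite mulmx1 scale1r.
  by rewrite mulmxA mulmxBr ev_X mul_mx_scalar -scalerBl -scalemxAl IH scalerA.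
by rewrite mxE -colE !mxE mulr1.
Qed.

Hypothesis generic : X * Y * (X ^+ 3 - Y ^+ 3) != 0.

(** [X] and [Y] nonzero separate the points within each half of the orbit, and [X^3 != Y^3]
    separates the two halves. *)
Let orbX_inj : injective orbX.
Proof.
move=> i j.
have [XY0 X3] : X * Y != 0 /\ X ^+ 3 - Y ^+ 3 != 0.
  by apply/andP; move: generic; rewrite mulf_eq0 negb_or.
have [X0 Y0] : X != 0 /\ Y != 0.
  by apply/andP; move: XY0; rewrite mulf_eq0 negb_or.
have e3 (k l : nat) : zeta ^+ k = zeta ^+ l -> k = l %[mod 3].
  by move=> /eqP; rewrite (eq_prim_root_expr zetaP) => /eqP.
have XY k l : zeta ^- k * X = zeta ^+ l * Y -> False.
  move=> /(congr1 (fun u => u ^+ 3)); rewrite !exprMn exprVn !(zetaX3 zetaP) invr1 !mul1r.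
  by move=> E; rewrite E subrr eqxx in X3.
rewrite /orbX; case: (ltnP i 3) => i3; case: (ltnP j 3) => j3.
- move=> /(mulIf X0)/invr_inj/e3; rewrite !modn_small //; exact: val_inj.
- by move=> /XY.
- by move=> /esym/XY.
- move=> /(mulIf Y0)/e3 E; apply: val_inj => /=.
  by case: i i3 E => [[|[|[|[|[|[|]]]]]] //= ?]; case: j j3 => [[|[|[|[|[|[|]]]]]] //= ?].
Qed.

Let ev_separatorNE k j : k != j -> (ev_row k *m separator j) 0 0 = 0.
Proof. by move=> kj; rewrite ev_separator (bigD1 k) //= subrr mul0r. Qed.

Let ev_separatorE j : (ev_row j *m separator j) 0 0 != 0.
Proof.
rewrite ev_separator prodf_seq_neq0; apply/allP => i _; apply/implyP => ij.
by rewrite subr_eq0; apply/eqP => /orbX_inj E; rewrite E eqxx in ij.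
Qed.

Definition nf_top n (P : 'I_6 -> {mpoly {poly C}[4]}) : 'M[C]_6 :=
  \sum_j \sum_(m <- msupp (P j) | degxy m == n) ((P j)@_m).[A] *: mono_top (wel j) m.

Lemma topm_nf n P : (forall j, degxy_le n (P j)) -> topm n (chart_at (nf P)) (nf_top n P).
Proof.
move=> Pn; rewrite /nf rmorph_sum /nf_top; apply: topm_sum => j _.
exact: topm_mult_map.
Qed.

Let ev_nf_top n P j :
  (ev_row 0 *m nf_top n P *m separator j) 0 0 =
  pev A (pt j) (top n (P j)) * (ev_row j *m separator j) 0 0.
Proof.
rewrite /nf_top mulmx_sumr mulmx_suml summxE (bigD1 j) //= [X in _ + X]big1; last first.
  move=> i ij; rewrite mulmx_sumr mulmx_suml summxE big1 // => m _.
  by rewrite -scalemxAr ev_mono scalerA -scalemxAl mxE ev_separatorNE // mulr0.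
rewrite addr0 mulmx_sumr mulmx_suml summxE rmorph_sum mulr_suml.
apply: eq_bigr => m _; rewrite -scalemxAr ev_mono scalerA -scalemxAl mxE.
by congr (_ * _); rewrite [RHS]mmapZ mmapX.
Qed.

Lemma nf_top_eq0 n P : nf_top n P = 0 -> forall j, pev A (pt j) (top n (P j)) = 0.
Proof.
move=> E j; have := ev_nf_top n P j; rewrite E mulmx0 mul0mx mxE => /esym/eqP.
by rewrite mulf_eq0 (negPf (ev_separatorE j)) orbF => /eqP.
Qed.

(** A scalar preserves the evaluation at the base point, which is the orbit point of [wel 0 = 1];
    the separators of the other points annihilate it. *)
Lemma nf_top_scalar n P t : nf_top n P = t%:M -> forall j,
  pev A (pt j) (top n (P j)) = if j == 0 then t else 0.
Proof.
move=> E j; have := ev_nf_top n P j; rewrite E mul_mx_scalar -scalemxAl mxE.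
case: eqP => [->|/eqP j0].
  by move=> /(mulIf (ev_separatorE 0)).
rewrite ev_separatorNE 1?eq_sym // mulr0 => /esym/eqP.
by rewrite mulf_eq0 (negPf (ev_separatorE j)) orbF => /eqP.
Qed.

End Point.
End Symbol.

(** * Lowering the degree of normal forms *)

Section Reduction.
Context {C : numClosedFieldType} {zeta : C}.
Hypothesis zetaP : 3.-primitive_root zeta.

Local Notation H := (H zeta).
Local Notation nf := (nf zetaP).
Local Notation orbX := (orbX (zeta := zeta)).
Local Notation orbY := (orbY (zeta := zeta)).
Local Notation orbx := (orbx (zeta := zeta)).
Local Notation orby := (orby (zeta := zeta)).
Local Notation pt := (pt (zeta := zeta)).

Definition generic (X Y : C) := X * Y * (X ^+ 3 - Y ^+ 3) != 0.

Definition degxy_lt n (P : {mpoly {poly C}[4]}) :=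
  all (fun m => (degxy m < n)%N) (msupp P).

(** At a fixed orbit point the momentum is linear in [(a, b)] with determinant [orbY^3 - orbX^3];
    the witnesses come from Cramer's rule. *)
Lemma pt_surj X Y (j : 'I_6) x y : generic X Y -> exists a b,
  orbx X Y a b j = x /\ orby X Y a b j = y.
Proof.
move=> g; have D : (orbX X Y j) ^+ 3 - (orbY X Y j) ^+ 3 != 0.
  have X3 : X ^+ 3 - Y ^+ 3 != 0.
    by move: g; rewrite /generic mulf_eq0 negb_or => /andP[].
  rewrite /orbX /orbY; case: ifP => _; rewrite !exprMn !exprVn !(zetaX3 zetaP) invr1 !mul1r //.
  by rewrite -opprB oppr_eq0.
rewrite /orbx /orby; move: (orbX _ _ _) (orbY _ _ _) D => u v D.
exists ((y * u ^+ 2 - x * v ^+ 2) / (u ^+ 3 - v ^+ 3)),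
  ((x * u - y * v) / (u ^+ 3 - v ^+ 3)).
by split; field.
Qed.

(** Multiplication by the equation [g] of the non-generic locus makes the polynomial vanish
    everywhere, and [g] then cancels. *)
Lemma top_vanish (P : {mpoly {poly C}[4]}) n j : (forall A X Y a b, generic X Y ->
  pev A (pt X Y a b j) (top n P) = 0) -> top n P = 0.
Proof.
move=> P0.
pose g : {mpoly {poly C}[4]} := 'X_iX * 'X_iY * ('X_iX ^+ 3 - 'X_iY ^+ 3).
have gE A v : pev A v g = v iX * v iY * (v iX ^+ 3 - v iY ^+ 3).
  by rewrite /g !(rmorphM, rmorphB, rmorphXn) /= !pevX.
have : g * top n P = 0.
  apply: pev_eq0 => A v; rewrite rmorphM gE.
  have [->|gN] := eqVneq (v iX * v iY * (v iX ^+ 3 - v iY ^+ 3)) 0.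
    by rewrite mul0r.
  have [a [b [Ex Ey]]] := pt_surj j (v ix) (v iy) gN.
  rewrite -[pev A v _](_ : pev A (pt (v iX) (v iY) a b j) (top n P) = _).
    by rewrite P0 // mulr0.
  rewrite !pevE; apply: eq_bigr => m _; congr (_ * _); apply: eq_bigr => i _.
  rewrite /pt Ex Ey; congr (_ ^+ _).
  by case: i => -[|[|[|[|]]]] //= i; congr (v _); apply: val_inj.
move=> /eqP; rewrite mulf_eq0 => /orP[/eqP g0|/eqP //].
(* At [X = 1], [Y = 2] the value of [g] is -14, so [g] is nonzero. *)
have := gE 0 (fun i => if i == iX then 1 else 2); rewrite g0 rmorph0 /=.
move=> /esym/eqP; rewrite !mulf_eq0 oner_eq0 pnatr_eq0 /= subr_eq0 expr1n.
by rewrite -natrX -[X in X == _]/(1%:R) eqr_nat.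
Qed.

Lemma degxy_le_lt P n : degxy_le n P -> top n P = 0 -> degxy_lt n P.
Proof.
move=> /allP Pn T0; apply/allP => m mP; rewrite ltn_neqAle Pn // andbT.
apply/eqP => mn; have := congr1 (mcoeff m) T0; rewrite mcoeff0 raddf_sum /=.
rewrite big_mkcond (bigD1_seq m) ?msupp_uniq //= mn eqxx big1 ?addr0 => [|i /negPf im].
  rewrite mcoeffZ mcoeffX eqxx mulr1 => /eqP.
  by rewrite mcoeff_eq0 mP.
by case: ifP => //; rewrite mcoeffZ mcoeffX im mulr0.
Qed.

Lemma degxy_bound (P : 'I_6 -> {mpoly {poly C}[4]}) :
  exists N, forall j, degxy_lt N (P j).
Proof.
clear zetaP; exists (\max_j msize (P j)) => j; apply/allP => m /msize_mdeg_lt mP.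
apply: leq_trans (leq_bigmax j); apply: leq_ltn_trans mP.
rewrite mdegE !big_ord_recl big_ord0 /degxy.
have -> : ix = lift ord0 (lift ord0 (ord0 : 'I_2)) by apply: val_inj.
have -> : iy = lift ord0 (lift ord0 (lift ord0 (ord0 : 'I_1))) by apply: val_inj.
by lia.
Qed.

Lemma nf_lt0 P : (forall j, degxy_lt 0 (P j)) -> nf P = 0.
Proof.
move=> P0; rewrite /nf big1 // => j _; rewrite /mult_map.
by have := P0 j; rewrite /degxy_lt; case: (msupp _) => [|m s] //=; rewrite big_nil.
Qed.

(** As long as the normal form has degree at least [n], its top symbols vanish at all generic
    points, hence identically, and the degree drops. The case [n = 0] is faithfulness of the
    charts. *)
Lemma nf_reduce (h : H) n : (forall A X Y a b, generic X Y ->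
    exists2 t : {poly C}, (size t <= n)%N & chart_at zetaP A X Y a b h = t%:M) ->
  exists2 P, h = nf P & forall j, degxy_lt n (P j).
Proof.
move=> ht; have [P E] := H_spanned zetaP h; exists P => //.
have [N] := degxy_bound P; elim: N => [|N IH] PN.
  by move=> j; apply: sub_all (PN j).
case: (leqP N.+1 n) => [Nn j|nN].
  by apply: sub_all (PN j) => m mN; exact: leq_trans Nn.
apply: IH => j; apply: degxy_le_lt; first exact: PN.
apply: (@top_vanish _ _ j) => A X Y a b g; apply: (nf_top_eq0 g).
apply/matrixP => i k.
have [_ <-] := topm_nf zetaP A X Y a b PN i k.
have [t tn Et] := ht A X Y a b g.
by rewrite -E Et !mxE mulrb; case: eqP; rewrite ?coef0 // nth_default // (leq_trans tn).
Qed.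

Lemma chart_at_faithful (h : H) : (forall A X Y a b, generic X Y ->
    chart_at zetaP A X Y a b h = 0) -> h = 0.
Proof.
move=> h0; have [A X Y a b g|P -> P0] := @nf_reduce h 0; last exact: nf_lt0.
by exists 0; rewrite ?size_poly0 // h0 // raddf0.
Qed.

Lemma center_chart (h : H) : (forall A X Y a b, generic X Y ->
    exists t, chart_at zetaP A X Y a b h = t%:M) -> h \in @center_pred C zeta.
Proof.
move=> ht; apply/center_predP => k; apply/eqP; rewrite -subr_eq0; apply/eqP.
apply: chart_at_faithful => A X Y a b g; have [t E] := ht A X Y a b g.
by rewrite rmorphB !rmorphM E [X in _ - X]scalar_mxC subrr.
Qed.

(** The charts of a central element are scalar, so its symbol is concentrated in the component of
    the identity and given there by the leading coefficient of the scalar. *)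
Lemma center_nf_top (h : H) P n : h \in @center_pred C zeta -> h = nf P ->
  (forall j, degxy_le n (P j)) -> forall A X Y a b, generic X Y ->
  forall j, pev A (pt X Y a b j) (top n (P j)) =
    if j == 0 then (chart_at zetaP A X Y a b h 0 0)`_n else 0.
Proof.
move=> /center_predP hc E Pn A X Y a b g; apply: (nf_top_scalar g).
have [t Et] : exists t, chart_at zetaP A X Y a b h = t%:M by exact: chart_scalar.
apply/matrixP => i k.
have [_ <-] := topm_nf zetaP A X Y a b Pn i k.
by rewrite -E Et !mxE !mulrb; case: (i == k); rewrite ?coef0.
Qed.

(** Injectivity of the truncation on the centre: the other components of a central element have
    vanishing top symbols, so if the component of the identity is 0 the degree can be lowered to
    nothing. *)
Lemma center_nf_eq0 (h : H) P : h \in @center_pred C zeta -> h = nf P -> P 0 = 0 -> h = 0.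
Proof.
move=> hc E P0; have [N] := degxy_bound P; elim: N => [|N IH] PN.
  by rewrite E nf_lt0.
apply: IH => j; apply: degxy_le_lt; first exact: PN.
have [->|j0] := eqVneq j 0; first by rewrite P0 /top msupp0 big_nil.
apply: (@top_vanish _ _ j) => A X Y a b g.
by rewrite (center_nf_top hc E PN) // (negPf j0).
Qed.

End Reduction.

(** * Central elements and their relations *)

Section CentralElements.
Context {C : numClosedFieldType} {zeta : C}.
Hypothesis zetaP : 3.-primitive_root zeta.

Local Notation H := (H zeta).
Local Notation Hconst := (Hconst zeta).
Local Notation Hx := (Hx zeta).
Local Notation Hy := (Hy zeta).
Local Notation HX := (HX zeta).
Local Notation HY := (HY zeta).

Definition reflsum (c : nat -> C) : H :=
  \sum_(i < 3) Hconst (c i)%:P * HW (reflW zeta i).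

(** [h_eu], [h_u] and [h_U] lift the invariants [X x + Y y], [Y x^2 + X y^2] and [X^2 y + Y^2 x].
    The terms with [A] and the reflections correct the ordered expressions so that they become
    central. *)
Definition h_eu : H :=
  HX * Hx + HY * Hy - Hconst 'X * \sum_(i < 3) HW (reflW zeta i).
Definition h_r : H := Hx ^+ 3 + Hy ^+ 3.
Definition h_R : H := HX ^+ 3 + HY ^+ 3.
Definition h_u : H := HY * Hx ^+ 2 + HX * Hy ^+ 2 + Hconst 'X *
  (reflsum (fun i => zeta ^- i) * Hx + reflsum (fun i => zeta ^+ i) * Hy).
Definition h_U : H := HX ^+ 2 * Hy + HY ^+ 2 * Hx + Hconst 'X *
  (HX * reflsum (fun i => zeta ^+ i) + HY * reflsum (fun i => zeta ^- i)).

Section Chart.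
Variables (R : comNzRingType) (kappa : {rmorphism C -> R}).
Variables (tw : bool) (A Q rho a b : R).

Local Notation chart := (chart zetaP kappa tw A Q rho a b).
Let At : R := if tw then - A else A.
(** In the charts [x^2] maps [1] to [e1 X + e4 Y^2], and [y^2] maps it to [e1 Y + e4 X^2]. The
    scalars of [h_u] and [h_r] are read off from the image of [1]. *)
Let e1 := 2 * a * b * Q + 2 * b ^+ 2 * rho - 3 * At * b.
Let e4 := a ^+ 2 - b ^+ 2 * Q.

Let cX := @chart_HX C zeta zetaP R kappa tw A Q rho a b.
Let cY := @chart_HY C zeta zetaP R kappa tw A Q rho a b.
Let cx := @chart_Hx C zeta zetaP R kappa tw A Q rho a b.
Let cy := @chart_Hy C zeta zetaP R kappa tw A Q rho a b.

Let sgA : (if tw then -1 else 1) * A = At.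
Proof. by rewrite /At; case: (tw); ring. Qed.

Lemma chart_q : chart (Hx * Hy) =
  (a ^+ 2 * Q + 2 * a * b * rho + b ^+ 2 * Q ^+ 2 - 3 * At * a)%:M.
Proof.
apply: mx6P => c0 c1 c2 c3 c4 c5; rewrite mul_scalar_mx rmorphM cx cy -!mulmxA.
by rewrite !(chart_x_col, chart_y_col, col6Z) -/At; congr col6; ring.
Qed.

Lemma chart_Q : chart (HX * HY) = Q%:M.
Proof.
apply: mx6P => c0 c1 c2 c3 c4 c5; rewrite mul_scalar_mx rmorphM cX cY -!mulmxA.
by rewrite !(chart_X_col, chart_Y_col, col6Z); congr col6; ring.
Qed.

Lemma chart_eu : chart h_eu = (2 * a * Q + 2 * b * rho - 3 * At)%:M.
Proof.
apply: mx6P => c0 c1 c2 c3 c4 c5; rewrite mul_scalar_mx.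
rewrite rmorphB rmorphD !rmorphM cX cY cx cy mulmxBl mulmxDl -!mulmxA.
rewrite chart_S chart_constX mul_scalar_mx scalerA (mulrC A) sgA.
rewrite !(chart_X_col, chart_Y_col, chart_x_col, chart_y_col) -/At.
by rewrite !(col6Z, col6N, col6D); congr col6; ring.
Qed.

Lemma chart_r : chart h_r =
  (2 * (a * (Q * e1 + rho * e4) + b * (Q ^+ 2 * e4 + rho * e1) - 3 * At * e1))%:M.
Proof.
apply: mx6P => c0 c1 c2 c3 c4 c5; rewrite mul_scalar_mx rmorphD !rmorphXn cx cy.
rewrite !exprS !expr0 !mulr1 mulmxDl -!mulmxA.
rewrite !(chart_x_col, chart_y_col) -/At /e1 /e4.
by rewrite !(col6Z, col6D); congr col6; ring.
Qed.

Lemma chart_R : chart h_R = (2 * rho)%:M.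
Proof.
apply: mx6P => c0 c1 c2 c3 c4 c5; rewrite mul_scalar_mx rmorphD !rmorphXn cX cY.
rewrite !exprS !expr0 !mulr1 mulmxDl -!mulmxA.
by rewrite !(chart_X_col, chart_Y_col) !(col6Z, col6D); congr col6; ring.
Qed.

Lemma chart_u : chart h_u = (2 * (Q * e1 + rho * e4))%:M.
Proof.
apply: mx6P => c0 c1 c2 c3 c4 c5; rewrite mul_scalar_mx !(rmorphD, rmorphM, rmorphXn).
rewrite cX cY cx cy ?exprS ?expr0 ?mulr1 !mulmxDl.
rewrite -!mulmxA [(_ (reflsum _) * _ + _) *m _]mulmxDl -!mulmxA.
rewrite chart_constX mul_scalar_mx !(chart_x_col, chart_y_col) chart_SzV chart_Sz.
rewrite -!scalerDr scalerA (mulrC A) sgA.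
rewrite !(chart_X_col, chart_Y_col) -/At /e1 /e4.
by rewrite !(col6Z, col6D); congr col6; ring.
Qed.

Lemma chart_U : chart h_U = (2 * a * rho + 2 * b * Q ^+ 2)%:M.
Proof.
apply: mx6P => c0 c1 c2 c3 c4 c5; rewrite mul_scalar_mx !(rmorphD, rmorphM, rmorphXn).
rewrite cX cY cx cy ?exprS ?expr0 ?mulr1 !mulmxDl.
rewrite -!mulmxA [(_ * _ (reflsum _) + _) *m _]mulmxDl -!mulmxA.
rewrite chart_constX mul_scalar_mx !(chart_x_col, chart_y_col) chart_SzV chart_Sz.
rewrite -!scalemxAr -!scalerDr scalerA (mulrC A) sgA.
rewrite !(chart_X_col, chart_Y_col) -/At.
by rewrite !(col6Z, col6D); congr col6; ring.
Qed.

(** The matrix is scalar by [chart_scalar], so one diagonal entry gives the central character. *)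
Definition chi (z : Z zeta) : R := chart (val z) 0 0.

Lemma chart_val z : chart (val z) = (chi z)%:M.
Proof.
have [t E] := chart_scalar zetaP kappa tw A Q rho a b (elimT (center_predP _) (valP z)).
by rewrite /chi E !mxE eqxx mulr1n.
Qed.

Lemma chi_zmod : zmod_morphism chi.
Proof. by move=> z z'; rewrite /chi rmorphB !mxE. Qed.

Lemma chi_monoid : monoid_morphism chi.
Proof.
split; first by rewrite /chi rmorph1 mxE eqxx.
move=> z z'; rewrite {1}/chi rmorphM !chart_val.
by rewrite -[_%:M * _]/(_ *m _) -scalar_mxM mxE eqxx mulr1n.
Qed.

HB.instance Definition _ := GRing.isZmodMorphism.Build _ _ chi chi_zmod.
HB.instance Definition _ := GRing.isMonoidMorphism.Build _ _ chi chi_monoid.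

Lemma chiE z t : chart (val z) = t%:M -> chi z = t.
Proof. by move=> E; rewrite /chi E mxE eqxx mulr1n. Qed.

Lemma chi_const p : chi (Zconst zeta p) = (map_poly kappa p).[A].
Proof. by apply: chiE; exact: chart_const. Qed.

End Chart.

Let central h : (forall (A X Y a b : C), exists t, chart_at zetaP A X Y a b h = t%:M) ->
  h \in @center_pred C zeta.
Proof. by move=> ht; apply: center_chart => A X Y a b _; exact: ht. Qed.

Lemma h_eu_center : h_eu \in @center_pred C zeta.
Proof. by apply: central => *; eexists; exact: chart_eu. Qed.
Lemma h_r_center : h_r \in @center_pred C zeta.
Proof. by apply: central => *; eexists; exact: chart_r. Qed.
Lemma h_R_center : h_R \in @center_pred C zeta.
Proof. by apply: central => *; eexists; exact: chart_R. Qed.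
Lemma h_u_center : h_u \in @center_pred C zeta.
Proof. by apply: central => *; eexists; exact: chart_u. Qed.
Lemma h_U_center : h_U \in @center_pred C zeta.
Proof. by apply: central => *; eexists; exact: chart_U. Qed.

Definition z_eu : Z zeta := exist _ h_eu h_eu_center.
Definition z_r : Z zeta := exist _ h_r h_r_center.
Definition z_R : Z zeta := exist _ h_R h_R_center.
Definition z_u : Z zeta := exist _ h_u h_u_center.
Definition z_U : Z zeta := exist _ h_U h_U_center.

Section ChiGenerators.
Variables (R : comNzRingType) (kappa : {rmorphism C -> R}).
Variables (tw : bool) (A Q rho a b : R).

Let At : R := if tw then - A else A.
Let e1 := 2 * a * b * Q + 2 * b ^+ 2 * rho - 3 * At * b.
Let e4 := a ^+ 2 - b ^+ 2 * Q.
Local Notation chi := (chi kappa tw A Q rho a b).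

Lemma chi_q : chi (Defs.q zetaP) =
  a ^+ 2 * Q + 2 * a * b * rho + b ^+ 2 * Q ^+ 2 - 3 * At * a.
Proof. by apply: chiE; exact: chart_q. Qed.
Lemma chi_Q : chi (Defs.Q zetaP) = Q.
Proof. by apply: chiE; exact: chart_Q. Qed.
Lemma chi_eu : chi z_eu = 2 * a * Q + 2 * b * rho - 3 * At.
Proof. by apply: chiE; exact: chart_eu. Qed.
Lemma chi_r : chi z_r =
  2 * (a * (Q * e1 + rho * e4) + b * (Q ^+ 2 * e4 + rho * e1) - 3 * At * e1).
Proof. by apply: chiE; exact: chart_r. Qed.
Lemma chi_R : chi z_R = 2 * rho.
Proof. by apply: chiE; exact: chart_R. Qed.
Lemma chi_u : chi z_u = 2 * (Q * e1 + rho * e4).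
Proof. by apply: chiE; exact: chart_u. Qed.
Lemma chi_U : chi z_U = 2 * a * rho + 2 * b * Q ^+ 2.
Proof. by apply: chiE; exact: chart_U. Qed.

Definition chi_gens := (chi_q, chi_Q, chi_eu, chi_r, chi_R, chi_u, chi_U).

End ChiGenerators.

(** The charts [chart_at] are charts over [{poly C}], so the quintuples of polynomials include a
    family that is faithful on [H]. *)
Lemma Z_eq_chi (z z' : Z zeta) : (forall A Q rho a b : {poly C},
  chi (@polyC C) false A Q rho a b z = chi (@polyC C) false A Q rho a b z') -> z = z'.
Proof.
move=> E; suff z0 : val (z - z') = 0 :> H.
  by apply/eqP; rewrite -subr_eq0; apply/eqP; apply: val_inj; rewrite z0.
apply: (@chart_at_faithful C zeta zetaP (val (z - z'))) => A X Y a b _.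
by rewrite [LHS]chart_val rmorphB /= E subrr raddf0.
Qed.

Lemma is_Trunc_eu : is_Trunc (val z_eu) ('X_ix * 'X_iX + 'X_iy * 'X_iY).
Proof.
pose w1 : W zeta := toW (inW_1 zeta).
exists [:: ('X_ix * 'X_iX + 'X_iy * 'X_iY, w1);
  (- ('X%:MP), reflW zeta 0); (- ('X%:MP), reflW zeta 1);
  (- ('X%:MP), reflW zeta 2)].
have rN i : (refl zeta i == 1%:M) = false.
  by apply/eqP => /matrixP/(_ 0 0); rewrite !mxE /= => /eqP; rewrite eq_sym oner_eq0.
split; last by rewrite !big_cons big_nil /= eqxx !rN addr0.
rewrite !big_cons big_nil /= addr0 mult_mapD !mult_mapN /= /h_eu.
have XE (w : W zeta) : mult_map 'X%:MP w = Hconst 'X * HW w.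
  by rewrite -[_%:MP]mulr1 mul_mpolyC -mpolyX0 mult_mapZX !mnm0E !expr0 !mulr1.
have XXE i j (w : W zeta) : mult_map ('X_i * 'X_j) w =
    mult_map (1 *: 'X_[(U_(i) + U_(j))%MM]) w.
  by rewrite scale1r mpolyXD.
rewrite !XE !XXE !mult_mapZX !mnmDE !mnm1E /= !expr0 !expr1 (rmorph1 Hconst).
rewrite !mul1r !mulr1 HW1 // !mulr1 !big_ord_recl big_ord0 addr0 !mulrDr !opprD.
have -> : lift ord0 (lift ord0 ord0) = 2 :> 'I_3 by apply: val_inj.
by have -> : lift ord0 ord0 = 1 :> 'I_3 by apply: val_inj.
Qed.

(** [eu] is chosen by its truncation. A second candidate differs from [z_eu] by a central element
    with zero component at the identity, and [center_nf_eq0] applies. *)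
Lemma euE : eu zeta = z_eu.
Proof.
apply: xget_unique; first exact: is_Trunc_eu.
move=> z [s [Es Ps]]; suff z0 : val (z - z_eu) = 0 :> H.
  by apply/eqP; rewrite -subr_eq0; apply/eqP; apply: val_inj; rewrite z0.
have [s' [Es' Ps']] := is_Trunc_eu.
apply: (@center_nf_eq0 _ _ zetaP _ (fun j => \sum_(u <- s | u.2 == wel zetaP j) u.1 -
  \sum_(u <- s' | u.2 == wel zetaP j) u.1)); first exact: valP.
  by rewrite nf_zmod -!nf_list -Es -Es' rmorphB.
have w1 (u : W zeta) : (u == wel zetaP 0) = (val u == 1%:M).
  by rewrite -val_eqE /= /wmat /= rot0.
by rewrite /= !(eq_bigl _ _ (fun u => w1 u.2)) -Ps -Ps' subrr.
Qed.

Let G : Z zeta := z_eu ^+ 2 - 9 * Zconst zeta 'X ^+ 2 - 4 * q zetaP * Q zetaP.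

Lemma rel_q : q zetaP * G = z_r * z_U - z_u ^+ 2.
Proof.
apply: Z_eq_chi => A Q rho a b; rewrite !(rmorphM, rmorphB, rmorphXn, rmorph_nat).
by rewrite /= chi_const !chi_gens map_polyX hornerX; ring.
Qed.

Lemma rel_Q : Q zetaP * G = z_R * z_u - z_U ^+ 2.
Proof.
apply: Z_eq_chi => A Q rho a b; rewrite !(rmorphM, rmorphB, rmorphXn, rmorph_nat).
by rewrite /= chi_const !chi_gens map_polyX hornerX; ring.
Qed.

Lemma rel_eu : z_eu * G = z_r * z_R - z_u * z_U.
Proof.
apply: Z_eq_chi => A Q rho a b; rewrite !(rmorphM, rmorphB, rmorphXn, rmorph_nat).
by rewrite /= chi_const !chi_gens map_polyX hornerX; ring.
Qed.

End CentralElements.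

(** * Generators of the centre *)

Section Generation.
Context {C : numClosedFieldType} {zeta : C}.
Hypothesis zetaP : 3.-primitive_root zeta.

Local Notation Z := (Z zeta).
Local Notation orbX := (orbX (zeta := zeta)).
Local Notation orbY := (orbY (zeta := zeta)).
Local Notation orbx := (orbx (zeta := zeta)).
Local Notation orby := (orby (zeta := zeta)).
Local Notation pt := (pt (zeta := zeta)).

Inductive generated : Z -> Prop :=
| gen_const p : generated (Zconst zeta p)
| gen_q : generated (Defs.q zetaP)
| gen_Q : generated (Defs.Q zetaP)
| gen_eu : generated (z_eu zetaP)
| gen_r : generated (z_r zetaP)
| gen_R : generated (z_R zetaP)
| gen_u : generated (z_u zetaP)
| gen_U : generated (z_U zetaP)
| gen_add z z' : generated z -> generated z' -> generated (z + z')
| gen_mul z z' : generated z -> generated z' -> generated (z * z').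

Definition deg_le n (p : {poly C}) c := (size p <= n.+1)%N /\ p`_n = c.

(** One-by-one matrices transfer the rules for [topm] to polynomials. *)
Let as_mx (p : {poly C}) : 'M[{poly C}]_1 := p%:M.

Let deg_leE n p c : deg_le n p c <-> topm n (as_mx p) c%:M.
Proof.
split=> [[s1 c1] i j|/(_ 0 0) [s1 c1]].
  by rewrite !mxE (ord1 i) (ord1 j) eqxx !mulr1n.
by move: s1 c1; rewrite !mxE eqxx !mulr1n.
Qed.

Lemma deg_leD n p p' c c' : deg_le n p c -> deg_le n p' c' -> deg_le n (p + p') (c + c').
Proof.
by move=> /deg_leE pc /deg_leE pc'; apply/deg_leE; rewrite /as_mx !raddfD; exact: topmD.
Qed.

Lemma deg_leM n m p p' c c' : deg_le n p c -> deg_le m p' c' ->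
  deg_le (n + m) (p * p') (c * c').
Proof.
move=> /deg_leE pc /deg_leE pc'; apply/deg_leE; rewrite /as_mx !scalar_mxM.
exact: topmM.
Qed.

Lemma deg_leC c : deg_le 0 c%:P c.
Proof. by rewrite /deg_le size_polyC coefC; case: (_ != 0). Qed.

Lemma deg_leN n p c : deg_le n p c -> deg_le n (- p) (- c).
Proof. by move=> [s1 c1]; rewrite /deg_le size_polyN coefN c1. Qed.

Lemma deg_leX c : deg_le 1 (c *: 'X) c.
Proof.
split; last by rewrite coefZ coefX mulr1.
by apply: leq_trans (size_scale_leq _ _) _; rewrite size_polyX.
Qed.

Lemma deg_le_lower n m p c : (n < m)%N -> deg_le n p c -> deg_le m p 0.
Proof.
move=> nm [s1 _]; split; first exact: leq_trans s1 (leqW nm).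
by rewrite nth_default // (leq_trans s1).
Qed.

Lemma deg_le_nat n : deg_le 0 n%:R n%:R.
Proof. by rewrite -polyC_natr; exact: deg_leC. Qed.

Lemma deg_leXn n p c k : deg_le n p c -> deg_le (n * k) (p ^+ k) (c ^+ k).
Proof.
move=> pc; elim: k => [|k IH]; first by rewrite muln0; exact: (deg_le_nat 1).
by rewrite mulnS !exprS; exact: deg_leM.
Qed.

Lemma deg_le_cast n p c c' : c = c' -> deg_le n p c -> deg_le n p c'.
Proof. by move=> ->. Qed.

Definition theta A X Y a b (z : Z) : {poly C} :=
  chi zetaP (@polyC C) false A%:P (X * Y)%:P ((X ^+ 3 + Y ^+ 3) / 2)%:P
    (a *: 'X) (b *: 'X) z.

Lemma thetaE A X Y a b z : chart_at zetaP A X Y a b (val z) = (theta A X Y a b z)%:M.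
Proof. exact: chart_val. Qed.

Lemma thetaD A X Y a b z z' :
  theta A X Y a b (z + z') = theta A X Y a b z + theta A X Y a b z'.
Proof. exact: rmorphD. Qed.

Lemma thetaM A X Y a b z z' :
  theta A X Y a b (z * z') = theta A X Y a b z * theta A X Y a b z'.
Proof. exact: rmorphM. Qed.

Definition fn5 := C -> C -> C -> C -> C -> C.

(* [theta] scales the parameters [a], [b] by a formal variable, so that the
   symbol of a central element of degree [n] in [x], [y] is the coefficient of
   degree [n] of its value. *)
Definition sym n (f : fn5) : Prop := exists2 z, generated z &
  forall A X Y a b, deg_le n (theta A X Y a b z)
    (f A X Y (a * Y + b * X ^+ 2) (a * X + b * Y ^+ 2)).

Lemma sym_ext n f g : (forall A X Y x y, f A X Y x y = g A X Y x y) ->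
  sym n f -> sym n g.
Proof. by move=> fg [z gz zf]; exists z => // A X Y a b; rewrite -fg; exact: zf. Qed.

Lemma symD n f g : sym n f -> sym n g ->
  sym n (fun A X Y x y => f A X Y x y + g A X Y x y).
Proof.
move=> [z gz zf] [z' gz' zg]; exists (z + z') => [|A X Y a b]; first exact: gen_add.
by rewrite thetaD; apply: deg_leD; [exact: zf|exact: zg].
Qed.

Lemma symM n m f g : sym n f -> sym m g ->
  sym (n + m) (fun A X Y x y => f A X Y x y * g A X Y x y).
Proof.
move=> [z gz zf] [z' gz' zg]; exists (z * z') => [|A X Y a b]; first exact: gen_mul.
by rewrite thetaM; apply: deg_leM; [exact: zf|exact: zg].
Qed.

Lemma sym_const p : sym 0 (fun A _ _ _ _ => p.[A]).
Proof.
exists (Zconst zeta p); first exact: gen_const.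
move=> A X Y a b; rewrite /theta chi_const horner_map; exact: deg_leC.
Qed.

Lemma sym_num (c : C) : sym 0 (fun _ _ _ _ _ => c).
Proof. by apply: sym_ext (sym_const c%:P) => *; rewrite hornerC. Qed.

Lemma sym0 n : sym n (fun _ _ _ _ _ => 0).
Proof.
exists (Zconst zeta 0); first exact: gen_const.
move=> A X Y a b; rewrite /theta chi_const map_poly0 horner0.
by rewrite /deg_le size_poly0 coef0.
Qed.

Lemma symZ n c f : sym n f -> sym n (fun A X Y x y => c * f A X Y x y).
Proof. by move=> sf; exact: (symM (sym_num c) sf). Qed.

Lemma sym_sum n I (s : seq I) (F : I -> fn5) : (forall i, sym n (F i)) ->
  sym n (fun A X Y x y => \sum_(i <- s) F i A X Y x y).
Proof.
move=> sF; elim: s => [|i s IH].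
  by apply: sym_ext (sym0 n) => *; rewrite big_nil.
by apply: sym_ext (symD (sF i) IH) => *; rewrite big_cons.
Qed.

Lemma sym_Q : sym 0 (fun _ X Y _ _ => X * Y).
Proof.
exists (Defs.Q zetaP) => [|A X Y a b]; first exact: gen_Q.
by rewrite /theta chi_Q; exact: deg_leC.
Qed.

Lemma sym_R : sym 0 (fun _ X Y _ _ => X ^+ 3 + Y ^+ 3).
Proof.
exists (z_R zetaP) => [|A X Y a b]; first exact: gen_R.
rewrite /theta chi_R; apply: deg_le_cast (deg_leM (deg_le_nat 2) (deg_leC _)).
by rewrite mulrCA mulfV ?mulr1 // pnatr_eq0.
Qed.

Let two0 : (2 : C) != 0. Proof. by rewrite pnatr_eq0. Qed.

Lemma sym_eu : sym 1 (fun _ X Y x y => X * x + Y * y).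
Proof.
exists (z_eu zetaP) => [|A X Y a b]; first exact: gen_eu.
rewrite /theta chi_eu; apply: deg_le_cast (deg_leD (deg_leD
  (deg_leM (deg_leM (deg_le_nat 2) (deg_leX a)) (deg_leC _))
  (deg_leM (deg_leM (deg_le_nat 2) (deg_leX b)) (deg_leC _)))
  (deg_le_lower _ (deg_leN (deg_leM (deg_le_nat 3) (deg_leC _))))) => //.
by field.
Qed.

Lemma sym_U : sym 1 (fun _ X Y x y => X ^+ 2 * y + Y ^+ 2 * x).
Proof.
exists (z_U zetaP) => [|A X Y a b]; first exact: gen_U.
rewrite /theta chi_U; apply: deg_le_cast (deg_leD
  (deg_leM (deg_leM (deg_le_nat 2) (deg_leX a)) (deg_leC _))
  (deg_leM (deg_leM (deg_le_nat 2) (deg_leX b)) (deg_leXn 2 (deg_leC _)))) => //.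
by field.
Qed.

Lemma sym_q : sym 2 (fun _ X Y x y => x * y).
Proof.
exists (Defs.q zetaP) => [|A X Y a b]; first exact: gen_q.
rewrite /theta chi_q; apply: deg_le_cast (deg_leD (deg_leD (deg_leD
  (deg_leM (deg_leXn 2 (deg_leX a)) (deg_leC _))
  (deg_leM (deg_leM (deg_leM (deg_le_nat 2) (deg_leX a)) (deg_leX b)) (deg_leC _)))
  (deg_leM (deg_leXn 2 (deg_leX b)) (deg_leXn 2 (deg_leC _))))
  (deg_le_lower _ (deg_leN (deg_leM (deg_leM (deg_le_nat 3) (deg_leC _)) (deg_leX a))))) => //.
by field.
Qed.

Let e1_deg A X Y a b : deg_le 2 (2 * (a *: 'X) * (b *: 'X) * (X * Y)%:P +
    2 * (b *: 'X) ^+ 2 * ((X ^+ 3 + Y ^+ 3) / 2)%:P - 3 * A%:P * (b *: 'X))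
  (2 * a * b * (X * Y) + 2 * b ^+ 2 * ((X ^+ 3 + Y ^+ 3) / 2)).
Proof.
apply: deg_le_cast (deg_leD (deg_leD
  (deg_leM (deg_leM (deg_leM (deg_le_nat 2) (deg_leX a)) (deg_leX b)) (deg_leC _))
  (deg_leM (deg_leM (deg_le_nat 2) (deg_leXn 2 (deg_leX b))) (deg_leC _)))
  (deg_le_lower _ (deg_leN (deg_leM (deg_leM (deg_le_nat 3) (deg_leC _)) (deg_leX b))))) => //.
exact: addr0.
Qed.

Let e4_deg X Y a b : deg_le 2 ((a *: 'X) ^+ 2 - (b *: 'X) ^+ 2 * (X * Y)%:P)
  (a ^+ 2 - b ^+ 2 * (X * Y)).
Proof.
exact: (deg_leD (deg_leXn 2 (deg_leX a))
  (deg_leN (deg_leM (deg_leXn 2 (deg_leX b)) (deg_leC _)))).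
Qed.

Lemma sym_u : sym 2 (fun _ X Y x y => Y * x ^+ 2 + X * y ^+ 2).
Proof.
exists (z_u zetaP) => [|A X Y a b]; first exact: gen_u.
rewrite /theta chi_u; apply: deg_le_cast (deg_leM (deg_le_nat 2) (deg_leD
  (deg_leM (deg_leC _) (e1_deg A X Y a b)) (deg_leM (deg_leC _) (e4_deg X Y a b)))).
by field.
Qed.

Lemma sym_r : sym 3 (fun _ X Y x y => x ^+ 3 + y ^+ 3).
Proof.
exists (z_r zetaP) => [|A X Y a b]; first exact: gen_r.
rewrite /theta chi_r; apply: deg_le_cast (deg_leM (deg_le_nat 2) (deg_leD (deg_leD
  (deg_leM (deg_leX a) (deg_leD
    (deg_leM (deg_leC _) (e1_deg A X Y a b)) (deg_leM (deg_leC _) (e4_deg X Y a b))))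
  (deg_leM (deg_leX b) (deg_leD
    (deg_leM (deg_leXn 2 (deg_leC _)) (e4_deg X Y a b))
    (deg_leM (deg_leC _) (e1_deg A X Y a b)))))
  (deg_le_lower _ (deg_leN (deg_leM (deg_leM (deg_le_nat 3) (deg_leC _))
    (e1_deg A X Y a b)))))) => //.
by field.
Qed.

Definition swap (f : fn5) : fn5 := fun A X Y x y => f A Y X y x.

(** The differences [f - swap f] for the rotation invariants [X x], [X^3], [X^2 y], [X y^2], [y^3];
    [wt] is their degree in [x], [y]. *)
Definition anti (j : 'I_5) : fn5 := fun _ X Y x y =>
  [:: X * x - Y * y; X ^+ 3 - Y ^+ 3; X ^+ 2 * y - Y ^+ 2 * x;
      X * y ^+ 2 - Y * x ^+ 2; y ^+ 3 - x ^+ 3]`_j.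
Definition wt (j : 'I_5) : nat := nth 0%N [:: 1; 0; 1; 2; 3] j.

Let eu2 := symM sym_eu sym_eu.
Let qQ := symM sym_q sym_Q.
Let eu2qQ := symD eu2 (symZ (-2) qQ).

Definition mono (a b c d : nat) : fn5 := fun _ X Y x y =>
  X ^+ a * Y ^+ b * x ^+ c * y ^+ d.

Local Ltac monoE := move=> *; rewrite /swap /mono /anti /=; ring.

(** With primes for [swap], [(f - f') (g - g') = (f g + f' g') - (f g' + f' g)] is again symmetric;
    the fifteen identities write it through the generators. *)
Lemma sym_anti i j : sym (wt i + wt j)
  (fun A X Y x y => anti i A X Y x y * anti j A X Y x y).
Proof.
wlog ij : i j / (i <= j)%N => [sij|].
  case: (leqP i j) => [|/ltnW]; first exact: sij.
  by move=> /sij ji; rewrite addnC; apply: sym_ext ji => *; rewrite mulrC.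
case: i ij => -[|[|[|[|[|//]]]]] i; case: j => -[|[|[|[|[|//]]]]] j // _;
  rewrite /wt /anti /=.
- by apply: sym_ext (symD eu2 (symZ (-4) qQ)); monoE.
- by apply: sym_ext (symD (symM sym_eu sym_R) (symZ (-2) (symM sym_Q sym_U))); monoE.
- by apply: sym_ext (symD (symM sym_q sym_R) (symZ (-1) (symM sym_Q sym_u))); monoE.
- by apply: sym_ext (symD (symM sym_q sym_U) (symZ (-1) (symM sym_Q sym_r))); monoE.
- by apply: sym_ext (symD (symZ 2 (symM sym_q sym_u)) (symZ (-1) (symM sym_eu sym_r))); monoE.
- by apply: sym_ext (symD (symM sym_R sym_R) (symZ (-4) (symM sym_Q (symM sym_Q sym_Q)))); monoE.
- by apply: sym_ext (symD (symM sym_R sym_U) (symZ (-2) (symM (symM sym_Q sym_Q) sym_eu))); monoE.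
- by apply: sym_ext (symD (symM sym_R sym_u) (symZ (-2) (symM sym_Q eu2qQ))); monoE.
- by apply: sym_ext (symD (symM sym_R sym_r) (symZ (-2) (symM sym_eu (symD eu2 (symZ (-3) qQ))))); monoE.
- by apply: sym_ext (symD (symM sym_U sym_U) (symZ (-4) (symM (symM sym_Q sym_Q) sym_q))); monoE.
- by apply: sym_ext (symD (symM sym_U sym_u) (symZ (-2) (symM qQ sym_eu))); monoE.
- by apply: sym_ext (symD (symM sym_U sym_r) (symZ (-2) (symM sym_q eu2qQ))); monoE.
- by apply: sym_ext (symD (symM sym_u sym_u) (symZ (-4) (symM sym_Q (symM sym_q sym_q)))); monoE.
- by apply: sym_ext (symD (symM sym_u sym_r) (symZ (-2) (symM (symM sym_q sym_q) sym_eu))); monoE.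
- by apply: sym_ext (symD (symM sym_r sym_r) (symZ (-4) (symM sym_q (symM sym_q sym_q)))); monoE.
Qed.

(* Invariance under multiplication by the invariants of the rotation group is
   easier to prove together with the products by its anti-invariants. *)
Definition sym_rot n (f : fn5) : Prop :=
  sym n (fun A X Y x y => f A X Y x y + swap f A X Y x y) /\
  forall j, sym (n + wt j)
    (fun A X Y x y => (f A X Y x y - swap f A X Y x y) * anti j A X Y x y).

Lemma sym_rot_ext n f g : (forall A X Y x y, f A X Y x y = g A X Y x y) ->
  sym_rot n f -> sym_rot n g.
Proof.
move=> fg [sf af]; split=> [|j]; [apply: sym_ext sf|apply: sym_ext (af j)];
  by move=> *; rewrite /swap !fg.
Qed.

Lemma sym_rot1 : sym_rot 0 (fun _ _ _ _ _ => 1).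
Proof.
split=> [|j]; first exact: (sym_num (1 + 1)).
by apply: sym_ext (sym0 _) => *; rewrite /swap subrr mul0r.
Qed.

(** With primes for [swap], [2 (f g + f' g') = (f + f') (g + g') + (f - f') (g - g')] and [2 (f g -
    f' g') = (f - f') (g + g') + (f + f') (g - g')]. The coefficient [c = 0] covers a symmetric [g],
    which has no anti-invariant whose degree could be compared with [k]. *)
Lemma sym_rot_mul n k f g : sym_rot n f ->
  sym k (fun A X Y x y => g A X Y x y + swap g A X Y x y) ->
  (exists c, exists2 j, (c != 0 -> k = wt j) & forall A X Y x y,
     g A X Y x y - swap g A X Y x y = c * anti j A X Y x y) ->
  sym_rot (n + k) (fun A X Y x y => f A X Y x y * g A X Y x y).
Proof.
move=> [sf af] sg [c [j kj gj]].
have ag i : sym (k + wt i)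
    (fun A X Y x y => (g A X Y x y - swap g A X Y x y) * anti i A X Y x y).
  have [c0|/kj ->] := eqVneq c 0.
    by apply: sym_ext (sym0 _) => *; rewrite gj c0 !mul0r.
  by apply: sym_ext (symZ c (sym_anti j i)) => *; rewrite gj mulrA.
have fag : sym (n + k) (fun A X Y x y =>
    (f A X Y x y - swap f A X Y x y) * (g A X Y x y - swap g A X Y x y)).
  have [c0|/kj ->] := eqVneq c 0.
    by apply: sym_ext (sym0 _) => *; rewrite gj c0 mul0r mulr0.
  by apply: sym_ext (symZ c (af j)) => *; rewrite gj mulrCA.
split=> [|i].
  by apply: sym_ext (symZ 2^-1 (symD (symM sf sg) fag)) => * /=; rewrite /swap; field.
have E1 := symM (af i) sg; have E2 := symM sf (ag i).
rewrite addnAC in E1; rewrite addnA in E2.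
by apply: sym_ext (symZ 2^-1 (symD E1 E2)) => * /=; rewrite /swap; field.
Qed.

Let o0 := @Ordinal 5 0 isT.
Let o1 := @Ordinal 5 1 isT.
Let o2 := @Ordinal 5 2 isT.
Let o3 := @Ordinal 5 3 isT.
Let o4 := @Ordinal 5 4 isT.

(** A rotation multiplies [x] and [Y] by a cube root of unity and [X] and [y] by its inverse, so the
    congruence says that the monomial is rotation invariant. Such a monomial, unless it is 1, is
    divisible by one of the twelve invariants split off below. *)
Lemma sym_rot_mono a b c d : (a + d = b + c %[mod 3])%N -> sym_rot (c + d) (mono a b c d).
Proof.
have [N] := ubnP (a + b + c + d)%N; elim: N a b c d => // N IH a b c d abcd E.
have step k a' b' c' d' a1 b1 c1 d1 : (a' + b' + c' + d' < N)%N ->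
    (a' + d' = b' + c' %[mod 3])%N -> (c + d = c' + d' + k)%N ->
    sym k (fun A X Y x y => mono a1 b1 c1 d1 A X Y x y + swap (mono a1 b1 c1 d1) A X Y x y) ->
    (exists c, exists2 j, (c != 0 -> k = wt j) & forall A X Y x y,
       mono a1 b1 c1 d1 A X Y x y - swap (mono a1 b1 c1 d1) A X Y x y
       = c * anti j A X Y x y) ->
    a = (a' + a1)%N -> b = (b' + b1)%N -> c = (c' + c1)%N -> d = (d' + d1)%N ->
    sym_rot (c + d) (mono a b c d).
  move=> lt' E' -> sg ag -> -> -> ->.
  apply: sym_rot_ext (sym_rot_mul (IH _ _ _ _ lt' E') sg ag) => *.
  by rewrite /mono !exprD; ring.
have [/andP[a0 b0]|ab] := boolP ((0 < a) && (0 < b))%N.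
  apply: (step 0%N a.-1 b.-1 c d 1%N 1%N 0%N 0%N); try lia.
    by apply: sym_ext (symZ 2 sym_Q); monoE.
  by exists 0, o0; rewrite ?eqxx //; monoE.
have [/andP[a0 c0]|ac] := boolP ((0 < a) && (0 < c))%N.
  apply: (step 1%N a.-1 b c.-1 d 1%N 0%N 1%N 0%N); try lia.
    by apply: sym_ext sym_eu; monoE.
  by exists 1, o0 => //; monoE.
have [/andP[d0 b0]|db] := boolP ((0 < d) && (0 < b))%N.
  apply: (step 1%N a b.-1 c d.-1 0%N 1%N 0%N 1%N); try lia.
    by apply: sym_ext sym_eu; monoE.
  by exists (-1), o0 => //; monoE.
have [/andP[d0 c0]|dc] := boolP ((0 < d) && (0 < c))%N.
  apply: (step 2%N a b c.-1 d.-1 0%N 0%N 1%N 1%N); try lia.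
    by apply: sym_ext (symZ 2 sym_q); monoE.
  by exists 0, o0; rewrite ?eqxx //; monoE.
have [a3|a3] := leqP 3 a.
  apply: (step 0%N (a - 3)%N b c d 3%N 0%N 0%N 0%N); try lia.
    by apply: sym_ext sym_R; monoE.
  by exists 1, o1 => //; monoE.
have [b3|b3] := leqP 3 b.
  apply: (step 0%N a (b - 3)%N c d 0%N 3%N 0%N 0%N); try lia.
    by apply: sym_ext sym_R; monoE.
  by exists (-1), o1 => //; monoE.
have [c3|c3] := leqP 3 c.
  apply: (step 3%N a b (c - 3)%N d 0%N 0%N 3%N 0%N); try lia.
    by apply: sym_ext sym_r; monoE.
  by exists (-1), o4 => //; monoE.
have [d3|d3] := leqP 3 d.
  apply: (step 3%N a b c (d - 3)%N 0%N 0%N 0%N 3%N); try lia.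
    by apply: sym_ext sym_r; monoE.
  by exists 1, o4 => //; monoE.
have [/andP[a2 d1]|ad2] := boolP ((1 < a) && (0 < d))%N.
  apply: (step 1%N (a - 2)%N b c d.-1 2%N 0%N 0%N 1%N); try lia.
    by apply: sym_ext sym_U; monoE.
  by exists 1, o2 => //; monoE.
have [/andP[a1 d2]|ad1] := boolP ((0 < a) && (1 < d))%N.
  apply: (step 2%N a.-1 b c (d - 2)%N 1%N 0%N 0%N 2%N); try lia.
    by apply: sym_ext sym_u; monoE.
  by exists 1, o3 => //; monoE.
have [/andP[b2 c1]|bc2] := boolP ((1 < b) && (0 < c))%N.
  apply: (step 1%N a (b - 2)%N c.-1 d 0%N 2%N 1%N 0%N); try lia.
    by apply: sym_ext sym_U; monoE.
  by exists (-1), o2 => //; monoE.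
have [/andP[b1 c2]|bc1] := boolP ((0 < b) && (1 < c))%N.
  apply: (step 2%N a b.-1 (c - 2)%N d 0%N 1%N 2%N 0%N); try lia.
    by apply: sym_ext sym_u; monoE.
  by exists (-1), o3 => //; monoE.
have [a0 [b0 [c0 d0]]] : a = 0%N /\ b = 0%N /\ c = 0%N /\ d = 0%N by lia.
by rewrite a0 b0 c0 d0; apply: sym_rot_ext sym_rot1 => *; rewrite /mono; ring.
Qed.

Lemma pev_top n A v (P : {mpoly {poly C}[4]}) : pev A v (top n P) =
  \sum_(m <- msupp P | degxy m == n) (P@_m).[A] * mono (m iX) (m iY) (m ix) (m iy) A
    (v iX) (v iY) (v ix) (v iy).
Proof.
rewrite rmorph_sum; apply: eq_bigr => m _; rewrite [LHS]mmapZ mmapX.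
congr (_ * _); rewrite /mmap1 /mono !big_ord_recl big_ord0 mulr1 !mulrA.
by congr (v _ ^+ m _ * v _ ^+ m _ * v _ ^+ m _ * v _ ^+ m _); apply: val_inj.
Qed.

Section Orbit.
Variables (A X Y a b : C).

Local Notation Xj := (orbX X Y).
Local Notation Yj := (orbY X Y).
Local Notation xj := (orbx X Y a b).
Local Notation yj := (orby X Y a b).
Local Notation x := (a * Y + b * X ^+ 2).
Local Notation y := (a * X + b * Y ^+ 2).

Let orb_mono i k l m (j : 'I_6) : mono i k l m A (Xj j) (Yj j) (xj j) (yj j) =
  if (j < 3)%N then (zeta ^+ (2 * (i + m) + (k + l))) ^+ j * mono i k l m A X Y x y
  else (zeta ^+ ((i + m) + 2 * (k + l))) ^+ j * swap (mono i k l m) A X Y x y.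
Proof.
have z3 : (zeta ^+ j) ^+ 3 = 1 := zetaX3 zetaP _.
have zV : zeta ^- j = (zeta ^+ j) ^+ 2 by rewrite (zetaVX zetaP) mulnC exprM.
rewrite /orbx /orby /orbX /orbY ![(zeta ^+ (_ + _)) ^+ j]exprAC zV.
move: (zeta ^+ j) z3 => u z3.
case: ifP => _.
  have -> : a * (u * Y) + b * (u ^+ 2 * X) ^+ 2 = u * x by ring: z3.
  have -> : a * (u ^+ 2 * X) + b * (u * Y) ^+ 2 = u ^+ 2 * y by ring: z3.
  rewrite /mono !exprMn mulnDr !exprD !expr0; ring.
have -> : a * (u ^+ 2 * X) + b * (u * Y) ^+ 2 = u ^+ 2 * y by ring: z3.
have -> : a * (u * Y) + b * (u ^+ 2 * X) ^+ 2 = u * x by ring: z3.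
by rewrite /swap /mono !exprMn mulnDr !exprD !expr0; ring.
Qed.

(** The three rotations multiply the monomial by the powers of a cube root of unity, which sum to 0
    unless the root is 1. The three reflections do the same to its image under [swap]. *)
Lemma orbit_sum i k l m :
  \sum_j mono i k l m A (Xj j) (Yj j) (xj j) (yj j) =
  if (i + m == k + l %[mod 3])%N then
    3 * (mono i k l m A X Y x y + swap (mono i k l m) A X Y x y) else 0.
Proof.
under eq_bigr do rewrite orb_mono.
rewrite !big_ord_recl big_ord0 /= /bump /= ?add1n ?addn0 !addr0.
have w1 (e : nat) : (zeta ^+ e == 1) = (3 %| e)%N by rewrite -(prim_order_dvd zetaP).
have d1 : (3 %| 2 * (i + m) + (k + l))%N = (i + m == k + l %[mod 3])%N.
  by apply/idP/eqP; lia.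
have d2 : (3 %| (i + m) + 2 * (k + l))%N = (i + m == k + l %[mod 3])%N.
  by apply/idP/eqP; lia.
move: (zetaX3 zetaP (2 * (i + m) + (k + l))%N) (w1 (2 * (i + m) + (k + l))%N).
move: (zetaX3 zetaP ((i + m) + 2 * (k + l))%N) (w1 ((i + m) + 2 * (k + l))%N).
rewrite d1 d2; move: (zeta ^+ _) (zeta ^+ _) => v w v3 v1 ww3 ww1.
have sum0 (u : C) : u ^+ 3 = 1 -> u != 1 -> u ^+ 2 = - u - 1.
  move=> u3 uN; apply: (@mulfI _ (u - 1)); first by rewrite subr_eq0.
  by ring: u3.
move: v1 ww1; case: (i + m == k + l %[mod 3])%N => v1 ww1.
  by rewrite (eqP v1) (eqP ww1) !expr1n; ring.
have v2 := sum0 _ v3 (negbT v1); have w2 := sum0 _ ww3 (negbT ww1).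
have e45 (u : C) : u ^+ 3 = 1 -> (u ^+ 4 = u) * (u ^+ 5 = u ^+ 2).
  by move=> u3; split; ring: u3.
by rewrite !(e45 _ v3, e45 _ ww3) ?v3 ?ww3 v2 w2 expr1 expr0; ring.
Qed.

End Orbit.

Lemma generic_orb X Y j : generic X Y ->
  generic (orbX X Y j) (orbY X Y j).
Proof.
rewrite /generic (orbQ zetaP) /orbX /orbY !mulf_eq0 !negb_or => /andP[-> /=].
case: ifP => _; rewrite !exprMn !exprVn !(zetaX3 zetaP) invr1 !mul1r //.
by rewrite -opprB oppr_eq0.
Qed.

(** A chart involves [X], [Y] only through [X Y] and [X^3 + Y^3], which are constant on orbits. *)
Lemma theta_orb A X Y a b j z :
  theta A (orbX X Y j) (orbY X Y j) a b z =
  theta A X Y a b z.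
Proof.
rewrite /theta (orbQ zetaP) (orbrho zetaP).
by rewrite mulrCA mulfV ?mulr1 // pnatr_eq0.
Qed.

Lemma pt_orb0 X Y a b j : pt (orbX X Y j)
    (orbY X Y j) a b 0 =1
  (fun i => [:: orbX X Y j; orbY X Y j;
    orbx X Y a b j; orby X Y a b j]`_i).
Proof.
have X0 u v : orbX u v 0 = u by rewrite /orbX /= expr0 invr1 mul1r.
have Y0 u v : orbY u v 0 = v by rewrite /orbY /= expr0 mul1r.
by move=> i; rewrite /pt /orbx /orby !X0 !Y0.
Qed.

(** Induction on the degree in [x], [y]. The symbol of [z] is constant along orbits, so it equals
    its orbit average, a combination of symmetrised rotation-invariant monomials; these are symbols
    of generated elements. Subtracting one lowers the degree. *)
Lemma generated_all z : generated z.
Proof.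
suff gen n P : val z = nf zetaP P -> (forall j, degxy_lt n (P j)) -> generated z.
  have [P E] := H_spanned zetaP (val z); have [N PN] := degxy_bound P.
  exact: gen E PN.
elim: n z P => [|n IH] z P E Pn.
  suff -> : z = Zconst zeta 0 by exact: gen_const.
  by apply: val_inj; rewrite E nf_lt0 //= (rmorph0 (Hconst zeta)).
pose good (m : 'X_{1..4}) := (degxy m == n) && (m iX + m iy == m iY + m ix %[mod 3])%N.
(* [orbit_sum] has the factor 3 and the average divides by 6, which leaves [2^-1]. *)
pose F m : fn5 := if good m then fun A X Y x y => ((P 0)@_m).[A] * (2^-1 *
    (mono (m iX) (m iY) (m ix) (m iy) A X Y x y +
     swap (mono (m iX) (m iY) (m ix) (m iy)) A X Y x y)) else fun _ _ _ _ _ => 0.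
have symF m : sym n (F m).
  rewrite /F; case: ifP => [/andP[/eqP <- /eqP mod3]|_]; last exact: sym0.
  by have := symM (sym_const (P 0)@_m) (symZ 2^-1 (sym_rot_mono mod3).1).
have [z' gz' z'F] := sym_sum (msupp (P 0)) symF.
suff : generated (z - z').
  by move=> gzz'; rewrite -[z](subrK z'); exact: gen_add.
have [|P' E' P'n] := @nf_reduce _ _ zetaP (val (z - z')) n; last exact: IH E' P'n.
move=> A X Y a b g; exists (theta A X Y a b (z - z')); last exact: thetaE.
have zc := valP z; have top_z := center_nf_top zc E Pn.
have [s1 c1] : deg_le n (theta A X Y a b (z - z')) 0.
  rewrite /theta rmorphB /=.
  rewrite -[X in deg_le _ _ X](subrr (\sum_(m <- msupp (P 0))
    F m A X Y (a * Y + b * X ^+ 2) (a * X + b * Y ^+ 2))).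
  apply: deg_leD; last by apply: deg_leN; exact: z'F.
  have [sz _] := topm_nf zetaP A X Y a b Pn 0 0.
  rewrite -E thetaE mxE eqxx mulr1n in sz.
  split=> //.
  have topj j : (theta A X Y a b z)`_n = pev A (pt
      (orbX X Y j) (orbY X Y j) a b 0) (top n (P 0)).
    have := top_z A _ _ a b (generic_orb j g) 0.
    by rewrite eqxx thetaE theta_orb mxE eqxx mulr1n.
  (* Six times the leading coefficient is the sum of its values computed at the six points of the
     orbit. *)
  apply: (@mulfI _ 6); first by rewrite pnatr_eq0.
  rewrite mulr_natl -[6%N](card_ord 6) -sumr_const (eq_bigr _ (fun j _ => topj j)).
  under eq_bigr do rewrite pev_top !pt_orb0 /=.
  rewrite exchange_big /= mulr_sumr [LHS]big_mkcond; apply: eq_bigr => m _.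
  rewrite -mulr_sumr orbit_sum /F /good; case: (degxy m == n); last by rewrite mulr0.
  case: (_ == _ %[mod 3])%N; last by rewrite !mulr0.
  by rewrite card_ord /=; field.
move: s1; rewrite leq_eqVlt ltnS => /predU1P[sn|//].
have := lead_coef_eq0 (theta A X Y a b (z - z')); rewrite lead_coefE sn /= c1 eqxx.
by rewrite -size_poly_eq0 sn.
Qed.

End Generation.

(** * Simple quotients of baby Verma modules *)

Section SimpleQuotient.
Variables (A : pzRingType) (M : lmodType A) (g : M).
Hypothesis g0 : g != 0.
Hypothesis cyclic : forall v, exists h : A, v = h *: g.

Let proper (S : set M) := [/\ forall x y, S x -> S y -> S (x + y),
  forall a x, S x -> S (a *: x) & ~ S g].

(** Zorn's lemma for submodules avoiding the generator [g]. Containing 0 is not part of [proper], so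
    that the empty chain has an upper bound; a maximal set without 0 would be empty, while the zero
    submodule is proper. *)
Lemma maximal_submodule : exists S : set M, [/\ S 0, proper S &
  forall S', proper S' -> S `<=` S' -> S' `<=` S].
Proof.
have [F FP Ftot|S [[SD SZ Sg] Smax]] := @Zorn_bigcup M proper.
  split=> [x y [X FX Xx] [Y FY Yy]|a x [X FX Xx]|[X FX Xg]].
  - have [XY|YX] := Ftot _ _ FX FY.
      by exists Y => //; have [+ _ _] := FP _ FY; apply=> //; exact: XY.
    by exists X => //; have [+ _ _] := FP _ FX; apply=> //; exact: YX.
  - by exists X => //; have [_ + _] := FP _ FX; apply.
  - by have [_ _] := FP _ FX; apply.
have S0 : S 0.
  apply: contrapT => NS0; apply: (Smax [set 0]).
    split=> [x Sx|E]; last by apply: NS0; exact: E.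
    by case: NS0; rewrite -(scale0r x); exact: SZ.
  split=> [x y /= -> ->|a x /= ->|/= /eqP]; rewrite ?addr0 ?scaler0 //.
  exact/negP.
exists S; split=> // S' PS' SS'; apply: contrapT => NS'.
by apply: (Smax S') => //; split.
Qed.

(** A submodule of the quotient that contains the image of [g] is everything; otherwise its preimage
    avoids [g] and is absorbed by the maximal one. *)
Lemma exists_simple_quotient :
  exists (L : lmodType A) (f : {linear M -> L}), simple_quotient f.
Proof.
have [S [S0 [SD SZ Sg] Smax]] := maximal_submodule.
have SE v : submod S v <-> S v.
  split=> [[s Ss ->]|Sv]; last first.
    by exists [:: (1, v)]; rewrite ?big_seq1 ?scale1r // => u; rewrite inE => /eqP ->.
  rewrite big_seq; apply: (big_ind S) => // u us; apply: SZ; exact: Ss.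
exists (quotMod S), (@quotM A M S); split; last by move=> v; exists (repr v); exact: quotM_repr.
have q0 v : quotM S v = 0 <-> S v.
  by rewrite -[0](raddf0 (@quotM A M S)) quotM_eq subr0 SE.
split; first by exists (quotM S g); apply/eqP => /q0.
move=> P [P0 PL]; have PD x y : x \in P -> y \in P -> x + y \in P.
  by move=> Px Py; rewrite -[x]scale1r; exact: PL.
have PZ a x : x \in P -> a *: x \in P by move=> Px; rewrite -[_ *: _]addr0; exact: PL.
have [Pg|Pg] := boolP (quotM S g \in P).
  right=> v; rewrite -(quotM_repr v); have [h ->] := cyclic (repr v).
  by rewrite linearZ; exact: PZ.
left=> v; rewrite -(quotM_repr v) => Pv; apply/q0.
apply: (Smax (fun x => quotM S x \in P)) => //.
  split=> [x y|a x|]; last exact/negP.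
    by rewrite raddfD; exact: PD.
  by rewrite linearZ; exact: PZ.
by move=> x /q0 ->.
Qed.

End SimpleQuotient.

(** * Invariant polynomials and the coinvariant relations *)

Section Coinvariants.
Context {C : numClosedFieldType} {zeta : C}.
Hypothesis zetaP : 3.-primitive_root zeta.

Local Notation rot := (@rot C zeta).
Local Notation i0 := (0 : 'I_2).
Local Notation i1 := (1 : 'I_2).

Let prod2 (F : 'I_2 -> {mpoly C[2]}) : \prod_i F i = F i0 * F i1.
Proof.
by rewrite !big_ord_recl big_ord0 mulr1; congr (F _ * F _); apply: val_inj.
Qed.

Let sum2 (F : 'I_2 -> {mpoly C[2]}) : \sum_i F i = F i0 + F i1.
Proof.
by rewrite !big_ord_recl big_ord0 addr0; congr (F _ + F _); apply: val_inj.
Qed.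

Let XE (m : 'X_{1..2}) : 'X_[m] = 'X_i0 ^+ m i0 * 'X_i1 ^+ m i1 :> {mpoly C[2]}.
Proof. by rewrite mpolyXE_id prod2. Qed.

Lemma linear_subst_diag (M : 'M[C]_2) (p : {mpoly C[2]}) m : M 0 1 = 0 -> M 1 0 = 0 ->
  (linear_subst M p)@_m = p@_m * (M 0 0 ^+ m i0 * M 1 1 ^+ m i1).
Proof.
move=> M01 M10; rewrite /linear_subst comp_mpolyEX.
have E m' : 'X_[m'] \mPo [tuple \sum_l M k l *: 'X_l | k < 2] =
    (M 0 0 ^+ m' i0 * M 1 1 ^+ m' i1) *: 'X_[m'] :> {mpoly C[2]}.
  rewrite comp_mpolyX prod2 !tnth_mktuple !sum2 M01 M10 !scale0r addr0 add0r.
  by rewrite !exprZn -scalerAl -scalerAr scalerA -XE.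
under eq_bigr do rewrite E scalerA.
rewrite raddf_sum /=; under eq_bigr do rewrite mcoeffZ mcoeffX.
rewrite (sum_msupp_delta (F := fun k => p@_k * (M 0 0 ^+ k i0 * M 1 1 ^+ k i1))) //.
by move=> ->; rewrite mul0r.
Qed.

Lemma linear_subst_swap (M : 'M[C]_2) (p : {mpoly C[2]}) (m m' : 'X_{1..2}) :
  M 0 0 = 0 -> M 1 1 = 0 -> M 0 1 = 1 -> M 1 0 = 1 ->
  m' i0 = m i1 -> m' i1 = m i0 -> (linear_subst M p)@_m = p@_m'.
Proof.
move=> M00 M11 M01 M10 m'0 m'1; rewrite /linear_subst comp_mpolyEX.
pose sw (k : 'X_{1..2}) := [multinom if i == i0 then k i1 else k i0 | i < 2].
have E k : 'X_[k] \mPo [tuple \sum_l M i l *: 'X_l | i < 2] = 'X_[sw k] :> {mpoly C[2]}.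
  rewrite comp_mpolyX prod2 !tnth_mktuple !sum2 M01 M10 M00 M11 !scale0r addr0 add0r.
  by rewrite !scale1r [RHS]XE !mnmE /= mulrC.
under eq_bigr do rewrite E.
have swm k : (sw k == m) = (k == m').
  apply/eqP/eqP => [/mnmP km|->].
    apply/mnmP => i; have := km i0; have := km i1; rewrite !mnmE /=.
    by case: (ord2 i) => -> k0 k1; rewrite ?m'0 ?m'1.
  by apply/mnmP => i; rewrite mnmE; case: (ord2 i) => ->; rewrite /= ?m'0 ?m'1.
rewrite raddf_sum /=; under eq_bigr do rewrite mcoeffZ mcoeffX swm.
by rewrite (sum_msupp_delta (F := fun k => p@_k)).
Qed.

(* [inv] is inversion for [invariant_CV] and transposition for [invariant_CVd]. *)
Let coef_inv (p : {mpoly C[2]}) (inv : 'M[C]_2 -> 'M[C]_2) :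
  (forall w : W zeta, linear_subst (inv (val w)) p = p) ->
  inv (refl zeta 0) = refl zeta 0 -> inv (rot 1) 0 1 = 0 -> inv (rot 1) 1 0 = 0 ->
  (exists2 z, 3.-primitive_root z & inv (rot 1) 0 0 = z /\ inv (rot 1) 1 1 = z^-1) ->
  (forall m : 'X_{1..2}, ~~ (3 %| m i0 + 2 * m i1)%N -> p@_m = 0) /\
  (forall m m' : 'X_{1..2}, m' i0 = m i1 -> m' i1 = m i0 -> p@_m = p@_m').
Proof.
move=> ip irefl r01 r10 [z zP [r00 r11]]; split=> [m m3|m m' m0 m1].
  have := ip (toW (inW_rot zetaP 1)) => /(congr1 (mcoeff m)).
  rewrite (linear_subst_diag _ _ r01 r10) r00 r11 (zetaV zP) -exprM -exprD.
  move/eqP; rewrite -[X in _ == X]mulr1 -subr_eq0 -mulrBr mulf_eq0 subr_eq0.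
  by rewrite -(prim_order_dvd zP) (negPf m3) orbF => /eqP.
have := ip (toW (inW_reflN zetaP 0)) => /(congr1 (mcoeff m)) /=.
by rewrite irefl (@linear_subst_swap _ _ _ m') // !mxE /= ?expr0 ?invr1.
Qed.

Let invmx_rot : invmx (rot 1) = rot 2.
Proof. by rewrite (rot_inv zetaP). Qed.

Lemma invariant_CV_coef p : invariant_CV zeta p ->
  (forall m : 'X_{1..2}, ~~ (3 %| m i0 + 2 * m i1)%N -> p@_m = 0) /\
  (forall m m' : 'X_{1..2}, m' i0 = m i1 -> m' i1 = m i0 -> p@_m = p@_m').
Proof.
move=> ip; apply: (coef_inv (inv := invmx)) => //; rewrite ?(refl_inv zetaP) ?invmx_rot ?mxE //.
exists (zeta ^+ 2); last by rewrite ?invmx_rot ?mxE.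
by rewrite (prim_root_exp_coprime _ zetaP).
Qed.

Lemma invariant_CVd_coef p : invariant_CVd zeta p ->
  (forall m : 'X_{1..2}, ~~ (3 %| m i0 + 2 * m i1)%N -> p@_m = 0) /\
  (forall m m' : 'X_{1..2}, m' i0 = m i1 -> m' i1 = m i0 -> p@_m = p@_m').
Proof.
move=> ip; apply: (coef_inv (inv := trmx)) => //; rewrite ?mxE //.
  apply/matrixP => i j; rewrite !mxE.
  by case: (ord2 i) => ->; case: (ord2 j) => -> //=; rewrite expr0 invr1.
by exists zeta => //; rewrite !mxE /= !expr1.
Qed.

(** The four conditions kill all monomials except the constant, those of degree prime to 3 in one
    variable, and the two cubes. Invariance excludes the former, [p@_0 = 0] the constant, and the
    cubes have equal coefficients, so they cancel. *)
Lemma mmap_coinvariant (R : nzRingType) (f : {additive C -> R}) (h : 'I_2 -> R)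
    (p : {mpoly C[2]}) :
  (forall m : 'X_{1..2}, ~~ (3 %| m i0 + 2 * m i1)%N -> p@_m = 0) ->
  (forall m m' : 'X_{1..2}, m' i0 = m i1 -> m' i1 = m i0 -> p@_m = p@_m') ->
  p@_0%MM = 0 -> h i0 * h i1 = 0 -> h i0 ^+ 4 = 0 -> h i1 ^+ 4 = 0 ->
  h i0 ^+ 3 + h i1 ^+ 3 = 0 -> mmap f h p = 0.
Proof.
move=> p3 psw p0 h01 h04 h14 h03.
pose m30 : 'X_{1..2} := [multinom if i == i0 then 3%N else 0%N | i < 2].
pose m03 : 'X_{1..2} := [multinom if i == i0 then 0%N else 3%N | i < 2].
have term m : m != m30 -> m != m03 -> f p@_m * mmap1 h m = 0.
  move=> N30 N03; have -> : mmap1 h m = h i0 ^+ m i0 * h i1 ^+ m i1.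
    rewrite /mmap1 !big_ord_recl big_ord0 mulr1.
    by congr (h _ ^+ m _ * h _ ^+ m _); apply: val_inj.
  have big k j : (4 <= j)%N -> h k ^+ 4 = 0 -> h k ^+ j = 0.
    by move=> j4 hk; rewrite -(subnKC j4) exprD hk mul0r.
  have [j3|j3] := boolP (3 %| m i0 + 2 * m i1)%N; last by rewrite p3 // raddf0 mul0r.
  case E0 : (m i0) => [|a]; case E1 : (m i1) => [|b].
  - have -> : m = 0%MM by apply/mnmP => i; rewrite mnm0E; case: (ord2 i) => ->.
    by rewrite p0 raddf0 mul0r.
  - rewrite mul1r; have [b4|b4] := leqP 4 b.+1; first by rewrite big // mulr0.
    case/eqP: N03; apply/mnmP => i; rewrite mnmE; case: (ord2 i) => -> //=.
    by rewrite E1; move: j3 b4; rewrite E0 E1; clear; lia.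
  - rewrite mulr1; have [a4|a4] := leqP 4 a.+1; first by rewrite big // mulr0.
    case/eqP: N30; apply/mnmP => i; rewrite mnmE; case: (ord2 i) => -> //=.
    by rewrite E0; move: j3 a4; rewrite E0 E1; clear; lia.
  - by rewrite exprSr exprS -mulrA [h i0 * _]mulrA h01 mul0r !mulr0.
pose k := (maxn (msize p) 4).
have lt (m : 'X_{1..2}) : (mdeg m < 4)%N -> (mdeg m < k)%N.
  by move=> m4; rewrite (leq_trans m4) // leq_maxr.
have d30 : (mdeg m30 < 4)%N by rewrite mdegE !big_ord_recl big_ord0 !mnmE.
have d03 : (mdeg m03 < 4)%N by rewrite mdegE !big_ord_recl big_ord0 !mnmE.
rewrite (@mmapE _ _ _ _ _ _ k) ?leq_maxl //.
rewrite (bigD1 (BMultinom (lt _ d30))) //= (bigD1 (BMultinom (lt _ d03))) /=; last first.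
  by apply/eqP => /(congr1 (fun m : 'X_{1..2 < k} => (m : 'X_{1..2}) i0)); rewrite /= !mnmE.
rewrite big1 ?addr0 => [|m /andP[N30 N03]]; last by apply: term.
rewrite (psw m03 m30) ?mnmE // -mulrDr /mmap1 !big_ord_recl !big_ord0 !mnmE /=.
have -> : lift ord0 (ord0 : 'I_1) = i1 by apply: val_inj.
by rewrite !mulr1 mul1r [X in _ * X]h03 mulr0.
Qed.

End Coinvariants.

(** * A module containing the standard representation *)

Section StandardRepresentation.
Context {C : numClosedFieldType} {zeta : C}.
Hypothesis zetaP : 3.-primitive_root zeta.
Variable A : C.

Local Notation W := (W zeta).
(** In the basis below [[x, Y]] maps [e_2] to [2 l e_1], while [A \sum_i zeta ^- i s_i] maps it to
    [3 A e_1]. *)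
Let l : C := 3 / 2 * A.

(* The simple module of the standard representation has basis
   e_1, e_2 | f, g | h_1, h_2 where W acts on (e_1, e_2) and (h_1, h_2) as on V,
   trivially on f and by det on g. *)
Let nat_X : 'M[C]_6 := mx6
  [:: [::]; [::]; [:: 1; 0; 0; 0; 0; 0]; [:: 1; 0; 0; 0; 0; 0]; [::];
      [:: 0; 0; 1; 1; 0; 0]].
Let nat_Y : 'M[C]_6 := mx6
  [:: [::]; [::]; [:: 0; 1; 0; 0; 0; 0]; [:: 0; - 1; 0; 0; 0; 0];
      [:: 0; 0; 1; - 1; 0; 0]; [::]].
Let nat_x : 'M[C]_6 := mx6
  [:: [:: 0; 0; l; - l; 0; 0]; [::]; [:: 0; 0; 0; 0; 0; - l]; [:: 0; 0; 0; 0; 0; l];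
      [::]; [::]].
Let nat_y : 'M[C]_6 := mx6
  [:: [::]; [:: 0; 0; l; l; 0; 0]; [:: 0; 0; 0; 0; - l; 0]; [:: 0; 0; 0; 0; - l; 0];
      [::]; [::]].
Let nat_W (w : 'M[C]_2) : 'M[C]_6 := mx6
  [:: [:: w 0 0; w 0 1; 0; 0; 0; 0]; [:: w 1 0; w 1 1; 0; 0; 0; 0];
      [:: 0; 0; 1; 0; 0; 0]; [:: 0; 0; 0; \det w; 0; 0];
      [:: 0; 0; 0; 0; w 0 0; w 0 1]; [:: 0; 0; 0; 0; w 1 0; w 1 1]].

Let nat_X_col c0 c1 c2 c3 c4 c5 : nat_X *m col6 c0 c1 c2 c3 c4 c5 =
  col6 0 0 c0 c0 0 (c2 + c3).
Proof. by rewrite mx6_col /dot6 /=; congr col6; ring. Qed.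
Let nat_Y_col c0 c1 c2 c3 c4 c5 : nat_Y *m col6 c0 c1 c2 c3 c4 c5 =
  col6 0 0 c1 (- c1) (c2 - c3) 0.
Proof. by rewrite mx6_col /dot6 /=; congr col6; ring. Qed.
Let nat_x_col c0 c1 c2 c3 c4 c5 : nat_x *m col6 c0 c1 c2 c3 c4 c5 =
  col6 (l * (c2 - c3)) 0 (- l * c5) (l * c5) 0 0.
Proof. by rewrite mx6_col /dot6 /=; congr col6; ring. Qed.
Let nat_y_col c0 c1 c2 c3 c4 c5 : nat_y *m col6 c0 c1 c2 c3 c4 c5 =
  col6 0 (l * (c2 + c3)) (- l * c4) (- l * c4) 0 0.
Proof. by rewrite mx6_col /dot6 /=; congr col6; ring. Qed.
Let nat_W_col w c0 c1 c2 c3 c4 c5 : nat_W w *m col6 c0 c1 c2 c3 c4 c5 =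
  col6 (w 0 0 * c0 + w 0 1 * c1) (w 1 0 * c0 + w 1 1 * c1) c2 (\det w * c3)
    (w 0 0 * c4 + w 0 1 * c5) (w 1 0 * c4 + w 1 1 * c5).
Proof. by rewrite mx6_col /dot6 /=; congr col6; ring. Qed.

Let nat_refl_col i c0 c1 c2 c3 c4 c5 :
  nat_W (refl zeta i) *m col6 c0 c1 c2 c3 c4 c5 =
  col6 (zeta ^+ i * c1) (zeta ^- i * c0) c2 (- c3) (zeta ^+ i * c5) (zeta ^- i * c4).
Proof. by rewrite nat_W_col (det_refl zetaP) !mxE /=; congr col6; ring. Qed.

Let nat_WM v w : nat_W (v *m w) = nat_W v * nat_W w.
Proof.
apply: mx6P => c0 c1 c2 c3 c4 c5.
by rewrite -mulmxA !nat_W_col det_mulmx !mul2E; congr col6; ring.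
Qed.

Let nat_W1 : nat_W 1%:M = 1.
Proof.
apply: mx6P => c0 c1 c2 c3 c4 c5.
by rewrite nat_W_col mul1mx det1 !mxE /=; congr col6; ring.
Qed.

Let f : {rmorphism {poly C} -> 'M[C]_6} := @scalar_mx C 6 \o horner_eval A.

Let fC c (s : 'M[C]_6) : f c * s = s * f c.
Proof. by rewrite /f /=; exact/esym/scalar_mxC. Qed.

Let fcol c (v : 'cV[C]_6) : f c%:P *m v = c *: v.
Proof. by rewrite /f /= mul_scalar_mx /horner_eval hornerC. Qed.

Let fcolM c (M : 'M[C]_6) (v : 'cV[C]_6) : (f c%:P * M) *m v = c *: (M *m v).
Proof. by rewrite -mulmxA fcol. Qed.

Let fcolX (M : 'M[C]_6) (v : 'cV[C]_6) : (f 'X * M) *m v = A *: (M *m v).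
Proof. by rewrite -mulmxA /f /= mul_scalar_mx /horner_eval hornerX. Qed.

Let zz i : (zeta ^+ i) * (zeta ^- i) = 1.
Proof. by rewrite mulfV ?expf_neq0 ?(zeta_neq0 zetaP). Qed.
Let zz2 i : (zeta ^+ i) ^+ 2 = zeta ^- i.
Proof. by rewrite (zetaVX zetaP) mulnC exprM. Qed.
Let zV2 i : (zeta ^- i) ^+ 2 = zeta ^+ i.
Proof. by rewrite (zetaVX zetaP) -exprM mulnC (zetaXX zetaP). Qed.

Local Ltac refl_action E1 E2 :=
  move=> ->; apply: mx6P => c0 c1 c2 c3 c4 c5;
  rewrite -mulrA fcolM -!mulmxA !(nat_refl_col, E1, E2, col6Z);
  match goal with i : nat |- _ => move: (zz i) (zz2 i) (zV2 i) end;
  move: (zeta ^+ _) (zeta ^- _).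

Let nat_rho_x (w : W) i : val w = refl zeta i ->
  nat_W (val w) * nat_x = f (zeta ^- i)%:P * nat_y * nat_W (val w).
Proof. by refl_action nat_x_col nat_y_col; move=> u v E1 E2 E3; congr col6; ring: E1 E2 E3. Qed.
Let nat_rho_y (w : W) i : val w = refl zeta i ->
  nat_W (val w) * nat_y = f (zeta ^+ i)%:P * nat_x * nat_W (val w).
Proof. by refl_action nat_x_col nat_y_col; move=> u v E1 E2 E3; congr col6; ring: E1 E2 E3. Qed.
Let nat_rho_X (w : W) i : val w = refl zeta i ->
  nat_W (val w) * nat_X = f (zeta ^+ i)%:P * nat_Y * nat_W (val w).
Proof. by refl_action nat_X_col nat_Y_col; move=> u v E1 E2 E3; congr col6; ring: E1 E2 E3. Qed.
Let nat_rho_Y (w : W) i : val w = refl zeta i ->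
  nat_W (val w) * nat_Y = f (zeta ^- i)%:P * nat_X * nat_W (val w).
Proof. by refl_action nat_X_col nat_Y_col; move=> u v E1 E2 E3; congr col6; ring: E1 E2 E3. Qed.

Local Ltac mul_zero E1 E2 :=
  apply: mx6P => c0 c1 c2 c3 c4 c5; rewrite mul0mx -!mulmxA !(E1, E2);
  apply/matrixP => -[[|[|[|[|[|[|]]]]]] i] j //; rewrite !mxE /=; ring.

Let nat_xy : nat_x * nat_y = 0.
Proof. mul_zero nat_x_col nat_y_col. Qed.
Let nat_yx : nat_y * nat_x = 0.
Proof. mul_zero nat_x_col nat_y_col. Qed.
Let nat_XY : nat_X * nat_Y = 0.
Proof. mul_zero nat_X_col nat_Y_col. Qed.
Let nat_YX : nat_Y * nat_X = 0.
Proof. mul_zero nat_X_col nat_Y_col. Qed.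

Let kE : (zeta ^+ 0 = 1) * (zeta ^- 0 = 1) * (zeta ^+ 1 = zeta)
  * (zeta ^- 1 = zeta ^+ 2) * (zeta ^- 2 = zeta).
Proof. by do !split; rewrite ?expr0 ?invr1 ?expr1 ?(zetaV zetaP) ?(zetaV2 zetaP). Qed.

Let nat_sum c0 c1 c2 c3 c4 c5 :
  (\sum_(i < 3) nat_W (val (reflW zeta i))) *m col6 c0 c1 c2 c3 c4 c5 =
  col6 0 0 (3 * c2) (- 3 * c3) 0 0.
Proof.
have z2 := zeta_sum zetaP.
rewrite !big_ord_recl big_ord0 addr0 !mulmxDl /= !nat_refl_col !col6D !kE.
by congr col6; ring: z2.
Qed.
Let nat_zsum c0 c1 c2 c3 c4 c5 :
  (\sum_(i < 3) f (zeta ^+ i)%:P * nat_W (val (reflW zeta i)))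
    *m col6 c0 c1 c2 c3 c4 c5 = col6 0 (3 * c0) 0 0 0 (3 * c4).
Proof.
have z2 := zeta_sum zetaP.
rewrite !big_ord_recl big_ord0 addr0 !mulmxDl !fcolM /= !nat_refl_col !(col6Z, col6D) !kE.
by congr col6; ring: z2.
Qed.
Let nat_zVsum c0 c1 c2 c3 c4 c5 :
  (\sum_(i < 3) f (zeta ^- i)%:P * nat_W (val (reflW zeta i)))
    *m col6 c0 c1 c2 c3 c4 c5 = col6 (3 * c1) 0 0 0 (3 * c5) 0.
Proof.
have z2 := zeta_sum zetaP.
rewrite !big_ord_recl big_ord0 addr0 !mulmxDl !fcolM /= !nat_refl_col !(col6Z, col6D) !kE.
by congr col6; ring: z2.
Qed.

Let two0 : (2 : C) != 0. Proof. by rewrite pnatr_eq0. Qed.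

Let nat_xX : nat_x * nat_X - nat_X * nat_x =
  - f 'X * \sum_(i < 3) nat_W (val (reflW zeta i)).
Proof.
apply: mx6P => c0 c1 c2 c3 c4 c5; rewrite mulNr mulNmx fcolX nat_sum mulmxBl -!mulmxA.
by rewrite !(nat_x_col, nat_X_col) !(col6Z, col6N, col6D) /l; congr col6; field.
Qed.
Let nat_yY : nat_y * nat_Y - nat_Y * nat_y =
  - f 'X * \sum_(i < 3) nat_W (val (reflW zeta i)).
Proof.
apply: mx6P => c0 c1 c2 c3 c4 c5; rewrite mulNr mulNmx fcolX nat_sum mulmxBl -!mulmxA.
by rewrite !(nat_y_col, nat_Y_col) !(col6Z, col6N, col6D) /l; congr col6; field.
Qed.
Let nat_xY : nat_x * nat_Y - nat_Y * nat_x =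
  f 'X * \sum_(i < 3) f (zeta ^- i)%:P * nat_W (val (reflW zeta i)).
Proof.
apply: mx6P => c0 c1 c2 c3 c4 c5; rewrite fcolX nat_zVsum mulmxBl -!mulmxA.
by rewrite !(nat_x_col, nat_Y_col) !(col6Z, col6N, col6D) /l; congr col6; field.
Qed.
Let nat_yX : nat_y * nat_X - nat_X * nat_y =
  f 'X * \sum_(i < 3) f (zeta ^+ i)%:P * nat_W (val (reflW zeta i)).
Proof.
apply: mx6P => c0 c1 c2 c3 c4 c5; rewrite fcolX nat_zsum mulmxBl -!mulmxA.
by rewrite !(nat_y_col, nat_X_col) !(col6Z, col6N, col6D) /l; congr col6; field.
Qed.

Definition nat_module : {rmorphism H zeta -> 'M[C]_6} :=
  @H_rep C zeta zetaP 'M[C]_6 f (fun w => nat_W (val w))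
    nat_x nat_y nat_X nat_Y fC
    (fun w E => etrans (congr1 nat_W E) nat_W1)
    (fun w1 w2 w3 E => esym (etrans (congr1 nat_W E) (nat_WM _ _)))
    nat_rho_x nat_rho_y nat_rho_X nat_rho_Y (etrans nat_xy (esym nat_yx))
    (etrans nat_XY (esym nat_YX)) nat_xX nat_xY nat_yX nat_yY.

Let nat_cube0 (M : 'M[C]_6) : (forall c0 c1 c2 c3 c4 c5,
  M *m (M *m (M *m col6 c0 c1 c2 c3 c4 c5)) = 0) -> M ^+ 3 = 0.
Proof.
move=> M0; apply: mx6P => c0 c1 c2 c3 c4 c5; rewrite mul0mx -[RHS](M0 c0 c1 c2 c3 c4 c5).
by rewrite !exprS expr0 mulr1 -!mulmxA.
Qed.

Let cube_coinvariant (M N : 'M[C]_6) : M * N = 0 -> M ^+ 3 = 0 -> N ^+ 3 = 0 ->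
  [/\ M * N = 0, M ^+ 4 = 0, N ^+ 4 = 0 & M ^+ 3 + N ^+ 3 = 0].
Proof. by move=> MN M3 N3; split; rewrite ?(exprS _ 3) ?M3 ?N3 ?mulr0 ?addr0. Qed.

Lemma nat_module_const p : nat_module (Hconst zeta p) = p.[A]%:M.
Proof. exact: H_rep_const. Qed.

Lemma nat_module_coinvariant :
  [/\ nat_module (Hx zeta) * nat_module (Hy zeta) = 0,
      nat_module (Hx zeta) ^+ 4 = 0, nat_module (Hy zeta) ^+ 4 = 0
    & nat_module (Hx zeta) ^+ 3 + nat_module (Hy zeta) ^+ 3 = 0] /\
  [/\ nat_module (HX zeta) * nat_module (HY zeta) = 0,
      nat_module (HX zeta) ^+ 4 = 0, nat_module (HY zeta) ^+ 4 = 0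
    & nat_module (HX zeta) ^+ 3 + nat_module (HY zeta) ^+ 3 = 0].
Proof.
have Ex : nat_module (Hx zeta) = nat_x by exact: H_rep_x.
have Ey : nat_module (Hy zeta) = nat_y by exact: H_rep_y.
have EX : nat_module (HX zeta) = nat_X by exact: H_rep_X.
have EY : nat_module (HY zeta) = nat_Y by exact: H_rep_Y.
rewrite Ex Ey EX EY; split; apply: cube_coinvariant => //; apply: nat_cube0 => c0 c1 c2 c3 c4 c5;
  rewrite !(nat_x_col, nat_y_col, nat_X_col, nat_Y_col);
  by apply/matrixP => -[[|[|[|[|[|[|]]]]]] i] j //; rewrite !mxE /=; ring.
Qed.

Definition nat_vec (j : 'I_2) : 'cV[C]_6 :=
  if j == 0 then col6 1 0 0 0 0 0 else col6 0 1 0 0 0 0.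

Lemma nat_vec_W w j : nat_module (HW w) *m nat_vec j = \sum_k rho_nat zeta w k j *: nat_vec k.
Proof.
have -> : nat_module (HW w) = nat_W (val w) by exact: H_rep_W.
rewrite !big_ord_recl big_ord0 addr0 /nat_vec /rho_nat /= !col6Z col6D.
have -> : lift ord0 ord0 = 1 :> 'I_2 by apply: val_inj.
have -> : ord0 = 0 :> 'I_2 by apply: val_inj.
by case: (ord2 j) => -> /=; rewrite nat_W_col; congr col6; ring.
Qed.

Lemma nat_vec_V u j : nat_module (HV zeta u) *m nat_vec j = 0.
Proof.
have Ex : nat_module (Hx zeta) = nat_x by exact: H_rep_x.
have Ey : nat_module (Hy zeta) = nat_y by exact: H_rep_y.
rewrite HVE rmorphD !rmorphM Ex Ey !nat_module_const mulmxDl -!mulmxA !mul_scalar_mx.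
rewrite /nat_vec; case: ifP => _; rewrite nat_x_col nat_y_col !col6Z col6D;
  by apply/matrixP => -[[|[|[|[|[|[|]]]]]] i] k //; rewrite !mxE /=; ring.
Qed.

End StandardRepresentation.

Section BabyVermaChart.
Context {C : numClosedFieldType} {zeta : C}.
Hypothesis zetaP : 3.-primitive_root zeta.
Variables (tw : bool) (A : C).

(** With [Q = rho = a = b = 0] the chart is the coinvariant algebra with pure Dunkl operators. The
    vector [1] is killed by [V] and carries the trivial character, or det when twisted. *)
Definition verma_chart : {rmorphism H zeta -> 'M[C]_6} :=
  chart zetaP (@idfun C) tw A 0 0 0 0.

Lemma verma_chart_const p : verma_chart (Hconst zeta p) = p.[A]%:M.
Proof. by rewrite [LHS]chart_const map_poly_id. Qed.

Let At : C := if tw then - A else A.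

Lemma verma_chart_coinvariant :
  [/\ verma_chart (Hx zeta) * verma_chart (Hy zeta) = 0,
      verma_chart (Hx zeta) ^+ 4 = 0, verma_chart (Hy zeta) ^+ 4 = 0
    & verma_chart (Hx zeta) ^+ 3 + verma_chart (Hy zeta) ^+ 3 = 0] /\
  [/\ verma_chart (HX zeta) * verma_chart (HY zeta) = 0,
      verma_chart (HX zeta) ^+ 4 = 0, verma_chart (HY zeta) ^+ 4 = 0
    & verma_chart (HX zeta) ^+ 3 + verma_chart (HY zeta) ^+ 3 = 0].
Proof.
rewrite [verma_chart (Hx _)]chart_Hx [verma_chart (Hy _)]chart_Hy.
rewrite [verma_chart (HX _)]chart_HX [verma_chart (HY _)]chart_HY.
by split; split; apply: mx6P => c0 c1 c2 c3 c4 c5;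
  rewrite mul0mx ?exprS ?expr0 ?mulr1 ?mulmxDl -!mulmxA
    !(chart_x_col, chart_y_col, chart_X_col, chart_Y_col, col6D);
  apply/matrixP => -[[|[|[|[|[|[|]]]]]] i] j //; rewrite !mxE /=; ring.
Qed.

Definition verma_vec (j : 'I_1) : 'cV[C]_6 := col6 1 0 0 0 0 0.

Lemma verma_vec_V u j : verma_chart (HV zeta u) *m verma_vec j = 0.
Proof.
rewrite HVE rmorphD !rmorphM !verma_chart_const.
rewrite [verma_chart (Hx _)]chart_Hx [verma_chart (Hy _)]chart_Hy mulmxDl -!mulmxA.
rewrite !mul_scalar_mx chart_x_col chart_y_col !col6Z col6D.
by apply/matrixP => -[[|[|[|[|[|[|]]]]]] i] k //; rewrite !mxE /=; ring.
Qed.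

Lemma verma_vec_W w j : verma_chart (HW w) *m verma_vec j =
  (if tw then \det (val w) else 1) *: verma_vec j.
Proof.
rewrite [verma_chart (HW _)]chart_HW chart_W_col; congr (_ *: _).
by rewrite /verma_vec; congr col6; ring.
Qed.

End BabyVermaChart.

(** * Central characters of baby Verma modules *)

Section BabyVerma.
Context {C : numClosedFieldType} {zeta : C}.
Hypothesis zetaP : 3.-primitive_root zeta.
Variable c : 'I_3 -> C.

Local Notation H := (H zeta).
Local Notation Hbar := (Hbar zeta c).
Local Notation Hbar_pi := (@Hbar_pi C zeta c).

Lemma Hbar_piD h k : Hbar_pi (h + k) = Hbar_pi h + Hbar_pi k.
Proof. by rewrite /Hbar_pi !rmorphD. Qed.
Lemma Hbar_piM h k : Hbar_pi (h * k) = Hbar_pi h * Hbar_pi k.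
Proof. by rewrite /Hbar_pi !rmorphM. Qed.
Lemma Hbar_pi0 : Hbar_pi 0 = 0.
Proof. by rewrite /Hbar_pi !rmorph0. Qed.
Lemma Hbar_pi1 : Hbar_pi 1 = 1.
Proof. by rewrite /Hbar_pi !rmorph1. Qed.
Lemma Hbar_piN h : Hbar_pi (- h) = - Hbar_pi h.
Proof. by rewrite /Hbar_pi !rmorphN. Qed.

Lemma Hbar_pi_surj (h : Hbar) : exists k, h = Hbar_pi k.
Proof. by have [k ->] := quotR_surj h; have [k' ->] := quotR_surj k; exists k'. Qed.

Lemma Hbar_pi_const p i : Hbar_pi (Hconst zeta p) = Hbar_pi (Hconst zeta (p.[c i])%:P).
Proof.
rewrite /Hbar_pi; congr quotR; apply/quotR_eq; rewrite -rmorphB.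
have /factor_theorem [d ->] : root (p - (p.[c i])%:P) (c i).
  by rewrite /root !hornerE subrr.
by rewrite rmorphM; apply: ideal2Ml; apply: ideal2_gen; exists i.
Qed.

Section NonZero.
Variable Phi : {rmorphism H -> 'M[C]_6}.
Hypothesis Phi_const : forall i p, Phi (Hconst zeta p) = p.[c i]%:M.
Hypothesis Phi_coinv :
  [/\ Phi (Hx zeta) * Phi (Hy zeta) = 0, Phi (Hx zeta) ^+ 4 = 0,
      Phi (Hy zeta) ^+ 4 = 0 & Phi (Hx zeta) ^+ 3 + Phi (Hy zeta) ^+ 3 = 0] /\
  [/\ Phi (HX zeta) * Phi (HY zeta) = 0, Phi (HX zeta) ^+ 4 = 0,
      Phi (HY zeta) ^+ 4 = 0 & Phi (HX zeta) ^+ 3 + Phi (HY zeta) ^+ 3 = 0].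
Variables (n : nat) (rho : W zeta -> 'M[C]_n) (vec : 'I_n -> 'cV[C]_6).
Hypothesis vec_V : forall u j, Phi (HV zeta u) *m vec j = 0.
Hypothesis vec_W : forall w j, Phi (HW w) *m vec j = \sum_k rho w k j *: vec k.

Let Phi_Hc h : (exists i, h = Hconst zeta ('X - (c i)%:P)) -> Phi h = 0.
Proof. by move=> [i ->]; rewrite (Phi_const i) !hornerE subrr raddf0. Qed.

Let PhiHc : {rmorphism Hc zeta c -> 'M[C]_6} := quotR_liftM Phi_Hc.

Let PhiHc_pi h : PhiHc (Hc_pi c h) = Phi h.
Proof. exact: quotR_liftME. Qed.

Let Phi_mmap (h : 'I_2 -> H) (p : {mpoly C[2]}) : Phi (mpoly.mmap (fun a => Hconst zeta a%:P) h p) =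
  mpoly.mmap (fun a : C => a%:M : 'M[C]_6) (fun k => Phi (h k)) p.
Proof.
rewrite /mpoly.mmap rmorph_sum; apply: eq_bigr => m _.
rewrite rmorphM (Phi_const 0) hornerC /mmap1 rmorph_prod; congr (_ * _).
by apply: eq_bigr => i _; rewrite rmorphXn.
Qed.

Let Phi_Hbar h : coinvariant_rel h -> PhiHc h = 0.
Proof.
have [[xy x4 y4 xy3] [XY X4 Y4 XY3]] := Phi_coinv.
move=> [|] [p [ip p0 ->]]; rewrite PhiHc_pi Phi_mmap.
  have [p3 psw] := invariant_CV_coef zetaP ip.
  by apply: (@mmap_coinvariant _ _ (@scalar_mx C 6)) => //; exact: val_inj.
have [p3 psw] := invariant_CVd_coef zetaP ip.
by apply: (@mmap_coinvariant _ _ (@scalar_mx C 6)) => //; exact: val_inj.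
Qed.

Let PhiHbar_ex : exists F : {rmorphism Hbar -> 'M[C]_6}, forall h, F (Hbar_pi h) = Phi h.
Proof.
by exists (quotR_liftM Phi_Hbar) => h; rewrite -PhiHc_pi; exact: quotR_liftME.
Qed.

Let PhiHbar : {rmorphism Hbar -> 'M[C]_6} := projT1 (cid PhiHbar_ex).

Let PhiHbar_pi h : PhiHbar (Hbar_pi h) = Phi h.
Proof. exact: (projT2 (cid PhiHbar_ex)). Qed.

(** This map out of the free module kills the relations of the baby Verma module, so a generator
    with [vec j != 0] cannot vanish there. *)
Let psi (v : 'rV[Hbar]_n) : 'cV[C]_6 := \sum_j PhiHbar (v 0 j) *m vec j.

Let psiD u v : psi (u + v) = psi u + psi v.
Proof.
rewrite /psi -big_split; apply: eq_bigr => j _.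
by rewrite mxE (rmorphD PhiHbar) mulmxDl.
Qed.

Let psiZ a v : psi (a *: v) = PhiHbar a *m psi v.
Proof.
by rewrite /psi mulmx_sumr; apply: eq_bigr => j _; rewrite mxE (rmorphM PhiHbar) mulmxA.
Qed.

Let psi_delta j : psi (delta_mx 0 j) = vec j.
Proof.
have E k : (delta_mx 0 j : 'rV[Hbar]_n) 0 k = (k == j)%:R by rewrite mxE eqxx.
rewrite /psi (bigD1 j) //= big1 ?addr0 => [|k /negPf kj]; last first.
  by rewrite E kj (rmorph0 PhiHbar) mul0mx.
by rewrite E eqxx (rmorph1 PhiHbar); exact: mul1mx.
Qed.

Let psi0 : psi 0 = 0.
Proof. by rewrite /psi big1 // => j _; rewrite mxE (rmorph0 PhiHbar) mul0mx. Qed.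

Let psiN v : psi (- v) = - psi v.
Proof. by apply/eqP; rewrite -subr_eq0 opprK -psiD addNr psi0. Qed.

Let psi_rel v : submod (@baby_verma_rel C zeta c n rho) v -> psi v = 0.
Proof.
move=> [s srel {v}->]; elim: s srel => [|[a u] s IH] srel; first by rewrite big_nil psi0.
rewrite big_cons psiD psiZ IH => [|v vs]; last by apply: srel; rewrite inE vs orbT.
suff -> : psi u = 0 by rewrite mulmx0 addr0.
have /= := srel (a, u) (mem_head _ _); case=> [w j|u' j].
  rewrite psiD psiN psiZ psi_delta PhiHbar_pi vec_W.
  rewrite (big_morph psi psiD psi0) -sumrB big1 // => k _.
  by rewrite psiZ psi_delta PhiHbar_pi (Phi_const 0) hornerC mul_scalar_mx subrr.
by rewrite psiZ psi_delta PhiHbar_pi vec_V.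
Qed.

Lemma baby_verma_neq0 j : vec j != 0 ->
  quotM (@baby_verma_rel C zeta c n rho) (delta_mx 0 j) != 0.
Proof.
move=> vj; apply/eqP => E.
have /quotM_eq : quotM (@baby_verma_rel C zeta c n rho) (delta_mx 0 j) = quotM _ 0.
  by rewrite E raddf0.
by rewrite subr0 => /psi_rel; rewrite psi_delta => v0; rewrite v0 eqxx in vj.
Qed.

End NonZero.

Section ZPoint.
Hypothesis c_const : forall i, c i = c 0.
Variables (n : nat) (rho : W zeta -> 'M[C]_n) (lam : C).
Hypothesis rho_sum : \sum_(i < 3) rho (reflW zeta i) = lam%:M.

Local Notation M := (baby_verma c rho).
Local Notation gM := (quotM (@baby_verma_rel C zeta c n rho)).

Lemma baby_verma_actW w j : Hbar_pi (HW w) *: gM (delta_mx 0 j) =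
  \sum_k Hbar_pi (Hconst zeta (rho w k j)%:P) *: gM (delta_mx 0 k).
Proof.
rewrite -linearZ; under eq_bigr do rewrite -linearZ; rewrite -raddf_sum.
apply/quotM_eq; exists [:: (1, Hbar_pi (HW w) *: delta_mx 0 j -
  \sum_k Hbar_pi (Hconst zeta (rho w k j)%:P) *: delta_mx 0 k)].
  by move=> u; rewrite inE => /eqP ->; exact: baby_verma_W.
by rewrite big_seq1 scale1r.
Qed.

Let gM_V u j : Hbar_pi (HV zeta u) *: gM (delta_mx 0 j) = 0.
Proof.
rewrite -linearZ -[RHS](raddf0 gM); apply/quotM_eq.
exists [:: (1, Hbar_pi (HV zeta u) *: delta_mx 0 j)].
  by move=> v; rewrite inE => /eqP ->; exact: baby_verma_V.
by rewrite big_seq1 scale1r subr0.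
Qed.

Lemma baby_verma_span (v : M) : exists h : 'I_n -> Hbar, v = \sum_j h j *: gM (delta_mx 0 j).
Proof.
exists (fun j => (repr v) 0 j); rewrite -[LHS](quotM_repr v) [X in gM X]row_sum_delta.
by rewrite raddf_sum; apply: eq_bigr => j _; exact: quotM_scalable.
Qed.

Definition acts_by (L : lmodType Hbar) (z : Z zeta) (b : C) := forall v : L,
  Hbar_pi (val z) *: v = Hbar_pi (Hconst zeta b%:P) *: v.

Lemma Hbar_pi_central (z : Z zeta) (h : Hbar) : Hbar_pi (val z) * h = h * Hbar_pi (val z).
Proof.
have [k ->] := Hbar_pi_surj h.
by rewrite -!Hbar_piM; congr Hbar_pi; apply/center_predP; exact: valP.
Qed.

Lemma acts_by_const L p : acts_by L (Zconst zeta p) p.[c 0].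
Proof. by move=> v /=; rewrite (Hbar_pi_const p 0). Qed.

Lemma acts_byD L z z' b b' : acts_by L z b -> acts_by L z' b' ->
  acts_by L (z + z') (b + b').
Proof.
move=> zb zb' v; rewrite rmorphD polyCD (rmorphD (Hconst zeta)) !Hbar_piD !scalerDl.
by rewrite zb zb'.
Qed.

Lemma acts_byM L z z' b b' : acts_by L z b -> acts_by L z' b' ->
  acts_by L (z * z') (b * b').
Proof.
move=> zb zb' v; rewrite rmorphM polyCM (rmorphM (Hconst zeta)) !Hbar_piM -!scalerA.
by rewrite zb' zb.
Qed.

Lemma acts_byN L z b : acts_by L z b -> acts_by L (- z) (- b).
Proof.
move=> zb v; rewrite rmorphN polyCN (rmorphN (Hconst zeta)) !Hbar_piN !scaleNr.
by rewrite zb.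
Qed.

Lemma acts_by0 L z : Hbar_pi (val z) = 0 -> acts_by L z 0.
Proof. by move=> z0 v; rewrite z0 polyC0 (rmorph0 (Hconst zeta)) Hbar_pi0. Qed.

Lemma acts_by_uniq (L : lmodType Hbar) (v : L) z b b' : v != 0 ->
  acts_by L z b -> acts_by L z b' -> b = b'.
Proof.
move=> v0 zb zb'; apply/eqP; rewrite -subr_eq0; apply: contraNT v0 => bb'.
have E : Hbar_pi (Hconst zeta (b - b')%:P) *: v = 0.
  rewrite polyCB (rmorphB (Hconst zeta)) Hbar_piD Hbar_piN scalerDl scaleNr.
  by rewrite -zb -zb' subrr.
have := congr1 (fun u => Hbar_pi (Hconst zeta (b - b')^-1%:P) *: u) E.
rewrite scalerA -Hbar_piM -(rmorphM (Hconst zeta)) -polyCM mulVf //.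
by rewrite polyC1 (rmorph1 (Hconst zeta)) Hbar_pi1 scale1r scaler0 => ->.
Qed.

Section Quotient.
Variables (L : lmodType Hbar) (f : {linear M -> L}).
Hypothesis fL : simple_quotient f.

Let acts_by_gen z b : (forall j, Hbar_pi (val z) *: gM (delta_mx 0 j) =
  Hbar_pi (Hconst zeta b%:P) *: gM (delta_mx 0 j)) -> acts_by L z b.
Proof.
move=> zb v; have [u <-] := fL.2 v; rewrite -!linearZ; congr (f _).
have [h ->] := baby_verma_span u; rewrite !scaler_sumr; apply: eq_bigr => j _.
have bh : Hbar_pi (Hconst zeta b%:P) * h j = h j * Hbar_pi (Hconst zeta b%:P).
  exact: (Hbar_pi_central (Zconst zeta b%:P)).
by rewrite !scalerA Hbar_pi_central bh -!scalerA zb.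
Qed.

(** On the generating copy of the representation [x] and [y] act by 0 and the sum of the reflections
    by [lam]; centrality carries the scalar to the whole quotient. *)
Lemma acts_by_eu : acts_by L (z_eu zetaP) (- (c 0 * lam)).
Proof.
apply: acts_by_gen => j; rewrite /= /h_eu !(Hbar_piD, Hbar_piN, Hbar_piM).
rewrite scalerDl scaleNr scalerDl -!scalerA !gM_V !scaler0 add0r add0r.
rewrite (Hbar_pi_const 'X 0) hornerX polyCN (rmorphN (Hconst zeta)) Hbar_piN scaleNr.
congr (- _); rewrite polyCM (rmorphM (Hconst zeta)) Hbar_piM -scalerA; congr (_ *: _).
rewrite (big_morph Hbar_pi Hbar_piD Hbar_pi0) scaler_suml.
under eq_bigr do rewrite baby_verma_actW; rewrite exchange_big /=.
have E k : \sum_(i < 3) Hbar_pi (Hconst zeta (rho (reflW zeta i) k j)%:P) *: gM (delta_mx 0 k)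
    = Hbar_pi (Hconst zeta (if k == j then lam else 0)%:P) *: gM (delta_mx 0 k).
  rewrite -scaler_suml -(big_morph Hbar_pi Hbar_piD Hbar_pi0) -(rmorph_sum (Hconst zeta)).
  rewrite -rmorph_sum -summxE rho_sum mxE.
  by congr (Hbar_pi (Hconst zeta _%:P) *: _); case: (k == j).
rewrite (eq_bigr _ (fun k _ => E k)) (bigD1 j) //= eqxx big1 ?addr0 // => k /negPf ->.
by rewrite polyC0 (rmorph0 (Hconst zeta)) Hbar_pi0 scale0r.
Qed.

(* If [z] acts by a nonzero endomorphism of a simple module, that endomorphism
   is surjective, hence not nilpotent. *)
Lemma acts_by_nilpotent z : acts_by L (z ^+ 2) 0 -> acts_by L z 0.
Proof.
move=> zz; have zz0 (v : L) : Hbar_pi (val z) *: (Hbar_pi (val z) *: v) = 0.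
  have := zz v; rewrite polyC0 (rmorph0 (Hconst zeta)) Hbar_pi0 scale0r => <-.
  by rewrite scalerA -Hbar_piM; congr (Hbar_pi _ *: _).
have [[v0 v0N] simp] := fL.1.
pose P : {pred L} := fun v => `[< exists w, v = Hbar_pi (val z) *: w >].
have Psub : GRing.submod_closed P.
  split; first by apply/asboolP; exists 0; rewrite scaler0.
  move=> a u v /asboolP[u' ->] /asboolP[v' ->]; apply/asboolP.
  by exists (a *: u' + v'); rewrite scalerDr !scalerA Hbar_pi_central.
have [P0|PT] := simp P Psub.
  move=> v; rewrite polyC0 (rmorph0 (Hconst zeta)) Hbar_pi0 scale0r.
  by apply: P0; apply/asboolP; exists v.
have /asboolP[w Ew] := PT v0; have /asboolP[w' Ew'] := PT w.
by rewrite Ew Ew' zz0 eqxx in v0N.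
Qed.

End Quotient.

Let linear_subst_inv (M : 'M[C]_2) : inW zeta M ->
  linear_subst M ('X_0 * 'X_1) = 'X_0 * 'X_1 /\
  linear_subst M ('X_0 ^+ 3 + 'X_1 ^+ 3) = 'X_0 ^+ 3 + 'X_1 ^+ 3.
Proof.
have zi3 i : (zeta ^- i) ^+ 3 = 1 by rewrite exprVn (zetaX3 zetaP) invr1.
have zi i : zeta ^+ i * zeta ^- i = 1 by rewrite mulfV // expf_neq0 // (zeta_neq0 zetaP).
have XE k : linear_subst M 'X_k = M k 0 *: 'X_0 + M k 1 *: 'X_1.
  rewrite /linear_subst /comp_mpoly mmapX mmap1U tnth_mktuple.
  by rewrite !big_ord_recl big_ord0 addr0; congr (M _ _ *: 'X__ + M _ _ *: 'X__); apply: val_inj.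
have ME : linear_subst M ('X_0 * 'X_1) = linear_subst M 'X_0 * linear_subst M 'X_1.
  exact: rmorphM.
have CE : linear_subst M ('X_0 ^+ 3 + 'X_1 ^+ 3) =
    linear_subst M 'X_0 ^+ 3 + linear_subst M 'X_1 ^+ 3.
  by rewrite /linear_subst rmorphD !rmorphXn.
move=> /(inW_shape zetaP) [[i E]|[i E]]; rewrite ME CE !XE E !mxE /= !scale0r ?addr0 ?add0r.
  by rewrite -scalerAl -scalerAr scalerA zi scale1r !exprZn (zetaX3 zetaP) zi3 !scale1r.
by rewrite -scalerAl -scalerAr scalerA zi scale1r !exprZn (zetaX3 zetaP) zi3 !scale1r mulrC addrC.
Qed.

Let inW_tr w : inW zeta w -> inW zeta w^T.
Proof.
move=> /(inW_shape zetaP) [[i ->]|[i ->]].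
  have -> : (@rot C zeta i)^T = @rot C zeta i; last exact: inW_rot.
  by apply/matrixP => k l; rewrite !mxE eq_sym; case: eqP => // ->.
have -> : (refl zeta i)^T = refl zeta (2 * i); last exact: (inW_reflN zetaP).
apply/matrixP => k l; rewrite !mxE !(zetaVX zetaP) (zetaXX zetaP).
by case: (ord2 k) => ->; case: (ord2 l) => ->.
Qed.

Let inv_CV (p : {mpoly C[2]}) : (forall M, inW zeta M -> linear_subst M p = p) ->
  invariant_CV zeta p /\ invariant_CVd zeta p.
Proof.
move=> ip; split=> w; apply: ip; first exact: inW_V (inW_val w).
exact: inW_tr (inW_val w).
Qed.

Let mmap2 (R : nzRingType) (g : C -> R) (h : 'I_2 -> R) (p : {mpoly C[2]}) :
  mpoly.mmap g h p = \sum_(m <- msupp p) g p@_m * (h 0 ^+ m 0 * h 1 ^+ m 1).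
Proof.
apply: eq_bigr => m _; congr (_ * _); rewrite /mmap1 !big_ord_recl big_ord0 mulr1.
by congr (h _ ^+ m _ * h _ ^+ m _); apply: val_inj.
Qed.

Let XX : 'X_0 * 'X_1 = 'X_[U_(0) + U_(1)] :> {mpoly C[2]}.
Proof. by rewrite mpolyXD. Qed.

Let mmapq (g : {additive C -> H}) (h : 'I_2 -> H) : g 1 = 1 ->
  mpoly.mmap g h ('X_0 * 'X_1) = h 0 * h 1 /\
  mpoly.mmap g h ('X_0 ^+ 3 + 'X_1 ^+ 3) = h 0 ^+ 3 + h 1 ^+ 3.
Proof.
move=> g1; have mX m : mpoly.mmap g h 'X_[m] = h 0 ^+ m 0 * h 1 ^+ m 1.
  by rewrite mmap2 msuppX big_seq1 mcoeffX eqxx g1 mul1r.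
split; first by rewrite XX mX !mnmDE !mnm1E /= !expr1.
rewrite (raddfD (mpoly.mmap g h)) /= !mpolyXn !mX !mulmnE !mnm1E /=.
by rewrite ?muln1 ?mul1n ?muln0 ?mul0n ?expr0 ?mul1r ?mulr1.
Qed.

Let Hbar_coinv : Hbar_pi (Hx zeta * Hy zeta) = 0 /\ Hbar_pi (HX zeta * HY zeta) = 0 /\
  Hbar_pi (@h_r C zeta) = 0 /\ Hbar_pi (@h_R C zeta) = 0.
Proof.
pose g : {additive C -> H} := Hconst zeta \o polyC.
have g1 : g 1 = 1 by rewrite /g /= polyC1 (rmorph1 (Hconst zeta)).
have [i1 i2] := inv_CV (fun M MW => (linear_subst_inv MW).1).
have [i3 i4] := inv_CV (fun M MW => (linear_subst_inv MW).2).
have q0 : ('X_0 * 'X_1 : {mpoly C[2]})@_0 = 0.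
  rewrite XX mcoeffX; case: eqP => // /mnmP/(_ 0); rewrite mnmDE !mnm1E mnm0E.
  by [].
have r0 : ('X_0 ^+ 3 + 'X_1 ^+ 3 : {mpoly C[2]})@_0 = 0.
  rewrite mcoeffD !mpolyXn !mcoeffX; case: eqP => [/mnmP/(_ 0)|_].
    by rewrite mulmnE mnm1E mnm0E.
  by case: eqP => [/mnmP/(_ 1)|_]; rewrite ?addr0 // mulmnE mnm1E mnm0E.
have [EQ ER] := mmapq (fun k => HVd zeta (delta_mx 0 k)) g1.
have [Eq Er] := mmapq (fun k => HV zeta (delta_mx k 0)) g1.
split; [|split; [|split]]; rewrite /Hbar_pi; apply/quotR_eq0/ideal2_gen.
- by right; exists ('X_0 * 'X_1); split=> //; congr Hc_pi; exact/esym/Eq.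
- by left; exists ('X_0 * 'X_1); split=> //; congr Hc_pi; exact/esym/EQ.
- by right; exists ('X_0 ^+ 3 + 'X_1 ^+ 3); split=> //; congr Hc_pi; exact/esym/Er.
- by left; exists ('X_0 ^+ 3 + 'X_1 ^+ 3); split=> //; congr Hc_pi; exact/esym/ER.
Qed.

Let acts (z : Z zeta) (b : C) := forall (L : lmodType Hbar) (f : {linear M -> L}),
  simple_quotient f -> acts_by L z b.

Lemma acts_generators :
  [/\ acts (Defs.q zetaP) 0, acts (Defs.Q zetaP) 0 & acts (z_eu zetaP) (- (c 0 * lam))] /\
  [/\ acts (z_r zetaP) 0, acts (z_R zetaP) 0, acts (z_u zetaP) 0 & acts (z_U zetaP) 0].
Proof.
have [q0 [Q0 [r0 R0]]] := Hbar_coinv.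
have aq : acts (Defs.q zetaP) 0 by move=> L f _; exact: acts_by0.
have aQ : acts (Defs.Q zetaP) 0 by move=> L f _; exact: acts_by0.
have ar : acts (z_r zetaP) 0 by move=> L f _; exact: acts_by0.
have aR : acts (z_R zetaP) 0 by move=> L f _; exact: acts_by0.
(* Instances: [rel_q] gives [u^2 = r U - q G] and [rel_Q] gives [U^2 = R u - Q G]. *)
have nilp (z w v g k : Z zeta) : w * g = v * k - z ^+ 2 ->
    Hbar_pi (val w) = 0 -> Hbar_pi (val v) = 0 -> acts z 0.
  move=> E w0 v0 L f fL; apply: (acts_by_nilpotent fL); apply: acts_by0.
  have -> : z ^+ 2 = v * k - w * g by rewrite E opprB addrC subrK.
  by rewrite rmorphB !rmorphM Hbar_piD Hbar_piN [Hbar_pi (val v * _)]Hbar_piM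
    [Hbar_pi (val w * _)]Hbar_piM w0 v0 !mul0r subrr.
split; split=> //; first by move=> L f; exact: acts_by_eu.
  by apply: nilp (rel_q zetaP) _ _.
by apply: nilp (rel_Q zetaP) _ _.
Qed.

Lemma acts_ex z : exists b, acts z b.
Proof.
have [[aq aQ ae] [ar aR au aU]] := acts_generators.
elim: {z}(generated_all zetaP z); do ?[by exists 0 | by eexists; exact: ae].
- by move=> p; exists p.[c 0] => L f _; exact: acts_by_const.
- move=> z z' _ [b zb] _ [b' zb']; exists (b + b') => L f fL.
  by apply: acts_byD; [exact: zb fL|exact: zb' fL].
- move=> z z' _ [b zb] _ [b' zb']; exists (b * b') => L f fL.
  by apply: acts_byM; [exact: zb fL|exact: zb' fL].
Qed.

(** The scalars in [acts] are shown to serve all simple quotients at once, and a single nonzero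
    quotient makes them unique. Uniqueness turns the choice of scalars into a ring morphism, which
    factors through [Zc]. *)
Lemma zpoint_ex : (exists (L : lmodType Hbar) (f : {linear M -> L}), simple_quotient f) ->
  exists p : Zc zeta c -> C, is_zpoint rho p /\
    [/\ p (Zc_pi c (Defs.q zetaP)) = 0, p (Zc_pi c (Defs.Q zetaP)) = 0
      & p (Zc_pi c (eu zeta)) = - (c 0 * lam)] /\
    [/\ p (Zc_pi c (z_r zetaP)) = 0, p (Zc_pi c (z_R zetaP)) = 0,
      p (Zc_pi c (z_u zetaP)) = 0 & p (Zc_pi c (z_U zetaP)) = 0].
Proof.
move=> exL; have [L0 [f0 fL0]] := exL.
have [[v0 v0N] _] := fL0.1.
pose chi z := projT1 (cid (acts_ex z)).
have chiP z : acts z (chi z) := projT2 (cid (acts_ex z)).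
have chi_eq z b : acts z b -> chi z = b.
  by move=> zb; apply: (acts_by_uniq v0N); [exact: chiP fL0|exact: zb fL0].
have chiB : zmod_morphism chi.
  move=> z z'; apply: chi_eq => L f fL.
  by apply: acts_byD; [exact: chiP fL|apply: acts_byN; exact: chiP fL].
have chiM : monoid_morphism chi.
  split; last by move=> z z'; apply: chi_eq => L f fL; apply: acts_byM; exact: chiP fL.
  rewrite -(rmorph1 (Zconst zeta)); apply: chi_eq => L f fL.
  by rewrite -[X in acts_by _ _ X](hornerC 1 (c 0)); exact: acts_by_const.
have chi_const p : chi (Zconst zeta p) = p.[c 0].
  by apply: chi_eq => L f fL; exact: acts_by_const.
pose chim : {rmorphism Z zeta -> C} := HB.pack chi
  (GRing.isZmodMorphism.Build _ _ chi chiB) (GRing.isMonoidMorphism.Build _ _ chi chiM).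
have chi_c z : (exists i, z = Zconst zeta ('X - (c i)%:P)) -> chim z = 0.
  by move=> [i ->]; rewrite [LHS]chi_const !hornerE c_const subrr.
pose p : {rmorphism Zc zeta c -> C} := quotR_liftM chi_c.
have pE z : p (Zc_pi c z) = chi z by exact: quotR_liftME.
have [[aq aQ ae] [ar aR au aU]] := acts_generators.
exists p; split; last by rewrite !pE euE //; split; split; exact: chi_eq.
split=> //.
  split=> [z z'||a]; [exact: rmorphB| |by rewrite pE chi_const hornerC].
  by split; [exact: rmorph1|move=> z z'; exact: rmorphM].
by move=> L f fL z v; rewrite pE; exact: chiP fL _.
Qed.

End ZPoint.
End BabyVerma.

(** * The points of the irreducible characters and the action of mu_2 *)

Section Specialization.
Context {C : numClosedFieldType} {zeta : C}.
Hypothesis zetaP : 3.-primitive_root zeta.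
Variable c : 'I_3 -> C.

(** The rotation [rot i] conjugates [s_i] into [s_0]: both products are [refl zeta (2 * i)]. *)
Lemma class_function_const : class_function zeta c -> forall i, c i = c 0.
Proof.
move=> cf i; apply: (cf (toW (inW_rot zetaP i))).
by rewrite /= (rot_refl zetaP) (refl_rot zetaP) add0n mul2n addnn.
Qed.

Hypothesis c_const : forall i, c i = c 0.

Local Notation odd0 p := [/\ p (Zc_pi c (z_r zetaP)) = 0, p (Zc_pi c (z_R zetaP)) = 0,
  p (Zc_pi c (z_u zetaP)) = 0 & p (Zc_pi c (z_U zetaP)) = 0].

Let col6_neq0 (c0 c1 c2 c3 c4 c5 : C) : (c0 != 0) || (c1 != 0) ->
  col6 c0 c1 c2 c3 c4 c5 != 0.
Proof.
move=> h; apply/eqP => /matrixP E; move: (E 0 0) (E 1 0); rewrite !mxE /= => h0 h1.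
by move: h; rewrite h0 h1 eqxx.
Qed.

Lemma zpoint_triv : exists p, is_zpoint (c := c) (rho_triv zeta) p /\
  [/\ p (Zc_pi c (q zetaP)) = 0, p (Zc_pi c (Q zetaP)) = 0
    & p (Zc_pi c (eu zeta)) = - (c 0 * 3)] /\ odd0 p.
Proof.
apply: zpoint_ex => //; first by rewrite /rho_triv sumr_const card_ord -raddfMn.
apply: (@exists_simple_quotient _ _ (quotM _ (delta_mx 0 0))).
  apply: (@baby_verma_neq0 _ _ zetaP c (verma_chart zetaP false (c 0))
    _ _ _ _ (@verma_vec C)).
  - by move=> i p; rewrite verma_chart_const c_const.
  - exact: verma_chart_coinvariant.
  - exact: verma_vec_V.
  - by move=> w j; rewrite verma_vec_W big_ord1 /rho_triv (ord1 j) mxE.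
  - by apply: col6_neq0; rewrite oner_eq0.
by move=> v; have [h ->] := baby_verma_span v; exists (h 0); rewrite big_ord1.
Qed.

Lemma zpoint_det : exists p, is_zpoint (c := c) (rho_det zeta) p /\
  [/\ p (Zc_pi c (q zetaP)) = 0, p (Zc_pi c (Q zetaP)) = 0
    & p (Zc_pi c (eu zeta)) = - (c 0 * - 3)] /\ odd0 p.
Proof.
apply: zpoint_ex => //.
  rewrite /rho_det; under eq_bigr do rewrite /= (det_refl zetaP).
  by rewrite sumr_const card_ord -raddfMn mulNrn.
apply: (@exists_simple_quotient _ _ (quotM _ (delta_mx 0 0))).
  apply: (@baby_verma_neq0 _ _ zetaP c (verma_chart zetaP true (c 0))
    _ _ _ _ (@verma_vec C)).
  - by move=> i p; rewrite verma_chart_const c_const.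
  - exact: verma_chart_coinvariant.
  - exact: verma_vec_V.
  - by move=> w j; rewrite verma_vec_W big_ord1 /rho_det (ord1 j) mxE.
  - by apply: col6_neq0; rewrite oner_eq0.
by move=> v; have [h ->] := baby_verma_span v; exists (h 0); rewrite big_ord1.
Qed.

Lemma zpoint_nat : exists p, is_zpoint (c := c) (rho_nat zeta) p /\
  [/\ p (Zc_pi c (q zetaP)) = 0, p (Zc_pi c (Q zetaP)) = 0
    & p (Zc_pi c (eu zeta)) = - (c 0 * 0)] /\ odd0 p.
Proof.
apply: zpoint_ex => //.
  have z2 := zeta_sum zetaP.
  rewrite raddf0 /rho_nat /= !big_ord_recl big_ord0 addr0; apply/matrixP => k l.
  rewrite !mxE /= expr0 invr1 !expr1 (zetaV zetaP) (zetaV2 zetaP).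
  by case: (ord2 k) => ->; case: (ord2 l) => -> /=; ring: z2.
apply: (@exists_simple_quotient _ _ (quotM _ (delta_mx 0 0))).
  apply: (@baby_verma_neq0 _ _ zetaP c (nat_module zetaP (c 0)) _ _ _ _ (@nat_vec C)).
  - by move=> i p; rewrite nat_module_const c_const.
  - exact: nat_module_coinvariant.
  - exact: nat_vec_V.
  - exact: nat_vec_W.
  - by apply: col6_neq0; rewrite oner_eq0.
move=> v; have [h ->] := baby_verma_span v.
(* [s_0] exchanges the two basis vectors of [V], so one of them generates the module. *)
have E : quotM (@baby_verma_rel C zeta c 2 (rho_nat zeta)) (delta_mx 0 1) =
    Hbar_pi c (HW (reflW zeta 0)) *: quotM _ (delta_mx 0 0).
  rewrite baby_verma_actW !big_ord_recl big_ord0 addr0 !mxE /=.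
  rewrite polyC0 (rmorph0 (Hconst zeta)) Hbar_pi0 scale0r add0r expr0 invr1.
  rewrite polyC1 (rmorph1 (Hconst zeta)) Hbar_pi1 scale1r.
  by congr (quotM _ (delta_mx _ _)); apply: val_inj.
exists (h 0 + h 1 * Hbar_pi c (HW (reflW zeta 0))).
rewrite !big_ord_recl big_ord0 addr0 scalerDl -scalerA -E.
by congr (h _ *: _ + h _ *: quotM _ (delta_mx _ _)); apply: val_inj.
Qed.

End Specialization.

(** * Parity of the generators under [mu_2] *)

Section FixedPoints.
Context {C : numClosedFieldType} {zeta : C}.
Hypothesis zetaP : 3.-primitive_root zeta.

Local Notation Z := (Z zeta).
Local Notation H := (H zeta).
Local Notation q := (q zetaP).
Local Notation Q := (Q zetaP).
Local Notation eu := (eu zeta).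
Local Notation F := (fixedZ zeta 2).

Section Act.
Variables (xi : C) (xi0 : xi != 0).
Hypothesis xi2 : xi ^+ 2 = 1.

Let k := Hconst zeta xi%:P.
Let xiV : xi^-1 = xi.
Proof. by apply: (mulfI xi0); rewrite mulfV // -expr2 xi2. Qed.

Let act := act zeta xi0.

Let actx : act (Hx zeta) = k * Hx zeta. Proof. by rewrite [LHS]act_V xiV. Qed.
Let acty : act (Hy zeta) = k * Hy zeta. Proof. by rewrite [LHS]act_V xiV. Qed.
Let actX : act (HX zeta) = k * HX zeta. Proof. exact: act_Vd. Qed.
Let actY : act (HY zeta) = k * HY zeta. Proof. exact: act_Vd. Qed.

Let kk s t : k * s * (k * t) = s * t.
Proof.
rewrite -mulrA [s * _]mulrA -(Hconst_comm xi%:P) -mulrA mulrA.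
by rewrite /k -(rmorphM (Hconst zeta)) -polyCM -expr2 xi2 polyC1 (rmorph1 (Hconst zeta)) mul1r.
Qed.

Let k3 s : (k * s) ^+ 3 = k * s ^+ 3.
Proof. by rewrite !exprS expr0 !mulr1 kk -mulrA. Qed.

Let act_refl c : act (reflsum c) = reflsum c.
Proof.
rewrite /reflsum rmorph_sum; apply: eq_bigr => i _.
by rewrite rmorphM; congr (_ * _); [exact: act_const|exact: act_W].
Qed.

Let actc p : act (Hconst zeta p) = Hconst zeta p. Proof. exact: act_const. Qed.

Let valZ_act (z z' : Z) : act (val z) = val z' -> actZ xi0 z = z'.
Proof. by move=> E; apply: val_inj. Qed.

Lemma actZ_q : actZ xi0 q = q.
Proof. by apply: valZ_act; rewrite [LHS](rmorphM act) actx acty kk. Qed.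

Lemma actZ_Q : actZ xi0 Q = Q.
Proof. by apply: valZ_act; rewrite [LHS](rmorphM act) actX actY kk. Qed.

Lemma actZ_eu : actZ xi0 (z_eu zetaP) = z_eu zetaP.
Proof.
apply: valZ_act; rewrite [LHS](rmorphB act) (rmorphD act) !(rmorphM act).
rewrite actx acty actX actY !kk actc (rmorph_sum act).
by congr (_ - _ * _); apply: eq_bigr => i _; exact: act_W.
Qed.

Lemma actZ_const p : actZ xi0 (Zconst zeta p) = Zconst zeta p.
Proof. by apply: valZ_act; exact: actc. Qed.

Let val_kM (z : Z) : val (Zconst zeta xi%:P * z) = k * val z.
Proof. by []. Qed.

Lemma actZ_r : actZ xi0 (z_r zetaP) = Zconst zeta xi%:P * z_r zetaP.
Proof.
apply: valZ_act; rewrite val_kM [LHS](rmorphD act) !(rmorphXn act) actx acty !k3.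
by rewrite -mulrDr.
Qed.

Lemma actZ_R : actZ xi0 (z_R zetaP) = Zconst zeta xi%:P * z_R zetaP.
Proof.
apply: valZ_act; rewrite val_kM [LHS](rmorphD act) !(rmorphXn act) actX actY !k3.
by rewrite -mulrDr.
Qed.

Let kC (s t : H) : s * (k * t) = k * (s * t).
Proof. by rewrite mulrA -Hconst_comm mulrA. Qed.

Let k2 (s : H) : (k * s) ^+ 2 = s ^+ 2.
Proof. by rewrite !expr2 kk. Qed.

Lemma actZ_u : actZ xi0 (z_u zetaP) = Zconst zeta xi%:P * z_u zetaP.
Proof.
apply: valZ_act; rewrite val_kM [LHS](rmorphD act) (rmorphD act) !(rmorphM act).
rewrite (rmorphD act) !(rmorphM act) actx acty actX actY actc !act_refl.
rewrite !kk !kC -!(mulrA k) -!mulrDr kC -mulrDr.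
by [].
Qed.

Lemma actZ_U : actZ xi0 (z_U zetaP) = Zconst zeta xi%:P * z_U zetaP.
Proof.
apply: valZ_act; rewrite val_kM [LHS](rmorphD act) (rmorphD act) !(rmorphM act).
rewrite (rmorphD act) !(rmorphM act) actx acty actX actY actc !act_refl.
rewrite !kk !kC -!(mulrA k) -!mulrDr kC -mulrDr.
by [].
Qed.

End Act.
End FixedPoints.

(** * The presentation *)

Lemma points_morph (C : fieldType) (S : pzRingType) (j : C -> S) p :
  points j p -> exists f : {rmorphism S -> C}, p = f /\ forall a, f (j a) = a.
Proof.
move=> [pB pM pj].
pose f : {rmorphism S -> C} := HB.pack p
  (GRing.isZmodMorphism.Build _ _ p pB) (GRing.isMonoidMorphism.Build _ _ p pM).
by exists f.
Qed.

Lemma morph_points (C : fieldType) (S : pzRingType) (j : C -> S) (f : {rmorphism S -> C}) :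
  (forall a, f (j a) = a) -> points j f.
Proof.
move=> fj; split=> // [x y|]; first exact: rmorphB.
by split; [exact: rmorph1|move=> x y; exact: rmorphM].
Qed.

Lemma mpoly_gen_ind (R : nzRingType) n (K : {mpoly R[n]} -> Prop) :
  (forall a, K a%:MP) -> (forall P P', K P -> K P' -> K (P + P')) ->
  (forall P i, K P -> K (P * 'X_i)) -> forall P, K P.
Proof.
move=> KC KD KX; elim/mpolyind => [|a m P _ _ KP]; first by rewrite -mpolyC0; exact: KC.
apply: KD => //; rewrite -mul_mpolyC mpolyXE_id.
elim: (index_enum _) a%:MP (KC a) => [|i r IH] P' KP'; first by rewrite big_nil mulr1.
rewrite big_cons mulrA; apply: IH.
elim: (m i) => [|k IHk]; first by rewrite expr0 mulr1.
by rewrite exprSr mulrA; exact: KX.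
Qed.

Section Presentation.
Variable C : numClosedFieldType.

Local Notation P3 := {mpoly {poly C}[3]}.
Local Notation Xq := ('X_(@Ordinal 3 0 isT) : P3).
Local Notation XQ := ('X_(@Ordinal 3 1 isT) : P3).
Local Notation Xe := ('X_(@Ordinal 3 2 isT) : P3).
Local Notation XA := ('X%:MP : P3).
Local Notation G := (Xe ^+ 2 - 9%:R * XA ^+ 2 - 4%:R * Xq * XQ).

Definition vec3 (a b d : C) (i : 'I_3) : C := nth 0 [:: a; b; d] i.

Lemma vec3E (v : 'I_3 -> C) : v =1 vec3 (v 0) (v 1) (v (@Ordinal 3 2 isT)).
Proof.
by move=> [[|[|[|]]] // h]; rewrite /vec3 /=; congr v; apply: val_inj.
Qed.

(** Freeness from [eu] is stated through values: polynomials are tested by evaluation below, at two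
    opposite values of [eu]. *)
Definition eu_free (S : P3) : Prop :=
  forall A a b d d', pev A (vec3 a b d) S = pev A (vec3 a b d') S.

Lemma eu_division (P : P3) : exists P' S0 S1,
  [/\ P = G * P' + S0 + S1 * Xe, eu_free S0 & eu_free S1].
Proof.
elim/mpoly_gen_ind: P => [a|P P'|P i].
- exists 0, a%:MP, 0; split; first by rewrite mulr0 mul0r add0r addr0.
    by move=> A x y d d'; rewrite !pevC.
  by move=> A x y d d'; rewrite !rmorph0.
- move=> [K [S0 [S1 [-> f0 f1]]]] [K' [S0' [S1' [-> f0' f1']]]].
  exists (K + K'), (S0 + S0'), (S1 + S1'); split; first by ring.
    by move=> A x y d d'; rewrite !rmorphD /= (f0 _ _ _ _ d') (f0' _ _ _ _ d').
  by move=> A x y d d'; rewrite !rmorphD /= (f1 _ _ _ _ d') (f1' _ _ _ _ d').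
- move=> [K [S0 [S1 [-> f0 f1]]]].
  have [i2|[i2 fi]] : i = @Ordinal 3 2 isT \/ i <> @Ordinal 3 2 isT /\ eu_free ('X_i).
  + case: i => [[|[|[|]]] // h]; [right|right|left; exact: val_inj].
      by split=> [//|A x y d d']; rewrite !pevX.
    by split=> [//|A x y d d']; rewrite !pevX.
  (* [S1 * Xe * Xe] is reduced by replacing [Xe ^+ 2] with [G + 9 A^2 + 4 q Q]. *)
  + exists (K * Xe + S1), (S1 * (9%:R * XA ^+ 2 + 4%:R * Xq * XQ)), S0; rewrite i2.
    split=> //; first by ring.
    move=> A x y d d'; rewrite [LHS]rmorphM [RHS]rmorphM (f1 _ _ _ _ d'); congr (_ * _).
    by rewrite !(rmorphD, rmorphM, rmorphXn, rmorph_nat) /= !pevC !pevX.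
  + exists (K * 'X_i), (S0 * 'X_i), (S1 * 'X_i); split; first by ring.
      by move=> A x y d d'; rewrite !rmorphM /= (f0 _ _ _ _ d') (fi _ _ _ _ d').
    by move=> A x y d d'; rewrite !rmorphM /= (f1 _ _ _ _ d') (fi _ _ _ _ d').
Qed.

Lemma const_division (P : P3) : exists a P0 P1 P2,
  P = a%:MP + Xq * P0 + XQ * P1 + Xe * P2.
Proof.
elim/mpoly_gen_ind: P => [a|P P'|P i].
- by exists a, 0, 0, 0; ring.
- move=> [a [P0 [P1 [P2 ->]]]] [a' [P0' [P1' [P2' ->]]]].
  by exists (a + a'), (P0 + P0'), (P1 + P1'), (P2 + P2'); rewrite mpolyCD; ring.
- move=> [a [P0 [P1 [P2 ->]]]]; set K := (X in X * _).
  have : [\/ i = @Ordinal 3 0 isT, i = @Ordinal 3 1 isT | i = @Ordinal 3 2 isT].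
    by case: i => [[|[|[|]]] // h];
      [apply: Or31|apply: Or32|apply: Or33]; apply: val_inj.
  by case=> ->; exists 0; rewrite mpolyC0; [exists K, 0, 0|exists 0, K, 0|exists 0, 0, K]; ring.
Qed.

Lemma pev_rel A a b d :
  pev A (vec3 a b d) G = d ^+ 2 - 9 * A ^+ 2 - 4 * a * b.
Proof.
by rewrite !(rmorphB, rmorphM, rmorphXn, rmorph_nat) /= !pevC !pevX hornerX.
Qed.

(** Above each [(A, q, Q)] with [Q != 0] the surface has the points [eu = e] and [eu = - e]. Hence
    the remainder [S0 + S1 eu] satisfies [S0 = 0] and [e^2 S1 = 0]; cancelling the nonzero
    polynomials [Q] and [9 A^2 + 4 q Q] makes it vanish. *)
Lemma pev_surface (S : P3) :
  (forall A a b d, b != 0 -> d ^+ 2 = 9 * A ^+ 2 + 4 * a * b -> pev A (vec3 a b d) S = 0) ->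
  exists P', S = G * P'.
Proof.
have [P' [S0 [S1 [-> f0 f1]]]] := eu_division S => SV.
have key A a b d : b != 0 -> pev A (vec3 a b d) S0 = 0 /\
    (9 * A ^+ 2 + 4 * a * b) * pev A (vec3 a b d) S1 = 0.
  move=> bN; pose e := sqrtC (9 * A ^+ 2 + 4 * a * b).
  have e2 : e ^+ 2 = 9 * A ^+ 2 + 4 * a * b by exact: sqrtCK.
  clearbody e.
  have E (d' : C) : d' ^+ 2 = 9 * A ^+ 2 + 4 * a * b ->
      pev A (vec3 a b d) S0 + pev A (vec3 a b d) S1 * d' = 0.
    move=> d2; rewrite -(SV A a b d') //.
    rewrite (f0 _ _ _ _ d') (f1 _ _ _ _ d') !(rmorphD (pev _ _)) (rmorphM (pev _ _) (_ - _)).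
    by rewrite (rmorphM (pev _ _) S1) /= pev_rel pevX d2 /vec3 /=; ring.
  have E1 := E e e2; have E2 := E (- e); rewrite sqrrN in E2; have {}E2 := E2 e2.
  have S00 : pev A (vec3 a b d) S0 = 0.
    have two0 : (2 : C) != 0 by rewrite pnatr_eq0.
    apply: (mulfI two0); rewrite mulr0; move: E1 E2.
    move: (pev _ _ S0) (pev _ _ S1) => s0 s1 E1 E2.
    have -> : 2 * s0 = s0 + s1 * e + (s0 + s1 * - e) by ring.
    by rewrite E1 E2 addr0.
  split=> //; move: E1; rewrite S00 add0r => S10.
  by rewrite -e2 expr2 -mulrA [e * pev _ _ _]mulrC S10 mulr0.
have pev3 A v (T : P3) : pev A v T = pev A (vec3 (v 0) (v 1) (v (@Ordinal 3 2 isT))) T.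
  by congr (mmap _ _ _); apply/funext; exact: vec3E.
have XQ0 : XQ != 0.
  apply/eqP => /(congr1 (pev 0 (fun=> 1))); rewrite pevX rmorph0 => /eqP.
  by rewrite oner_eq0.
have E0 : S0 = 0.
  apply: (mulfI XQ0); rewrite mulr0; apply: pev_eq0 => A v; rewrite pev3 rmorphM /= pevX.
  have [b0|/key h] := eqVneq (v 1) 0; first by rewrite {1}/vec3 /= b0 mul0r.
  by rewrite (h A (v 0) _).1 mulr0.
have E1 : S1 = 0.
  pose K := 9%:R * XA ^+ 2 + 4%:R * Xq * XQ.
  have EK A v : pev A v K = 9 * A ^+ 2 + 4 * v 0 * v 1.
    rewrite [LHS]rmorphD !(rmorphM, rmorphXn, rmorph_nat) /= !pevC !pevX hornerX.
    by congr (_ + 4 * v _ * v _); apply: val_inj.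
  have K0 : K != 0.
    apply/eqP => /(congr1 (pev 1 (fun=> 0))); rewrite EK rmorph0 => /eqP.
    by rewrite expr1n mulr1 !mulr0 addr0 pnatr_eq0.
  apply: (mulfI XQ0); apply: (mulfI K0); rewrite !mulr0; apply: pev_eq0 => A v.
  rewrite pev3 !rmorphM /= pevX EK.
  have [b0|/key h] := eqVneq (v 1) 0; first by rewrite {2}/vec3 /= b0 mul0r mulr0.
  by rewrite mulrCA (h A (v 0) _).2 mulr0.
by exists P'; rewrite E0 E1 mul0r !addr0.
Qed.

(** The constant term is a polynomial in [A] that vanishes for [A != 0]; multiplied by [A] it
    vanishes everywhere. *)
Lemma pev_origin (P : P3) : (forall A, A != 0 -> pev A (vec3 0 0 0) P = 0) ->
  exists P0 P1 P2, P = Xq * P0 + XQ * P1 + Xe * P2.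
Proof.
have [a [P0 [P1 [P2 ->]]]] := const_division P => PV.
suff a0 : a = 0 by exists P0, P1, P2; rewrite a0 mpolyC0 add0r.
have XN : ('X : {poly C}) != 0 by rewrite polyX_eq0.
apply: (mulfI XN); rewrite mulr0; apply: poly_eq0_horner => A.
rewrite hornerM hornerX; have [->|A0] := eqVneq A 0; first by rewrite mul0r.
have := PV A A0; rewrite !rmorphD !rmorphM /= pevC !pevX /vec3 /= !mul0r !addr0 => ->.
by rewrite mulr0.
Qed.

End Presentation.

Section FixedPointsZ.
Context {C : numClosedFieldType} {zeta : C}.
Hypothesis zetaP : 3.-primitive_root zeta.

Local Notation Z := (Z zeta).
Local Notation q := (q zetaP).
Local Notation Q := (Q zetaP).
Local Notation F := (fixedZ zeta 2).

Definition odd0 (p : Z -> C) : Prop :=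
  [/\ p (z_r zetaP) = 0, p (z_R zetaP) = 0, p (z_u zetaP) = 0 & p (z_U zetaP) = 0].

Lemma fixedZ2P p : F p <-> points (fun a => Zconst zeta a%:P) p /\ odd0 p.
Proof.
split=> [[pp fp]|[pp o]].
  split=> //; have [f [fE fc]] := points_morph pp; subst p.
  have N0 : (-1 : C) != 0 by rewrite oppr_eq0 oner_eq0.
  have N2 : (-1 : C) ^+ 2 = 1 by rewrite sqrrN expr1n.
  have odd z : actZ N0 z = Zconst zeta (-1)%:P * z -> f z = 0.
    move=> Ez; have := fp _ N0 N2 z; rewrite Ez rmorphM fc mulN1r => /eqP.
    by rewrite eqNr => /eqP.
  by split; apply: odd; [exact: actZ_r|exact: actZ_R|exact: actZ_u|exact: actZ_U].
split=> // xi xi0 xi2; have [f [fE fc]] := points_morph pp; subst p => z.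
have [r0 R0 u0 U0] := o; have actM := rmorphM (act zeta xi0).
elim: {z}(generated_all zetaP z) => [p| | | | | | | |z z' _ IH _ IH'|z z' _ IH _ IH'].
- by rewrite actZ_const.
- by rewrite actZ_q.
- by rewrite actZ_Q.
- by rewrite actZ_eu.
- by rewrite actZ_r // rmorphM r0 mulr0.
- by rewrite actZ_R // rmorphM R0 mulr0.
- by rewrite actZ_u // rmorphM u0 mulr0.
- by rewrite actZ_U // rmorphM U0 mulr0.
- rewrite (_ : actZ xi0 (z + z') = actZ xi0 z + actZ xi0 z') ?rmorphD ?IH ?IH' //.
  by apply: val_inj; exact: rmorphD.
- rewrite (_ : actZ xi0 (z * z') = actZ xi0 z * actZ xi0 z') ?rmorphM ?IH ?IH' //.
  by apply: val_inj; exact: rmorphM.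
Qed.

Lemma morph_const (f : {rmorphism Z -> C}) : (forall a, f (Zconst zeta a%:P) = a) ->
  forall p, f (Zconst zeta p) = p.[f (Zconst zeta 'X)].
Proof.
move=> fc; elim/poly_ind => [|p a IH]; first by rewrite !rmorph0 horner0.
by rewrite rmorphD rmorphM rmorphD rmorphM /= IH fc hornerMXaddC.
Qed.

Definition Zeval : {rmorphism {mpoly {poly C}[3]} -> Z} :=
  mmap (Zconst zeta) (tnth [tuple q; Q; eu zeta]).

Lemma ZevalC a : Zeval a%:MP = Zconst zeta a. Proof. exact: mmapC. Qed.

Lemma ZevalX i : Zeval 'X_i = tnth [tuple q; Q; eu zeta] i.
Proof. by rewrite /Zeval /= mmapX mmap1U. Qed.

Lemma morph_Zeval (f : {rmorphism Z -> C}) : (forall a, f (Zconst zeta a%:P) = a) ->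
  forall P, f (Zeval P) = pev (f (Zconst zeta 'X)) (vec3 (f q) (f Q) (f (eu zeta))) P.
Proof.
move=> fc; elim/mpoly_gen_ind => [a|P P' IH IH'|P i IH].
- by rewrite ZevalC pevC morph_const.
- by rewrite !rmorphD IH IH'.
- rewrite !rmorphM IH /= ZevalX pevX; congr (_ * _).
  by case: i => [[|[|[|]]] // h].
Qed.

Lemma even_part z : exists P, forall f : {rmorphism Z -> C},
  (forall a, f (Zconst zeta a%:P) = a) -> odd0 f -> f z = f (Zeval P).
Proof.
elim: {z}(generated_all zetaP z) => [p| | | | | | | |z z' _ [P EP] _ [P' EP']|z z' _ [P EP] _ [P' EP']].
- by exists p%:MP => f _ _; rewrite ZevalC.
- by exists 'X_(@Ordinal 3 0 isT) => f _ _; rewrite ZevalX.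
- by exists 'X_(@Ordinal 3 1 isT) => f _ _; rewrite ZevalX.
- by exists 'X_(@Ordinal 3 2 isT) => f _ _; rewrite ZevalX -(euE zetaP).
- by exists 0 => f _ [-> _ _ _]; rewrite !rmorph0.
- by exists 0 => f _ [_ -> _ _]; rewrite !rmorph0.
- by exists 0 => f _ [_ _ -> _]; rewrite !rmorph0.
- by exists 0 => f _ [_ _ _ ->]; rewrite !rmorph0.
- by exists (P + P') => f fc fo; rewrite !rmorphD EP // EP'.
- by exists (P * P') => f fc fo; rewrite !rmorphM EP // EP'.
Qed.

Lemma morph_rel (f : {rmorphism Z -> C}) : (forall a, f (Zconst zeta a%:P) = a) -> odd0 f ->
  let A := f (Zconst zeta 'X) in
  let g := f (eu zeta) ^+ 2 - 9 * A ^+ 2 - 4 * f q * f Q in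
  [/\ f q * g = 0, f Q * g = 0 & f (eu zeta) * g = 0].
Proof.
move=> fc [r0 R0 u0 U0] A g; rewrite /g /A (euE zetaP).
have fG : f (z_eu zetaP ^+ 2 - 9 * Zconst zeta 'X ^+ 2 - 4 * q * Q) =
    f (z_eu zetaP) ^+ 2 - 9 * f (Zconst zeta 'X) ^+ 2 - 4 * f q * f Q.
  by rewrite !(rmorphB, rmorphM, rmorphXn, rmorph_nat).
split; rewrite -fG -rmorphM ?rel_q ?rel_Q ?rel_eu rmorphB !(rmorphM, rmorphXn) /=.
- by rewrite r0 u0 ?expr2 !mul0r subrr.
- by rewrite R0 U0 ?expr2 !mul0r subrr.
- by rewrite r0 u0 !mul0r subrr.
Qed.

Definition chart_pt (tw : bool) (A Q a : C) : {rmorphism Z -> C} :=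
  chi zetaP idfun tw A Q 0 a 0.

Lemma chart_pt_const tw A Q a p : chart_pt tw A Q a (Zconst zeta p) = p.[A].
Proof. by rewrite /chart_pt /= chi_const map_poly_id. Qed.

Lemma chart_pt_odd0 tw A Q a : odd0 (chart_pt tw A Q a).
Proof. by split; rewrite /chart_pt /= chi_gens; case: tw; ring. Qed.

Lemma chart_pt_fixed tw A Q a : F (chart_pt tw A Q a).
Proof.
apply/fixedZ2P; split; last exact: chart_pt_odd0.
by apply: morph_points => b; rewrite chart_pt_const hornerC.
Qed.

Lemma chart_pt_q tw A Q a :
  chart_pt tw A Q a q = a ^+ 2 * Q - 3 * (if tw then - A else A) * a.
Proof. by rewrite /chart_pt /= chi_gens; case: tw; ring. Qed.

Lemma chart_pt_Q tw A Q a : chart_pt tw A Q a (Defs.Q zetaP) = Q.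
Proof. by rewrite /chart_pt /= chi_gens. Qed.

Lemma chart_pt_eu tw A Q a :
  chart_pt tw A Q a (eu zeta) = 2 * a * Q - 3 * (if tw then - A else A).
Proof. by rewrite (euE zetaP) /chart_pt /= chi_gens; case: tw; ring. Qed.

Lemma chart_pt_surface A b d e : d != 0 -> e ^+ 2 = 9 * A ^+ 2 + 4 * b * d ->
  exists a, chart_pt false A d a q = b /\ chart_pt false A d a (eu zeta) = e.
Proof.
(* The witness solves [eu = 2 a Q - 3 A] for [a]. *)
move=> d0 Ee; exists ((e + 3 * A) / (2 * d)); rewrite chart_pt_q chart_pt_eu.
have two : (2 : C) != 0 by rewrite pnatr_eq0.
split; last by field; rewrite d0.
have -> : b = (e ^+ 2 - 9 * A ^+ 2) / (4 * d) by rewrite Ee; field; rewrite d0.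
by field; rewrite d0.
Qed.

Lemma const_pi (c : 'I_3 -> C) p :
  Zc_pi c (Zconst zeta p) = Zc_pi c (Zconst zeta (p.[c 0])%:P).
Proof.
have X0 : Zc_pi c (Zconst zeta ('X - (c 0)%:P)) = 0.
  by apply/quotR_eq0/ideal2_gen; exists 0.
have [p' Ep] : exists p', p = p' * ('X - (c 0)%:P) + (p.[c 0])%:P.
  have /factor_theorem[p' Ep] : root (p - (p.[c 0])%:P) (c 0).
    by rewrite /root !hornerE subrr.
  by exists p'; rewrite -Ep subrK.
have -> : Zc_pi c (Zconst zeta p) = Zc_pi c (Zconst zeta p') *
    Zc_pi c (Zconst zeta ('X - (c 0)%:P)) + Zc_pi c (Zconst zeta (p.[c 0])%:P).
  by rewrite {1}Ep (rmorphD (Zconst zeta)) (rmorphM (Zconst zeta))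
    [LHS](rmorphD (Zc_pi c)) (rmorphM (Zc_pi c)).
by rewrite X0 mulr0 add0r.
Qed.

Lemma comp_pi_const (c : 'I_3 -> C) (f : {rmorphism Zc zeta c -> C}) p :
  (forall a, f (Zc_const zeta c a) = a) -> f (Zc_pi c (Zconst zeta p)) = p.[c 0].
Proof. by move=> fc; rewrite const_pi fc. Qed.

(** The point is [z_(chi_1)] for the constant parameter [A], pulled back along [Z -> Zc]. *)
Lemma origin_pt A : exists2 f : {rmorphism Z -> C}, F f &
  [/\ f (Zconst zeta 'X) = A, f q = 0, f Q = 0 & f (eu zeta) = 0].
Proof.
pose c (i : 'I_3) := A.
have [p [[pp _ _] [[pq pQ pe] po]]] := @zpoint_nat C zeta zetaP c (fun=> erefl).
have [f [fE fc]] := points_morph pp; subst p.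
pose g : {rmorphism Z -> C} := f \o Zc_pi c.
have gc p : g (Zconst zeta p) = p.[A] by exact: comp_pi_const.
exists g; last by split=> //; rewrite ?gc ?hornerX // [LHS]pe mulr0 oppr0.
by apply/fixedZ2P; split=> //; apply: morph_points => a; rewrite gc hornerC.
Qed.

Local Notation Xq := ('X_(@Ordinal 3 0 isT) : {mpoly {poly C}[3]}).
Local Notation XQ := ('X_(@Ordinal 3 1 isT) : {mpoly {poly C}[3]}).
Local Notation Xe := ('X_(@Ordinal 3 2 isT) : {mpoly {poly C}[3]}).

Lemma fixedZ_presentation :
   presentation
     (fun a : {poly C} => restrictZ F (Zconst zeta a))
     (tnth [tuple restrictZ F q; restrictZ F Q; restrictZ F (eu zeta)])
     (let A : {mpoly {poly C}[3]} := 'X%:MP in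
      let q := 'X_(@Ordinal 3 0 isT) in
      let Q := 'X_(@Ordinal 3 1 isT) in
      let eu := 'X_(@Ordinal 3 2 isT) in
      [set q * (eu ^+ 2 - 9%:R * A ^+ 2 - 4%:R * q * Q);
           eu * (eu ^+ 2 - 9%:R * A ^+ 2 - 4%:R * q * Q);
           Q * (eu ^+ 2 - 9%:R * A ^+ 2 - 4%:R * q * Q)]).
Proof.
pose res : {rmorphism Z -> functions_on F} := @quotR _ (vanishing F).
have res0 z : res z = 0 <-> forall p, F p -> p z = 0.
  rewrite quotR_eq0; split=> [Iz p Fp|]; last exact: ideal2_gen.
  have [f [fE fc]] := points_morph Fp.1; subst p.
  by apply: (@ideal2_ker _ _ _ f _ _ Iz) => z' /(_ _ Fp).
exists (res \o Zeval); split.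
- by move=> a; rewrite /= ZevalC.
- by move=> i; rewrite /= ZevalX; case: i => [[|[|[|]]] // h].
- move=> b; have [z ->] := quotR_surj b; have [P EP] := even_part z.
  exists P; apply/eqP; rewrite -subr_eq0 -[quotR _ z]/(res z) /= -rmorphB; apply/eqP/res0.
  move=> p /fixedZ2P[pp po]; have [f [fE fc]] := points_morph pp; subst p.
  by rewrite rmorphB (EP f) // subrr.
move=> P; split; last first.
  move=> IP; apply/res0 => p /fixedZ2P[pp po]; have [f [fE fc]] := points_morph pp; subst p.
  have [g1 g2 g3] := morph_rel fc po.
  rewrite morph_Zeval //; apply: (@ideal2_ker _ _ _ (pev _ _) _ _ IP) => x.
  by case=> [[->|->]|->]; rewrite [LHS]rmorphM pev_rel pevX.
move=> /res0 P0; have [P' EP] : exists P', P =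
    (Xe ^+ 2 - 9%:R * 'X%:MP ^+ 2 - 4%:R * Xq * XQ) * P'.
  apply: pev_surface => A b d e d0 Ee; have [a [aq ae]] := chart_pt_surface d0 Ee.
  rewrite -(P0 _ (chart_pt_fixed false A d a)) morph_Zeval; last first.
    by move=> a'; rewrite chart_pt_const hornerC.
  by rewrite aq ae chart_pt_Q chart_pt_const hornerX.
have [P0' [P1 [P2 EP']]] : exists P0 P1 P2, P' = Xq * P0 + XQ * P1 + Xe * P2.
  (* At the origin the surface equation takes the value [- 9 A^2], nonzero for [A != 0], so the
     vanishing of [P] passes to the cofactor [P']. *)
  apply: pev_origin => A A0; have [f /[dup] /fixedZ2P[fc _] Ff [fA fq fQ fe]] := origin_pt A.
  have := P0 _ Ff; rewrite morph_Zeval; last by case: fc.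
  rewrite fA fq fQ fe EP rmorphM /= pev_rel => /eqP; rewrite mulf_eq0 => /orP[|/eqP //].
  rewrite expr0n !mulr0 subr0 sub0r oppr_eq0 mulf_eq0 expf_eq0 (negPf A0) andbF orbF.
  by rewrite pnatr_eq0.
rewrite EP EP'; set G := _ - _.
rewrite (_ : _ * _ = P0' * (Xq * G) + P1 * (XQ * G) + P2 * (Xe * G)); last by ring.
by apply: ideal2D; [apply: ideal2D|]; apply: ideal2Ml; apply: ideal2_gen;
  [left; left|right|left; right].
Qed.

End FixedPointsZ.

(** * Irreducible components *)

Section Varieties.
Variables (C : fieldType) (S : pzRingType) (j : C -> S).

(** Each [z - j (p z)] lies in the kernel of [p], and a point vanishing on all of them agrees with
    [p]. *)
Lemma zclosed_set1 p : points j p -> zclosed j [set p].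
Proof.
move=> pp; exists [set z | p z = 0]; apply/seteqP; split=> [_ -> //|p' [pp' p'0] /=].
have [f [fE fj]] := points_morph pp; have [f' [fE' fj']] := points_morph pp'; subst p p'.
apply/funext => z; have := p'0 (z - j (f z)); rewrite /= !rmorphB fj fj' subrr => /(_ erefl).
by move/eqP; rewrite subr_eq0 => /eqP.
Qed.

Lemma irreducible_set1 p : irreducible j [set p].
Proof.
split=> [|Y1 Y2 _ _ Y12]; first by exists p.
by case: (Y12 p erefl) => Yp; [left|right] => _ ->.
Qed.

(* The functions on [X] then form a domain, embedded in [T]. *)
Lemma irreducible_domain (T : idomainType) (theta : {rmorphism S -> T}) X :
  X !=set0 -> X `<=` points j ->
  (forall z, (forall p, X p -> p z = 0) <-> theta z = 0) -> irreducible j X.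
Proof.
move=> X0 Xp XT; split=> // _ _ [E1 ->] [E2 ->] X12.
have [XE|/existsNP[f1 /not_implyP[E1f /XT f10]]] :=
  pselect (forall f, E1 f -> forall p, X p -> p f = 0).
  by left=> p pX; split=> [|f /XE]; [exact: Xp|exact].
have [XE|/existsNP[f2 /not_implyP[E2f /XT f20]]] :=
  pselect (forall f, E2 f -> forall p, X p -> p f = 0).
  by right=> p pX; split=> [|f /XE]; [exact: Xp|exact].
have : theta (f1 * f2) = 0.
  apply/XT => p pX; have [f [fE _]] := points_morph (Xp _ pX); rewrite fE rmorphM /= -fE.
  by case: (X12 _ pX) => -[_ h]; [rewrite (h _ E1f) mul0r|rewrite (h _ E2f) mulr0].
by rewrite rmorphM => /eqP; rewrite mulf_eq0 => /orP[/eqP /f10|/eqP /f20].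
Qed.

Lemma irreducible_prime X : irreducible j X -> X `<=` points j ->
  forall f g, (forall p, X p -> p (f * g) = 0) ->
  (forall p, X p -> p f = 0) \/ (forall p, X p -> p g = 0).
Proof.
move=> [_ Xirr] Xp f g fg0.
have [||p pX|Xf|Xg] := Xirr (zeros j [set f]) (zeros j [set g]).
- by exists [set f].
- by exists [set g].
- have [h [hE hj]] := points_morph (Xp _ pX); have := fg0 _ pX.
  rewrite hE rmorphM => /eqP; rewrite mulf_eq0 => /orP[] /eqP h0.
    by left; split=> [|_ ->]; [rewrite -hE; exact: Xp|].
  by right; split=> [|_ ->]; [rewrite -hE; exact: Xp|].
- by left=> p /Xf[_]; exact.
- by right=> p /Xg[_]; exact.
Qed.

End Varieties.

Lemma poly2_eq0 (F : numDomainType) (P : {poly {poly F}}) :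
  (forall a b, P.[a%:P].[b] = 0) -> P = 0.
Proof.
move=> P0; apply/polyP => k; rewrite coef0; apply: poly_eq0_horner => b.
have : map_poly (horner_eval b) P = 0.
  apply: poly_eq0_horner => a; rewrite -[RHS](P0 a b) -[RHS]/(horner_eval b _).
  by rewrite -(horner_map (horner_eval b)) /= /horner_eval hornerC.
by move=> /polyP/(_ k); rewrite coef_map coef0.
Qed.

Section Specialized.
Context {C : numClosedFieldType} {zeta : C}.
Hypothesis zetaP : 3.-primitive_root zeta.
Variable c : 'I_3 -> C.

Local Notation Z := (Z zeta).
Local Notation Zc := (Zc zeta c).
Local Notation j := (Zc_const zeta c).
Local Notation pi := (Zc_pi (zeta := zeta) c).
Local Notation F := (fixedZc zeta c 2).
Local Notation qc := (pi (q zetaP)).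
Local Notation Qc := (pi (Q zetaP)).
Local Notation euc := (pi (eu zeta)).

Lemma comp_pi_morph p : points j p -> exists f : {rmorphism Zc -> C},
  [/\ p = f, forall a, f (j a) = a &
   exists2 g : {rmorphism Z -> C}, (forall z, g z = f (pi z)) &
     (forall a, g (Zconst zeta a%:P) = a) /\ g (Zconst zeta 'X) = c 0].
Proof.
move=> pp; have [f [fE fj]] := points_morph pp; exists f; split=> //.
by exists (f \o pi) => //; split=> [a|]; [exact: fj|rewrite /= comp_pi_const // hornerX].
Qed.

(** Composition with [Z -> Zc] reduces the claim to [fixedZ2P]. *)
Lemma fixedZc2P p : F p <-> points j p /\ odd0 zetaP (p \o pi).
Proof.
suff: points j p -> (forall (xi : C) (xi0 : xi != 0), xi ^+ 2 = 1 ->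
    forall z, p (pi (actZ xi0 z)) = p (pi z)) <-> odd0 zetaP (p \o pi).
  by move=> h; split=> -[pp] /(h pp).
move=> pp; have [f [fE fj [g gE [gc _]]]] := comp_pi_morph pp; subst p.
have pg : points (fun a => Zconst zeta a%:P) g by exact: morph_points.
have -> : f \o pi = g by apply/funext => z; rewrite gE.
split=> [h|og]; first by apply: ((fixedZ2P zetaP g).1 _).2; split=> // xi xi0 x2 z; rewrite !gE h.
by have [_ h] := (fixedZ2P zetaP g).2 (conj pg og) => xi xi0 x2 z; rewrite -!gE h.
Qed.

Lemma fixedZc_eval z : exists P, forall p, F p ->
  p z = pev (c 0) (vec3 (p qc) (p Qc) (p euc)) P.
Proof.
have [z' ->] := quotR_surj z; have [P EP] := even_part zetaP z'; exists P => p.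
move=> /fixedZc2P[pp op]; have [f [fE fj [g gE [gc gX]]]] := comp_pi_morph pp; subst p.
rewrite -[LHS]gE EP // ?morph_Zeval // ?gX ?gE //.
by case: op; rewrite /= -!gE.
Qed.

Lemma fixedZc_ext p p' : F p -> F p' ->
  p qc = p' qc -> p Qc = p' Qc -> p euc = p' euc -> p = p'.
Proof.
move=> Fp Fp' Eq EQ Ee; apply/funext => z; have [P EP] := fixedZc_eval z.
by rewrite !EP // Eq EQ Ee.
Qed.

Definition gapc : Zc := euc ^+ 2 - 9%:R * (j (c 0)) ^+ 2 - 4%:R * qc * Qc.

Local Notation D := (F `&` zeros j [set gapc]).

Lemma gapcE p : points j p -> p gapc = p euc ^+ 2 - 9 * c 0 ^+ 2 - 4 * p qc * p Qc.
Proof.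
move=> /points_morph[f [-> fj]].
by rewrite !(rmorphB, rmorphM, rmorphXn, rmorph_nat) /= fj.
Qed.

Lemma fixedZc_points p : F p -> points j p.
Proof. by case. Qed.

Lemma componentP p : D p <-> F p /\ p euc ^+ 2 = 9 * c 0 ^+ 2 + 4 * p qc * p Qc.
Proof.
split=> [[Fp [pp p0]]|[Fp E]].
  split=> //; have := p0 _ erefl; rewrite gapcE // => /eqP.
  by rewrite subr_eq0 subr_eq => /eqP ->; ring.
by split=> //; split=> [|_ ->]; [case: Fp|rewrite gapcE ?E; [ring|case: Fp]].
Qed.

Lemma fixedZc_cases p : F p -> D p \/ [/\ p qc = 0, p Qc = 0 & p euc = 0].
Proof.
move=> Fp; have /fixedZc2P[pp op] := Fp.
have [f [fE fj [g gE [gc gX]]]] := comp_pi_morph pp; subst p.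
have og : odd0 zetaP g by case: op; rewrite /= -!gE.
have [g1 g2 g3] := morph_rel gc og; move: g1 g2 g3; rewrite gX !gE.
have [/eqP g0 _ _ _|gN /eqP + /eqP + /eqP] :=
  eqVneq (f euc ^+ 2 - 9 * c 0 ^+ 2 - 4 * f qc * f Qc) 0.
  left; apply/componentP; split=> //; move: g0.
  by rewrite subr_eq0 subr_eq => /eqP ->; ring.
by rewrite !mulf_eq0 (negPf gN) !orbF => /eqP ? /eqP ? /eqP ?; right.
Qed.

(** Both sides are multiplicative and additive in [z], so it is enough to compare them on generators
    of the centre, where [chi] is a polynomial in the parameters. *)
Lemma chi_morph (R R' : comNzRingType) (kappa : {rmorphism C -> R})
    (kappa' : {rmorphism C -> R'}) (h : {rmorphism R -> R'}) tw A Q rho a b z :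
  (forall x, h (kappa x) = kappa' x) ->
  h (chi zetaP kappa tw A Q rho a b z) =
  chi zetaP kappa' tw (h A) (h Q) (h rho) (h a) (h b) z.
Proof.
move=> hk; have ifN : h (if tw then - A else A) = if tw then - h A else h A.
  by case: tw; rewrite ?rmorphN.
elim: {z}(generated_all zetaP z) => [p| | | | | | | |u v _ IH _ IH'|u v _ IH _ IH'].
1: by rewrite !chi_const -horner_map -map_poly_comp; congr (_.[_]); exact: eq_map_poly.
8: by rewrite [X in h X]rmorphD rmorphD IH IH' [RHS]rmorphD.
8: by rewrite [X in h X]rmorphM rmorphM IH IH' [RHS]rmorphM.
all: by rewrite !chi_gens ?(rmorph_nat, rmorphXn, rmorphD, rmorphN, rmorphM) ?ifN.
Qed.

Lemma component_points : D `<=` points j.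
Proof. by move=> p [/fixedZc_points]. Qed.

Lemma zclosed_fixed : zclosed j F.
Proof.
exists [set pi (z_r zetaP); pi (z_R zetaP); pi (z_u zetaP); pi (z_U zetaP)].
apply/seteqP; split=> p.
  by move=> /fixedZc2P[pp [? ? ? ?]]; split=> // _ [[[->|->]|->]|->].
move=> [pp h]; apply/fixedZc2P; split=> //.
by split; apply: h; [left; left; left|left; left; right|left; right|right].
Qed.

Lemma zclosed_setI (X Y : set (Zc -> C)) : zclosed j X -> zclosed j Y -> zclosed j (X `&` Y).
Proof.
move=> [E1 ->] [E2 ->]; exists (E1 `|` E2); apply/seteqP; split=> p.
  by move=> [[pp h1] [_ h2]]; split=> // f [/h1|/h2].
by move=> [pp h]; split; split=> // f Ef; apply: h; [left|right].
Qed.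

Lemma zclosed_D : zclosed j D.
Proof. by apply: zclosed_setI; [exact: zclosed_fixed|exists [set gapc]]. Qed.

Hypothesis c_const : forall i, c i = c 0.

Lemma chart_kills tw (R : comNzRingType) (kappa : {rmorphism C -> R}) (Q a : R) z :
  (exists i, z = Zconst zeta ('X - (c i)%:P)) ->
  (chi zetaP kappa tw (kappa (c 0)) Q 0 a 0 : {rmorphism Z -> R}) z = 0.
Proof.
by move=> [i ->]; rewrite [LHS]chi_const map_polyXsubC !hornerE c_const subrr.
Qed.

Definition chartc tw (R : comNzRingType) (kappa : {rmorphism C -> R}) (Q a : R) :
  {rmorphism Zc -> R} := quotR_liftM (@chart_kills tw R kappa Q a).

Lemma chartcE tw (R : comNzRingType) (kappa : {rmorphism C -> R}) (Q a : R) z :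
  chartc tw kappa Q a (pi z) = chi zetaP kappa tw (kappa (c 0)) Q 0 a 0 z.
Proof. exact: quotR_liftME. Qed.

Definition ptc tw Q a : {rmorphism Zc -> C} := chartc tw idfun Q a.

Lemma ptcE tw Q a z : ptc tw Q a (pi z) = chart_pt zetaP tw (c 0) Q a z.
Proof. exact: chartcE. Qed.

Lemma ptc_const tw Q a b : ptc tw Q a (j b) = b.
Proof. by rewrite [LHS]ptcE chart_pt_const hornerC. Qed.

Lemma ptc_fixed tw Q a : F (ptc tw Q a).
Proof.
apply/fixedZc2P; split; first by apply: morph_points; exact: ptc_const.
have -> : ptc tw Q a \o pi = chart_pt zetaP tw (c 0) Q a by apply/funext => z; exact: ptcE.
exact: chart_pt_odd0.
Qed.

Lemma ptc_gens tw Q a : [/\ ptc tw Q a qc = a ^+ 2 * Q - 3 * (if tw then - c 0 else c 0) * a,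
  ptc tw Q a Qc = Q & ptc tw Q a euc = 2 * a * Q - 3 * (if tw then - c 0 else c 0)].
Proof. by rewrite !ptcE chart_pt_q chart_pt_Q chart_pt_eu. Qed.

Lemma ptc_component tw Q a : D (ptc tw Q a).
Proof.
apply/componentP; split; first exact: ptc_fixed.
by have [-> -> ->] := ptc_gens tw Q a; case: tw; ring.
Qed.

Hypothesis c_neq0 : c 0 != 0.

(** For [Q != 0] the chart parameter is determined by [eu]. On the line [Q = 0], [eu = - 3 c_0] it
    is determined by [q = - 3 c_0 a], where [c_0 != 0] is used. *)
Lemma component_ptc p : D p -> p Qc != 0 \/ p euc = - 3 * c 0 ->
  exists Q a, p = ptc false Q a.
Proof.
move=> /componentP[Fp E] h; exists (p Qc).
have c3 : 3 * c 0 != 0 by rewrite mulf_neq0 // pnatr_eq0.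
have [Q0|Q0] := eqVneq (p Qc) 0.
  case: h => [|e3]; first by rewrite Q0 eqxx.
  exists (- p qc / (3 * c 0)); apply: fixedZc_ext => //; first exact: ptc_fixed.
  - have [-> _ _] := ptc_gens false (p Qc) (- p qc / (3 * c 0)).
    by rewrite Q0; field.
  - by have [_ -> _] := ptc_gens false (p Qc) (- p qc / (3 * c 0)).
  - have [_ _ ->] := ptc_gens false (p Qc) (- p qc / (3 * c 0)).
    by rewrite Q0 e3; ring.
have [a [aq ae]] := chart_pt_surface zetaP Q0 E; exists a.
by apply: fixedZc_ext => //; [exact: ptc_fixed| | |]; rewrite ptcE ?aq ?ae ?chart_pt_Q.
Qed.

Lemma component_ptc_twist p : D p -> p Qc = 0 -> p euc = 3 * c 0 ->
  exists a, p = ptc true 0 a.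
Proof.
move=> /componentP[Fp E] Q0 e3; exists (p qc / (3 * c 0)).
have c3 : 3 * c 0 != 0 by rewrite mulf_neq0 // pnatr_eq0.
have [gq gQ ge] := ptc_gens true 0 (p qc / (3 * c 0)).
apply: fixedZc_ext => //; rewrite ?gq ?gQ ?ge ?Q0 ?e3; [exact: ptc_fixed|field => //|by []|ring].
Qed.

(** The chart with indeterminate parameters: the outer variable is [a], the inner one [Q]. *)
Definition thetac tw : {rmorphism Zc -> {poly {poly C}}} :=
  chartc tw (polyC \o polyC) 'X%:P 'X.

Lemma thetacE tw z a Q : (thetac tw z).[a%:P].[Q] = ptc tw Q a z.
Proof.
have [z' ->] := quotR_surj z; rewrite -[quotR _ z']/(pi z').
pose ev : {rmorphism {poly {poly C}} -> C} := horner_eval Q \o horner_eval a%:P.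
rewrite -[LHS]/(ev (thetac tw _)) /thetac /ptc !chartcE.
rewrite (@chi_morph _ _ _ idfun); last by move=> x; rewrite /ev /= /horner_eval !hornerC.
by rewrite /ev /= /horner_eval !hornerC !hornerX hornerC.
Qed.

Lemma thetac_eq0 tw z : (forall Q a, ptc tw Q a z = 0) <-> thetac tw z = 0.
Proof.
split=> [z0|z0 Q a]; last by rewrite -thetacE z0 !horner0.
by apply: poly2_eq0 => a Q; rewrite thetacE.
Qed.

(* On the line Q = 0, eu = 3 c_0 only the twisted charts have points; a function
   vanishing on the other points vanishes there by density, as the twisted charts
   with Q <> 0 have no new points. *)
Lemma component_vanishing z : (forall p, D p -> p z = 0) <-> thetac false z = 0.
Proof.
rewrite -thetac_eq0; split=> [h Q a|h p Dp]; first by apply: h; exact: ptc_component.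
have [Q0|Q0] := eqVneq (p Qc) 0; last first.
  by have [|Q [a ->]] := component_ptc Dp; [left|].
have /componentP[_ /eqP] := Dp; rewrite Q0 mulr0 addr0.
rewrite (_ : 9 * c 0 ^+ 2 = (3 * c 0) ^+ 2); last by ring.
rewrite eqf_sqr => /orP[] /eqP e3; last first.
  by have [|Q [a ->]] := component_ptc Dp; [right; rewrite e3 mulNr|].
have [a ->] := component_ptc_twist Dp Q0 e3.
suff /thetac_eq0 : thetac true z = 0 by exact.
have XN : ('X%:P : {poly {poly C}}) != 0 by rewrite polyC_eq0 polyX_eq0.
apply: (mulfI XN); rewrite mulr0; apply: poly2_eq0 => a' Q'.
rewrite !hornerE thetacE; have [->|Q'0] := eqVneq Q' 0; first by rewrite mul0r.
have [|Q'' [a'' ->]] := component_ptc (ptc_component true Q' a').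
  by left; have [_ -> _] := ptc_gens true Q' a'.
by rewrite h mulr0.
Qed.

Lemma irreducible_D : irreducible j D.
Proof.
apply: (irreducible_domain (theta := thetac false)) component_vanishing.
  by exists (ptc false 0 0); exact: ptc_component.
exact: component_points.
Qed.

Section Components.
Variable p0 : Zc -> C.
Hypothesis Fp0 : F p0.
Hypothesis p0_gens : [/\ p0 qc = 0, p0 Qc = 0 & p0 euc = 0].

Lemma origin_notD : ~ D p0.
Proof.
have [q0 Q0 e0] := p0_gens => /componentP[_ /eqP].
rewrite q0 Q0 e0 mulr0 addr0 expr0n /= eq_sym mulf_eq0 expf_eq0 /=.
by rewrite (negPf c_neq0) orbF pnatr_eq0.
Qed.

Lemma fixedZc_split : F = D `|` [set p0].
Proof.
apply/seteqP; split=> [p Fp|p [[]|->] //]; have [|[q0 Q0 e0]] := fixedZc_cases Fp.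
  by left.
by right; have [q0' Q0' e0'] := p0_gens; apply: fixedZc_ext; rewrite ?q0 ?Q0 ?e0.
Qed.

Lemma D_neq_origin : ~ (D `<=` [set p0]).
Proof.
move=> /(_ _ (ptc_component false 0 0)) E; apply: origin_notD; rewrite -E.
exact: ptc_component.
Qed.

Lemma irreducible_cases X : irreducible j X -> X `<=` F -> X `<=` D \/ X `<=` [set p0].
Proof.
move=> [_ Xirr] XF; apply: Xirr; rewrite -?fixedZc_split //; first exact: zclosed_D.
exact: zclosed_set1 (fixedZc_points Fp0).
Qed.

Lemma componentsP X : irreducible_component j F X <-> (X = D \/ X = [set p0]).
Proof.
split=> [[Xirr XF Xmax]|[->|->]].
- have [XD|Xp] := irreducible_cases Xirr XF.
    by left; rewrite (Xmax _ irreducible_D XD) // => p [].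
  by right; rewrite (Xmax _ (irreducible_set1 j p0) Xp) // => p ->.
- split; [exact: irreducible_D|by move=> p []|move=> Y Yirr DY YF].
  have [YD|Yp] := irreducible_cases Yirr YF; first by apply/seteqP.
  by case: D_neq_origin; exact: subset_trans Yp.
- split; [exact: irreducible_set1|by move=> p ->|move=> Y Yirr pY YF].
  have [YD|Yp] := irreducible_cases Yirr YF; last by apply/seteqP.
  by case: origin_notD; apply: YD; exact: pY.
Qed.

Lemma isolated_origin : isolated j F p0.
Proof.
split=> //; exists D; first exact: zclosed_D.
apply/seteqP; split=> p.
  by move=> [Fp Dp]; split=> // E; apply: origin_notD; rewrite -E.
move=> [Fp pN]; split=> //; move: (Fp); rewrite {1}fixedZc_split => -[//|].
by move=> /pN.
Qed.

End Components.
End Specialized.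

(** * Dimension *)

Section NoEmbedding.
Variable K : fieldType.

Definition bidegree_le (n : nat) (p : {poly {poly K}}) : Prop :=
  (size p <= n.+1)%N /\ forall i, (size (p`_i)%R <= n.+1)%N.

Lemma bidegree_leW m n p : (m <= n)%N -> bidegree_le m p -> bidegree_le n p.
Proof.
by rewrite -ltnS => mn [sp cp]; split=> [|i]; apply: leq_trans mn.
Qed.

Lemma bidegree_ex p : exists n, bidegree_le n p.
Proof.
exists (size p + \sum_(i < size p) size (p`_i)%R)%N; split; first by rewrite ltnW // ltnS leq_addr.
move=> i; have [ip|pi] := ltnP i (size p); last by rewrite nth_default // size_poly0.
by rewrite ltnW // ltnS (bigD1 (Ordinal ip)) //= addnCA leq_addr.
Qed.

Lemma bidegree_leM m n p p' :
  bidegree_le m p -> bidegree_le n p' -> bidegree_le (m + n) (p * p').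
Proof.
move=> [sp cp] [sp' cp']; split=> [|i].
  by apply: leq_trans (size_polyMleq _ _) _; lia.
rewrite coefM; apply: leq_trans (size_sum _ _ _) _; apply/bigmax_leqP => k _.
apply: leq_trans (size_polyMleq _ _) _.
by have := cp k; have := cp' (i - k)%N; lia.
Qed.

Lemma bidegree_leX m n p : bidegree_le m p -> bidegree_le (m * n) (p ^+ n).
Proof.
move=> pm; elim: n => [|n IH]; last by rewrite exprS mulnS; exact: bidegree_leM.
rewrite muln0 expr0; split=> [|i]; first by rewrite size_poly1.
by rewrite coefC; case: ifP => _; rewrite ?size_poly1 ?size_poly0.
Qed.

Variable f : {rmorphism {poly {poly {poly K}}} -> {poly {poly K}}}.
Hypothesis f_const : forall a, f a%:P%:P%:P = a%:P%:P.

Let mono i j k : {poly {poly {poly K}}} := ('X^i)%:P%:P * ('X^j)%:P * 'X^k.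

Let mono_coef a i j k i' j' k' :
  (a%:P%:P%:P * mono i j k)`_k'`_j'`_i' = a * ((i == i') && (j == j') && (k == k'))%:R.
Proof.
have E : (mono i j k)`_k' = ('X^i)%:P * 'X^j * (k == k')%:R.
  by rewrite /mono -polyCM coefCM coefXn eq_sym.
rewrite !coefCM E; case: (k == k'); last by rewrite !mulr0 !coef0 andbF mulr0.
rewrite mulr1 andbT coefCM coefXn (eq_sym j'); congr (_ * _).
by case: (j == j'); rewrite ?mulr1 ?mulr0 ?coef0 ?andbF // coefXn eq_sym andbT.
Qed.

(** A dimension count: the [N^3] monomials with exponents below [N] are sent to polynomials of
    bidegree at most [3 m N], which form a space of dimension only quadratic in [N]. *)
Lemma poly3_not_embed_poly2 : exists2 t, t != 0 & f t = 0.
Proof.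
have [m [mx my mz]] : exists m, [/\ bidegree_le m (f 'X%:P%:P), bidegree_le m (f 'X%:P)
    & bidegree_le m (f 'X)].
  have [m1 h1] := bidegree_ex (f 'X%:P%:P); have [m2 h2] := bidegree_ex (f 'X%:P).
  have [m3 h3] := bidegree_ex (f 'X).
  exists (m1 + m2 + m3)%N; split; [apply: bidegree_leW h1|apply: bidegree_leW h2|].
  - by rewrite -addnA leq_addr.
  - by rewrite addnAC leq_addl.
  - by apply: bidegree_leW h3; rewrite leq_addl.
(* Since [L <= (3 m + 1) N], one has [L^2 <= (3 m + 1)^2 N^2 < N^3] for this [N]. *)
pose N := ((3 * m).+1 ^ 2).+1; pose L := (3 * m * N).+1.
pose I := ('I_N * 'I_N * 'I_N)%type.
have LN : (L * L < #|{: I}|)%N.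
  rewrite !card_prod !card_ord.
  have LE : (L <= (3 * m).+1 * N)%N by rewrite /L (mulSn (3 * m)) -[X in (X <= _)%N]add1n leq_add2r.
  apply: (@leq_ltn_trans (((3 * m).+1 * N) * ((3 * m).+1 * N))); first exact: leq_mul.
  by rewrite mulnACA -[X in (_ < X)%N]mulnA ltn_pmul2r ?muln_gt0 // mulnn.
have fm i j k : (i < N)%N -> (j < N)%N -> (k < N)%N -> bidegree_le (3 * m * N) (f (mono i j k)).
  move=> iN jN kN; apply: (@bidegree_leW (m * i + m * j + m * k)).
    rewrite -!mulnDr (mulnC 3) -mulnA leq_mul2l !mulSn mul0n addn0 addnA.
    by rewrite !leq_add ?orbT // ltnW.
  rewrite /mono !rmorphM /= !rmorphXn /=.
  by do 2?apply: bidegree_leM; apply: bidegree_leX.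
pose fr (r : 'I_#|{: I}|) := let: (i, j, k) := enum_val r in f (mono i j k).
pose M : 'M[K]_(#|{: I}|, L * L) := \matrix_r mxvec (\matrix_(a, b) (fr r)`_a`_b).
(* There are more monomials than coefficients, so the rows of [M] are linearly dependent; a
   dependency gives the element of the kernel. *)
have [v vN vM] : exists2 v : 'rV_#|{: I}|, v != 0 & v *m M = 0.
  have : kermx M != 0.
    rewrite kermx_eq0 /row_free; apply/eqP => E.
    by have := rank_leq_col M; rewrite E leqNgt LN.
  by move=> /rowV0Pn[v /sub_kermxP vM vN]; exists v.
pose t := \sum_r (v 0 r)%:P%:P%:P * (let: (i, j, k) := enum_val r in mono i j k).
exists t.
  apply: contra_neq vN => t0; apply/rowP => r; rewrite mxE.
  have := congr1 (fun p : {poly {poly {poly K}}} => let: (i, j, k) := enum_val r in p`_k`_j`_i) t0.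
  case Er: (enum_val r) => [[i j] k]; rewrite !coef0 => <-.
  rewrite /t !coef_sum (bigD1 r) //= Er mono_coef !eqxx mulr1 big1 ?addr0 // => r' r'r.
  case Er': (enum_val r') => [[i' j'] k']; rewrite mono_coef.
  have [/andP[/andP[/eqP i'i /eqP j'j] /eqP k'k]|_] := boolP (_ && _ && _); last by rewrite mulr0.
  case/eqP: r'r; apply: enum_val_inj; rewrite Er Er'.
  by congr (_, _, _); exact: val_inj.
have ft : f t = \sum_r (v 0 r)%:P%:P * fr r.
  rewrite rmorph_sum; apply: eq_bigr => r _; rewrite rmorphM /= f_const; congr (_ * _).
  by rewrite /fr; case: (enum_val r) => [[i j] k].
have frL r : bidegree_le (3 * m * N) (fr r).
  by rewrite /fr; case: (enum_val r) => [[i j] k]; apply: fm.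
apply/polyP => a; apply/polyP => b; rewrite ft coef_sum coef_sum !coef0.
under eq_bigr do rewrite coefCM coefCM.
have [aL|aL] := leqP L a.
  by rewrite big1 // => r _; rewrite (nth_default 0 (leq_trans (frL r).1 aL)) coef0 mulr0.
have [bL|bL] := leqP L b.
  by rewrite big1 // => r _; rewrite (nth_default 0 (leq_trans ((frL r).2 a) bL)) mulr0.
have /rowP/(_ (mxvec_index (Ordinal aL) (Ordinal bL))) := vM.
rewrite !mxE => h; rewrite -[RHS]h; apply: eq_bigr => r _; congr (_ * _).
by rewrite mxE mxvecE mxE.
Qed.

End NoEmbedding.

(** * Chains of irreducible closed sets *)

Section Chain.
Variables (C : fieldType) (S : pzRingType) (Z : comNzRingType).
Variables (j : C -> S) (pi : {rmorphism Z -> S}).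
Hypothesis pi_surj : forall s, exists z, s = pi z.

Definition embeds (T : nzRingType) (e : {rmorphism T -> Z}) (X : set (S -> C)) : Prop :=
  forall t, (forall p, X p -> p (pi (e t)) = 0) -> t = 0.

(* A function vanishing on [X] but not on [X'] is transcendental over [T] on [X']. *)
Lemma embeds_poly (T : comNzRingType) (e : {rmorphism T -> Z}) X X' :
  zclosed j X -> X `<` X' -> irreducible j X' -> X' `<=` points j -> embeds e X ->
  exists e' : {rmorphism {poly T} -> Z}, embeds e' X' /\ forall t, e' t%:P = e t.
Proof.
move=> [E XE] [XX' X'X] X'irr X'p eX.
have [g gX gX'] : exists2 g, forall p, X p -> p g = 0 & ~ forall p, X' p -> p g = 0.
  move/existsNP: X'X => [p /not_implyP[X'p1 Xp]].
  have [g /not_implyP[Eg pg]] : exists g, ~ (E g -> p g = 0).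
    by apply/existsNP => h; apply: Xp; rewrite XE; split=> //; exact: X'p.
  by exists g; [rewrite XE => p' [_ h]; exact: h|move=> h; apply/pg/h].
have [g' Eg] := pi_surj g.
have [e' e'C e'X] : exists2 e' : {rmorphism {poly T} -> Z},
    (forall t, e' t%:P = e t) & e' 'X = g'.
  exists (horner_eval g' \o map_poly e); first by move=> t; rewrite /= /horner_eval map_polyC hornerC.
  by rewrite /= /horner_eval map_polyX hornerX.
exists e'; split=> //; elim/poly_ind => [//|P a IH] PX'.
have a0 : a = 0.
  apply: eX => p Xp; have X'p1 := XX' _ Xp; have := PX' _ X'p1.
  have [h [hE _]] := points_morph (X'p _ X'p1); have := gX _ Xp.
  by rewrite hE Eg => hg; rewrite !(rmorphD, rmorphM) /= e'X hg mulr0 add0r e'C.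
rewrite a0 addr0 IH ?mul0r //.
have [p X'p1||] := irreducible_prime X'irr X'p (f := pi (e' P)) (g := g); last by move/gX'.
  by rewrite Eg -e'X -!rmorphM; have := PX' _ X'p1; rewrite a0 addr0.
by [].
Qed.

End Chain.

Section Dimension.
Context {C : numClosedFieldType} {zeta : C}.
Hypothesis zetaP : 3.-primitive_root zeta.
Variable c : 'I_3 -> C.
Hypothesis c_const : forall i, c i = c 0.
Hypothesis c_neq0 : c 0 != 0.

Local Notation Z := (Z zeta).
Local Notation Zc := (Zc zeta c).
Local Notation j := (Zc_const zeta c).
Local Notation pi := (Zc_pi (zeta := zeta) c).
Local Notation F := (fixedZc zeta c 2).
Local Notation Qc := (pi (Q zetaP)).
Local Notation euc := (pi (eu zeta)).
Local Notation D := (F `&` zeros j [set gapc zetaP c]).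
Local Notation L := (F `&` zeros j [set Qc; euc + j (3 * c 0)]).
Local Notation ptc := (ptc zetaP c_const).

(** The value [eu = - 3 c_0] is nonzero, which excludes the isolated point; the rest of this locus
    lies in the untwisted charts with [Q = 0]. *)
Lemma lineP p : L p <-> exists a, p = ptc false 0 a.
Proof.
split=> [[Fp [pp p0]]|[a ->]].
  have [f [fE fj]] := points_morph pp.
  have Q0 : p Qc = 0 by apply: p0; left.
  have e0 : p euc = - 3 * c 0.
    have := p0 (euc + j (3 * c 0)) (or_intror erefl).
    by rewrite fE rmorphD /= fj => /eqP; rewrite addr_eq0 mulNr => /eqP.
  have Dp : D p.
    have [//|[_ _ e00]] := fixedZc_cases zetaP Fp; move: e0; rewrite e00 => /esym/eqP.
    by rewrite mulf_eq0 (negPf c_neq0) orbF oppr_eq0 pnatr_eq0.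
  have [|Q [a pE]] := component_ptc c_const c_neq0 Dp; first by right.
  by exists a; rewrite pE; move: Q0; rewrite pE; have [_ -> _] := ptc_gens zetaP c_const false Q a => ->.
have [_ aQ ae] := ptc_gens zetaP c_const false 0 a.
split; first exact: ptc_fixed; split; first by case: (ptc_fixed zetaP c_const false 0 a).
by move=> _ [->|->] //; rewrite [LHS](rmorphD (ptc false 0 a)) ae ptc_const; ring.
Qed.

Lemma irreducible_line : irreducible j L.
Proof.
pose theta0 : {rmorphism Zc -> {poly C}} :=
  map_poly (horner_eval 0) \o thetac zetaP c_const false.
apply: (irreducible_domain (theta := theta0)) => [|p [[]] //|z].
  by exists (ptc false 0 0); apply/lineP; exists 0.
have thetaE a : (theta0 z).[a] = ptc false 0 a z.
  rewrite -thetacE -[RHS]/(horner_eval 0 _) -(horner_map (horner_eval 0)).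
  by rewrite /= /horner_eval hornerC.
split=> [z0|t0 p /lineP[a ->]]; last by rewrite -thetaE t0 horner0.
by apply: poly_eq0_horner => a; rewrite thetaE; apply: z0; apply/lineP; exists a.
Qed.

Lemma zclosed_line : zclosed j L.
Proof.
by apply: zclosed_setI; [exact: (zclosed_fixed zetaP)|exists [set Qc; euc + j (3 * c 0)]].
Qed.

(** A point in the line [L] in the surface. The chart with [a = 1] shows the first inclusion to be
    strict, the one with [Q = 1] the second. *)
Lemma closed_chain2 : closed_chain j D 2.
Proof.
have DL : L `<=` D by move=> p /lineP[a ->]; exact: ptc_component.
have L0 : [set (ptc false 0 0 : Zc -> C)] `<=` L by move=> _ ->; apply/lineP; exists 0.
exists (fun i => if i is i'.+1 then if i' is 0%N then L else D else [set (ptc false 0 0 : Zc -> C)]).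
split=> [[|[|[|]]] // _|[|[|]] // _].
- split; [exact: irreducible_set1| |exact: subset_trans DL].
  by apply: zclosed_set1; case: (ptc_fixed zetaP c_const false 0 0).
- by split; [exact: irreducible_line|exact: zclosed_line|].
- by split; [exact: irreducible_D|exact: zclosed_D|].
- split=> // LE; have : L (ptc false 0 1) by apply/lineP; exists 1.
  move/LE => E; have [q0 _ _] := ptc_gens zetaP c_const false 0 0.
  have [+ _ _] := ptc_gens zetaP c_const false 0 1; rewrite E q0 => /eqP.
  by rewrite !mulr0 !sub0r oppr0 mulr1 eq_sym oppr_eq0 mulf_eq0 (negPf c_neq0) orbF pnatr_eq0.
- split=> // /(_ _ (ptc_component zetaP c_const false 1 0)) /lineP[a E].
  have [_ + _] := ptc_gens zetaP c_const false 1 0; rewrite E.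
  by have [_ -> _] := ptc_gens zetaP c_const false 0 a => /esym/eqP; rewrite oner_eq0.
Qed.

Lemma closed_chain3 : ~ closed_chain j D 3.
Proof.
move=> [Y [Yirr Ylt]].
have Yp i : (i <= 3)%N -> Y i `<=` points j.
  by move=> /Yirr[_ _ YD] p /YD; exact: component_points.
have pi_surj s : exists z, s = pi z by exact: quotR_surj.
have step i : (i < 3)%N -> forall (T : comNzRingType) (e : {rmorphism T -> Z}),
    embeds pi e (Y i) -> exists e' : {rmorphism {poly T} -> Z},
    embeds pi e' (Y i.+1) /\ forall t, e' t%:P = e t.
  move=> i3 T e eY; have [_ Ycl _] := Yirr i (ltnW i3); have [Y'irr _ _] := Yirr i.+1 i3.
  exact: (embeds_poly pi_surj Ycl (Ylt i i3) Y'irr (Yp _ i3) eY).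
pose e0 : {rmorphism C -> Z} := Zconst zeta \o polyC.
(* The chain starts with the constants, which embed because [Y 0] is nonempty. *)
have e0Y : embeds pi e0 (Y 0%N).
  move=> t t0; have [[[p Yp0] _] _ _] := Yirr 0%N isT.
  by have [_ _ pj] := Yp 0%N isT _ Yp0; rewrite -[t]pj; exact: t0.
have [e1 [e1Y e1C]] := step 0%N isT _ _ e0Y.
have [e2 [e2Y e2C]] := step 1%N isT _ _ e1Y.
have [e3 [e3Y e3C]] := step 2%N isT _ _ e2Y.
pose f : {rmorphism {poly {poly {poly C}}} -> {poly {poly C}}} :=
  thetac zetaP c_const false \o pi \o e3.
have [a|t tN ft] := poly3_not_embed_poly2 (f := f).
  transitivity (thetac zetaP c_const false (pi (Zconst zeta a%:P))).
    by rewrite /f /= e3C e2C e1C.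
  by rewrite [LHS]chartcE chi_const map_polyC hornerC.
(* An element killed by [f] vanishes on the whole surface, hence on [Y 3], where the three functions
   are independent. *)
case/eqP: tN; apply: e3Y => p Yp3; have [_ _ Y3D] := Yirr 3%N isT.
exact: (component_vanishing zetaP c_const c_neq0 _).2 ft _ (Y3D _ Yp3).
Qed.

Lemma dimension_D : dimension j D 2.
Proof. by split; [exact: closed_chain2|exact: closed_chain3]. Qed.

End Dimension.

Theorem proposition8p3 (R : realType) (zeta : R[i])
    (zetaP : 3.-primitive_root zeta) :
  (let F := fixedZ zeta 2 in
   presentation
     (fun a : {poly R[i]} => restrictZ F (Zconst zeta a))
     (tnth [tuple restrictZ F (q zetaP); restrictZ F (Q zetaP);
                  restrictZ F (eu zeta)])
     (let A : {mpoly {poly R[i]}[3]} := 'X%:MP in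
      let q := 'X_(@Ordinal 3 0 isT) in
      let Q := 'X_(@Ordinal 3 1 isT) in
      let eu := 'X_(@Ordinal 3 2 isT) in
      [set q * (eu ^+ 2 - 9%:R * A ^+ 2 - 4%:R * q * Q);
           eu * (eu ^+ 2 - 9%:R * A ^+ 2 - 4%:R * q * Q);
           Q * (eu ^+ 2 - 9%:R * A ^+ 2 - 4%:R * q * Q)]))
  /\
  (forall c : 'I_3 -> R[i], class_function zeta c -> c 0 != 0 ->
   let a : Zc zeta c := Zc_const zeta c (c 0) in
   let q : Zc zeta c := Zc_pi c (q zetaP) in
   let Q : Zc zeta c := Zc_pi c (Q zetaP) in
   let eu : Zc zeta c := Zc_pi c (eu zeta) in
   let F := fixedZc zeta c 2 in
   let D := F `&` zeros (Zc_const zeta c)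
              [set eu ^+ 2 - 9%:R * a ^+ 2 - 4%:R * q * Q] in
   exists z_triv z_det z_nat : Zc zeta c -> R[i],
     [/\ is_zpoint (rho_triv zeta) z_triv,
         is_zpoint (rho_det zeta) z_det
       & is_zpoint (rho_nat zeta) z_nat] /\
     [/\ forall X, irreducible_component (Zc_const zeta c) F X <->
                      (X = D \/ X = [set z_nat]),
         D <> [set z_nat],
         dimension (Zc_const zeta c) D 2,
         D z_triv /\ D z_det
       & isolated (Zc_const zeta c) F z_nat]).
Proof.
split; first exact: fixedZ_presentation.
move=> c /(class_function_const zetaP) c_const c_neq0 /=.
have [z1 [z1P [[z1q z1Q z1e] z1o]]] := zpoint_triv zetaP c_const.
have [z2 [z2P [[z2q z2Q z2e] z2o]]] := zpoint_det zetaP c_const.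
have [z3 [z3P [[z3q z3Q z3e] z3o]]] := zpoint_nat zetaP c_const.
have fixed p : points (Zc_const zeta c) p -> odd0 zetaP (p \o Zc_pi c) -> fixedZc zeta c 2 p.
  by move=> pp po; apply/fixedZc2P.
have F1 : fixedZc zeta c 2 z1 by apply: fixed z1o; case: z1P.
have F2 : fixedZc zeta c 2 z2 by apply: fixed z2o; case: z2P.
have F3 : fixedZc zeta c 2 z3 by apply: fixed z3o; case: z3P.
rewrite mulr0 oppr0 in z3e; have z3g := And3 z3q z3Q z3e.
exists z1, z2, z3; split=> //; split.
- exact: (componentsP c_const c_neq0 F3 z3g).
- move=> E; apply: (origin_notD c_neq0 z3g); rewrite [X in X z3]E; exact: erefl.
- exact: dimension_D.
- split; apply/componentP; split=> //.
    by rewrite z1e z1q; ring.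
  by rewrite z2e z2q; ring.
- exact: (isolated_origin c_neq0 F3 z3g).
Qed.
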